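(* For every $n\ge 3$, every connected non-homotopic $n$-vertex $2$-planar graph has at most $5n-10$ edges.
   Context: Graphs are finite and have no loops, but may have parallel edges. A drawing on the sphere $\mathbb{S}^2$ maps vertices to pairwise distinct points and each edge to a simple Jordan arc joining its endpoints, such that no edge passes through a vertex, any two edges have finitely many common points, every common interior point of two edges is a proper crossing, and no three edges pass through the same crossing. A drawing is $k$-planar if every edge has at most $k$ crossings. A lens is a region bounded by a simple closed curve consisting of exactly two contiguous parts, each being (a part of) a single edge (e.g. two uncrossed parallel edges, parts of two adjacent edges that cross, or parts of two edges crossing more than once); a drawing is non-homotopic if every lens contains a vertex or a crossing in its interior. A non-homotopic $k$-planar graph is a graph admitting a drawing that is both non-homotopic and $k$-planar. *)

(* Defs.v *)
From HB Require Import structures.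
From mathcomp Require Import all_boot all_order all_algebra.
From mathcomp Require Import all_classical all_reals all_analysis.
Set Implicit Arguments. Unset Strict Implicit. Unset Printing Implicit Defensive.
Import Order.TTheory GRing.Theory Num.Theory.
Local Open Scope classical_set_scope.
Local Open Scope ring_scope.

Import numFieldTopology.Exports.
Section Drawings.
Variable R : realType.

Local Notation pt := (R * R * R)%type.
Definition sphere : set pt :=
  [set p | p.1.1 ^+ 2 + p.1.2 ^+ 2 + p.2 ^+ 2 = 1].
Definition I01 : set R := [set t | 0 <= t <= 1].
Definition I01o : set R := [set t | 0 < t < 1].
Definition open_disk : set (R * R) := [set q | q.1 ^+ 2 + q.2 ^+ 2 < 1].

(* A proper (transversal) crossing of the sets A and B at p on the sphere:
   a neighbourhood of p in S^2 is homeomorphic to the open unit disk by a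
   chart sending p to the origin, A to the horizontal axis and B to the
   vertical axis. *)
Definition proper_crossing (A B : set pt) (p : pt) : Prop :=
  exists (U : set pt) (h : pt -> R * R) (g : R * R -> pt),
    [/\ open U, U p & h p = (0, 0)] /\
    [/\ (forall x, U x -> sphere x -> open_disk (h x) /\ g (h x) = x),
        (forall y, open_disk y -> [/\ U (g y), sphere (g y) & h (g y) = y]),
        {within U `&` sphere, continuous h},
        {within open_disk, continuous g} &
        (forall x, U x -> sphere x ->
           (A x <-> (h x).2 = 0) /\ (B x <-> (h x).1 = 0))].

Variables (V E : finType) (ends : E -> V * V).

Record drawing := Drawing { pos : V -> pt; arc : E -> R -> pt }.

Definition edge_img (D : drawing) (e : E) : set pt := arc D e @` I01.

Definition is_drawing (D : drawing) : Prop :=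
  [/\ injective (pos D),
      (forall v, sphere (pos D v)) &
      (forall e, [/\ {within I01, continuous (arc D e)},
                    (forall s t, I01 s -> I01 t -> arc D e s = arc D e t -> s = t),
                    edge_img D e `<=` sphere,
                    arc D e 0 = pos D (ends e).1 &
                    arc D e 1 = pos D (ends e).2])] /\
  [/\
      (forall e t v, I01o t -> arc D e t <> pos D v),
      (forall e f, e != f -> exists s : seq pt,
          edge_img D e `&` edge_img D f `<=` [set` s]),
      (forall e f s t, e != f -> I01o s -> I01o t -> arc D e s = arc D f t ->
          proper_crossing (edge_img D e) (edge_img D f) (arc D e s)) &
      (forall e f g s t u, e != f -> f != g -> e != g ->
          I01o s -> I01o t -> I01o u ->
          arc D e s = arc D f t -> arc D f t = arc D g u -> False)].

Definition is_crossing (D : drawing) (p : pt) : Prop :=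
  exists e f s t, [/\ e != f, I01o s, I01o t, arc D e s = p & arc D f t = p].

Definition k_planar (k : nat) (D : drawing) : Prop :=
  forall e, exists s : seq pt, (size s <= k)%N /\
    [set p | exists t, [/\ I01o t, arc D e t = p &
                          exists f, f != e /\ edge_img D f p]] `<=` [set` s].

(* non-homotopic: every lens contains a vertex or a crossing.
   A lens is a connected component of S^2 minus a simple closed curve made of
   a sub-arc arc e [s1,t1] of an edge e and a sub-arc arc f [s2,t2] of an edge f,
   which meet exactly at their common endpoints. *)
Definition non_homotopic (D : drawing) : Prop :=
  forall e f (s1 t1 s2 t2 : R),
    0 <= s1 -> s1 < t1 -> t1 <= 1 -> 0 <= s2 -> s2 < t2 -> t2 <= 1 ->
    let A := arc D e @` [set t | s1 <= t <= t1] in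
    let B := arc D f @` [set t | s2 <= t <= t2] in
    A `&` B = [set arc D e s1] `|` [set arc D e t1] ->
    [set arc D f s2] `|` [set arc D f t2] = [set arc D e s1] `|` [set arc D e t1] ->
    forall x, sphere x -> ~ (A `|` B) x ->
      exists q, connected_component (sphere `\` (A `|` B)) x q /\
        ((exists v, q = pos D v) \/ is_crossing D q).

End Drawings.

Definition loopless (V E : finType) (ends : E -> V * V) : Prop :=
  forall e, (ends e).1 != (ends e).2.

Definition adj (V E : finType) (ends : E -> V * V) : rel V :=
  fun u v => [exists e, (ends e == (u, v)) || (ends e == (v, u))].

Definition mg_connected (V E : finType) (ends : E -> V * V) : Prop :=
  forall u v, connect (adj ends) u v.

Definition non_homotopic_k_planar (R : realType) (V E : finType)
  (ends : E -> V * V) (k : nat) : Prop :=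
  exists D : drawing R V E, is_drawing ends D /\ non_homotopic D /\ k_planar k D.

(* Main.v *)
(** Project the sphere stereographically from a point off the drawing and make
    every crossing a node of a plane graph.  Separation properties of the plane
    come from mod 2 cochains: [sig p x y] is the parity of the crossings of the
    chord [xy] with the horizontal ray issuing from [p], and two points [p], [q]
    off a compact set [K] lie in one component of its complement iff
    [sig p + sig q] is a coboundary on [K] (Borsuk).  Adding the segments one by
    one to a spanning tree then gives at least [#|S| + 2 - #|N|] faces.

    Let a segment weigh 2 plus the number of its ends that are vertices, and a
    face the sum of the weights of its sides.  With [m] the sum over the edges of
    their numbers of crossings, the faces weigh [8 #|E| + 4 m] altogether.  As
    there are no empty lenses, a face of weight at most 9 has at least three
    distinct sides; it is then bounded by middle segments of twice crossed edges,
    possibly with one uncrossed edge, or it is a triangle with one vertex opposite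
    to a middle segment.  Such a face can claim some of its middle segments in such
    a way that 10 is at most its weight plus twice the number of its claims, and
    two faces claiming the same segment would produce an empty lens.  Hence
    [10 F <= 8 #|E| + 5 m], which together with [F >= #|E| + m + 2 - #|N|] and
    [2 #|N| <= 2 n + m] gives the bound. *)

(* The constants are forced by the crossings. An edge with [k] crossings has [k + 1] segments and
   two real ends, and both sides of a segment count, whence [2 (2 (k + 1) + 2) = 8 + 4 k]. If all
   faces had weight at least 10, then [10 F <= 8 #|E| + 4 m]. Euler's relation and the count of
   nodes leave room for exactly one more [m], and at most [m / 2] middle segments worth 2 each
   supply it; then [m] cancels from the final inequality. Facial walks are never built. A face is a
   point off the drawing up to [linked]; it knows which segments it touches and, through [mult],
   whether on one side or on both. The cyclic structure is recovered only locally, from the four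
   quadrants at each crossing, which is why a handshake parity and lens contradictions stand where a
   boundary cycle would be followed. A lens is contradicted by describing its inside as a union of
   known faces and open segments, which leaves no place for a vertex or a crossing. *)
Require Import Defs.
From mathcomp Require Import all_boot all_order all_algebra.
From mathcomp Require Import all_classical all_reals all_analysis.
From mathcomp Require Import ring lra zify.
Set Implicit Arguments. Unset Strict Implicit. Unset Printing Implicit Defensive.
Import Order.TTheory GRing.Theory Num.Theory.
Import numFieldTopology.Exports numFieldNormedType.Exports.
Local Open Scope classical_set_scope.
Local Open Scope ring_scope.
Local Notation darc := Defs.arc.

(** * Parity cochains in the plane *)

Section PlaneSig.
Variable R : realType.
Local Notation P2 := (R * R)%type.
Implicit Types (p q x y z c a b : P2) (r d : R) (l : seq P2).

(** The open ball of the max norm, written as four linear inequalities so that [lra] settles every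
    comparison of nested balls. *)
Definition box r c x : Prop :=
  [/\ c.1 - r < x.1, x.1 < c.1 + r, c.2 - r < x.2 & x.2 < c.2 + r].

Lemma nnr r c p : ~ box r c p ->
  [\/ p.1 <= c.1 - r, c.1 + r <= p.1, p.2 <= c.2 - r | c.2 + r <= p.2].
Proof.
move=> h.
case: (leP p.1 (c.1 - r)) => h1; first exact: Or41.
case: (leP (c.1 + r) p.1) => h2; first exact: Or42.
case: (leP p.2 (c.2 - r)) => h3; first exact: Or43.
case: (leP (c.2 + r) p.2) => h4; first exact: Or44.
by case: h; split.
Qed.

Lemma box_refl r x : 0 < r -> box r x x.
Proof. by move=> r0; split; lra. Qed.

Lemma box_sym r x y : box r x y -> box r y x.
Proof. by case=> *; split; lra. Qed.

Lemma box_tri r d x y z : box r x y -> box d y z -> box (r + d) x z.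
Proof. by case=> ? ? ? ? [? ? ? ?]; split; lra. Qed.

Lemma box_le r d x y : r <= d -> box r x y -> box d x y.
Proof. by move=> ? [? ? ? ?]; split; lra. Qed.

Lemma box_gt0 r x y : box r x y -> 0 < r.
Proof. by case=> *; lra. Qed.

(** The ray test looks at the first end [x] only, so this is a crossing parity just for short
    chords: by [sig_coc] the choice of the end is immaterial in a box missing [p]. The half-open
    comparison [<=] counts a passage through the height of [p] once. *)
Definition sig p x y : bool := ((p.2 <= x.2) (+) (p.2 <= y.2)) && (p.1 < x.1).

(** A box missing [p] lies beyond [p] in one of the four axis directions. To the right of [p] the
    ray test always succeeds and [sig p] is the coboundary of the height test; in the other three
    directions it vanishes. *)
Lemma sig_coc c r p x y z : ~ box r c p -> box r c x -> box r c y -> box r c z ->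
  sig p x y (+) sig p y z = sig p x z.
Proof.
case/nnr=> h [x1 x2 x3 x4] [y1 y2 y3 y4] [z1 z2 z3 z4]; rewrite /sig.
- have -> : p.1 < x.1 by lra.
  have -> : p.1 < y.1 by lra.
  by rewrite !andbT; case: (_ <= x.2); case: (_ <= y.2); case: (_ <= z.2).
- have -> : (p.1 < x.1) = false by apply/negbTE; rewrite -leNgt; lra.
  have -> : (p.1 < y.1) = false by apply/negbTE; rewrite -leNgt; lra.
  by rewrite !andbF.
- have -> : p.2 <= x.2 by lra.
  have -> : p.2 <= y.2 by lra.
  by have -> : p.2 <= z.2 by lra.
- have -> : (p.2 <= x.2) = false by apply/negbTE; rewrite -ltNge; lra.
  have -> : (p.2 <= y.2) = false by apply/negbTE; rewrite -ltNge; lra.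
  by have -> : (p.2 <= z.2) = false by apply/negbTE; rewrite -ltNge; lra.
Qed.

Lemma sigxx p x : sig p x x = false.
Proof. by rewrite /sig addbb. Qed.

Lemma sig_sym c r p x y : ~ box r c p -> box r c x -> box r c y -> sig p x y = sig p y x.
Proof.
move=> h hx hy; have := sig_coc h hx hy hx; rewrite sigxx.
by case: (sig p x y); case: (sig p y x).
Qed.

Definition sigd p q x y := sig p x y (+) sig q x y.

(* Moving the base point of [sig] inside a box changes it, away from the box,
   by a coboundary. *)
Definition shift_cob p q x := ((p.2 <= x.2) (+) (q.2 <= x.2)) && (p.1 < x.1).

Lemma sig_shift_in c r p q x y : box r c p -> box r c q -> ~ box (r * 2) c x -> box r x y ->
  sigd p q x y = shift_cob p q x (+) shift_cob p q y.
Proof.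
move=> [p1 p2 p3 p4] [q1 q2 q3 q4] /nnr h [y1 y2 y3 y4]; rewrite /sigd /sig /shift_cob.
case: h => h.
- rewrite !(ltNge _ x.1) !(ltNge _ y.1).
  have -> : x.1 <= p.1 by lra.
  have -> : x.1 <= q.1 by lra.
  have -> : y.1 <= p.1 by lra.
  by rewrite !andbF.
- have -> : p.1 < x.1 by lra.
  have -> : p.1 < y.1 by lra.
  have -> : q.1 < x.1 by lra.
  rewrite !andbT.
  by case: (_ <= x.2); case: (_ <= y.2); case: (_ <= x.2); case: (_ <= y.2).
- rewrite !(leNgt _ x.2) !(leNgt _ y.2).
  have -> : x.2 < p.2 by lra.
  have -> : x.2 < q.2 by lra.
  have -> : y.2 < p.2 by lra.
  by have -> : y.2 < q.2 by lra.
- have -> : p.2 <= x.2 by lra.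
  have -> : p.2 <= y.2 by lra.
  have -> : q.2 <= x.2 by lra.
  by have -> : q.2 <= y.2 by lra.
Qed.

(** The same coboundary with the roles exchanged: here the chord is confined to a box and the base
    point moves outside its double. [sig_shift_in] serves a base point that moves while the set
    stays, this one a fixed chain under a base point running along a set. *)
Lemma sig_shift_out c r p q x y : box r c x -> box r c y -> ~ box (r * 2) c p -> box r p q ->
  sigd p q x y = shift_cob p q x (+) shift_cob p q y.
Proof.
move=> [x1 x2 x3 x4] [y1 y2 y3 y4] /nnr h [q1 q2 q3 q4]; rewrite /sigd /sig /shift_cob.
case: h => h.
- have -> : p.1 < x.1 by lra.
  have -> : p.1 < y.1 by lra.
  have -> : q.1 < x.1 by lra.
  rewrite !andbT.
  by case: (_ <= x.2); case: (_ <= y.2); case: (_ <= x.2); case: (_ <= y.2).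
- rewrite !(ltNge _ x.1) !(ltNge _ y.1).
  have -> : x.1 <= p.1 by lra.
  have -> : x.1 <= q.1 by lra.
  have -> : y.1 <= p.1 by lra.
  by rewrite !andbF.
- have -> : p.2 <= x.2 by lra.
  have -> : p.2 <= y.2 by lra.
  have -> : q.2 <= x.2 by lra.
  by have -> : q.2 <= y.2 by lra.
- rewrite !(leNgt _ x.2) !(leNgt _ y.2).
  have -> : x.2 < p.2 by lra.
  have -> : x.2 < q.2 by lra.
  have -> : y.2 < p.2 by lra.
  by have -> : y.2 < q.2 by lra.
Qed.

Fixpoint psum (t : P2 -> P2 -> bool) x l : bool :=
  if l is y :: l' then t x y (+) psum t y l' else false.

Lemma psum_cat t x l1 l2 : psum t x (l1 ++ l2) = psum t x l1 (+) psum t (last x l1) l2.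
Proof. by elim: l1 x => [|y l IH] x //=; rewrite IH addbA. Qed.

Lemma psumD t u x l : psum (fun a b => t a b (+) u a b) x l = psum t x l (+) psum u x l.
Proof.
elim: l x => [|y l IH] x //=; rewrite IH.
by case: (t x y); case: (u x y); case: (psum t y l); case: (psum u y l).
Qed.

Lemma addb_telescope (f : nat -> bool) n :
  \big[addb/false]_(0 <= i < n) (f i (+) f i.+1) = f 0 (+) f n.
Proof.
elim: n => [|n IH]; first by rewrite big_geq // addbb.
by rewrite big_nat_recr //= IH; case: (f 0); case: (f n); case: (f n.+1).
Qed.

Definition frac (N i : nat) : R := i%:R / N%:R.

Lemma frac_bd N i : (0 < N)%N -> (i <= N)%N -> 0 <= frac N i <= 1.
Proof.
move=> N0 iN; rewrite /frac divr_ge0 ?ler0n //= ler_pdivrMr ?ltr0n // mul1r ler_nat //.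
Qed.

Lemma frac_step N i : (0 < N)%N -> frac N i.+1 = frac N i + N%:R^-1.
Proof. by move=> N0; rewrite /frac -natr1 mulrDl mul1r. Qed.

Definition scl (t : R) x : P2 := (t * x.1, t * x.2).

(* H^1 of a star-shaped set vanishes: integrate the cocycle along rays. *)
Lemma coarse_trivial (S : P2 -> Prop) (M d : R) (t : P2 -> P2 -> bool) :
  0 < d -> (forall x, S x -> box M (0,0) x) ->
  (forall x s, S x -> 0 <= s <= 1 -> S (scl s x)) ->
  (forall x y z, S x -> S y -> S z -> box d x y -> box d y z -> box d x z ->
     t x y (+) t y z = t x z) ->
  exists e : P2 -> bool, forall x y, S x -> S y -> box (d / 2) x y ->
    t x y = e x (+) e y.
Proof.
move=> d0 SM Sst coc.
have [N N0 NM] : exists2 N : nat, (0 < N)%N & M / N%:R < d / 2.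
  have M0 : M < (Num.truncn (M / (d / 2))).+1%:R * (d / 2).
    by rewrite -ltr_pdivrMr ?truncnS_gt //; lra.
  exists (Num.truncn (M / (d / 2))).+1 => //.
  by rewrite ltr_pdivrMr ?ltr0n // mulrC.
pose A x i := scl (frac N i) x.
exists (fun x => \big[addb/false]_(0 <= i < N) t (A x i) (A x i.+1)).
move=> x y Sx Sy xy.
have SA z i : S z -> (i <= N)%N -> S (A z i).
  by move=> Sz iN; apply: Sst => //; exact: frac_bd.
have txx z : S z -> t z z = false.
  by move=> Sz; have := coc z z z Sz Sz Sz (box_refl _ d0) (box_refl _ d0) (box_refl _ d0);
     rewrite addbb.
have tsym u v : S u -> S v -> box d u v -> t u v = t v u.
  move=> Su Sv uv; have := coc u v u Su Sv Su uv (box_sym uv) (box_refl _ d0).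
  by rewrite txx //; case: (t u v); case: (t v u).
have Astep z i : S z -> (i < N)%N -> box (d / 2) (A z i) (A z i.+1).
  move=> /SM Sz iN; rewrite /A /scl frac_step // /box /= !mulrDl.
  case: Sz => /= *.
  have h1 : `|N%:R^-1 * z.1| < d / 2.
    rewrite normrM normfV normr_nat mulrC; apply: le_lt_trans NM.
    by rewrite ler_pM2r ?invr_gt0 ?ltr0n // ler_norml; apply/andP; split; lra.
  have h2 : `|N%:R^-1 * z.2| < d / 2.
    rewrite normrM normfV normr_nat mulrC; apply: le_lt_trans NM.
    by rewrite ler_pM2r ?invr_gt0 ?ltr0n // ler_norml; apply/andP; split; lra.
  by move: h1 h2; rewrite !ltr_norml => /andP[? ?] /andP[? ?]; split; lra.
have Axy i : (i <= N)%N -> box (d / 2) (A x i) (A y i).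
  move=> iN; have /andP[f0 f1] := frac_bd N0 iN.
  have hh (u v : R) : v - d / 2 < u -> u < v + d / 2 ->
      frac N i * v - d / 2 < frac N i * u /\ frac N i * u < frac N i * v + d / 2.
    move=> h1 h2; have : `|frac N i * (u - v)| < d / 2.
      rewrite normrM ger0_norm //; apply: le_lt_trans (_ : 1 * `|u - v| < _).
        by rewrite ler_wpM2r.
      by rewrite mul1r ltr_norml; apply/andP; split; lra.
    by rewrite mulrBr ltr_norml => /andP[? ?]; split; lra.
  case: xy => a1 a2 a3 a4.
  have [? ?] := hh _ _ a1 a2; have [? ?] := hh _ _ a3 a4.
  by split.
(* The cocycle rule on the two triangles of the thin quadrilateral between the two rays. Its sides
   are below [d / 2], which keeps the diagonal below [d]. *)
have sq i : (i < N)%N -> t (A x i) (A x i.+1) (+) t (A y i) (A y i.+1) =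
    t (A x i) (A y i) (+) t (A x i.+1) (A y i.+1).
  move=> iN; have iN' := ltnW iN.
  have dd : d / 2 <= d by lra.
  have n1 := Astep x i Sx iN; have n2 := Astep y i Sy iN.
  have n3 := Axy i iN'; have n4 := Axy i.+1 iN.
  have d2 : d / 2 + d / 2 <= d by lra.
  have c1 := coc (A x i) (A x i.+1) (A y i.+1) (SA _ _ Sx iN') (SA _ _ Sx iN) (SA _ _ Sy iN)
    (box_le dd n1) (box_le dd n4) (box_le d2 (box_tri n1 n4)).
  have c2 := coc (A x i) (A y i) (A y i.+1) (SA _ _ Sx iN') (SA _ _ Sy iN') (SA _ _ Sy iN)
    (box_le dd n3) (box_le dd n2) (box_le d2 (box_tri n1 n4)).
  move: c1; rewrite -c2; move: (t _ _) (t _ _) (t _ _) (t _ _) => b1 b2 b3 b4.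
  by case: b1; case: b2; case: b3; case: b4.
rewrite -big_split /= (eq_big_nat _ _ (F2 := fun i => t (A x i) (A y i) (+) t (A x i.+1) (A y i.+1))).
  rewrite addb_telescope.
  have -> : A x 0 = A y 0 by rewrite /A /scl /frac !mul0r.
  rewrite txx; last exact: SA.
  have AN z : A z N = z by case: z => z1 z2; rewrite /A /scl /frac divff ?pnatr_eq0 -?lt0n // !mul1r.
  by rewrite !AN.
by move=> i /andP[_ iN]; exact: sq.
Qed.

End PlaneSig.

(** * Subdivided segments and a loop around a point *)

Section PlaneChains.
Variable R : realType.
Local Notation P2 := (R * R)%type.
Implicit Types (p q x y z c a b : P2) (r d : R) (l : seq P2) (O K : set P2).

Fixpoint chainR (Q : P2 -> P2 -> Prop) x l : Prop :=
  if l is y :: l' then Q x y /\ chainR Q y l' else True.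

Lemma chainR_cat Q x l1 l2 : chainR Q x (l1 ++ l2) <-> chainR Q x l1 /\ chainR Q (last x l1) l2.
Proof.
elim: l1 x => [|y l IH] x /=; first by split=> // -[].
by rewrite IH; tauto.
Qed.

Lemma chainR_sub (Q Q' : P2 -> P2 -> Prop) x l :
  (forall u v, Q u v -> Q' u v) -> chainR Q x l -> chainR Q' x l.
Proof. by move=> h; elim: l x => [|y l IH] x //= [/h ? /IH]. Qed.

Lemma psum_cob (Q : P2 -> P2 -> Prop) (t : P2 -> P2 -> bool) (e : P2 -> bool) x l :
  (forall u v, Q u v -> t u v = e u (+) e v) -> chainR Q x l ->
  psum t x l = e x (+) e (last x l).
Proof.
move=> h; elim: l x => [|y l IH] x /=; first by rewrite addbb.
case=> /h -> /IH ->.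
by case: (e x); case: (e y); case: (e _).
Qed.

Definition lerp a b (s : R) : P2 := (a.1 + s * (b.1 - a.1), a.2 + s * (b.2 - a.2)).

Lemma lerp0 a b : lerp a b 0 = a.
Proof. by case: a => a1 a2; rewrite /lerp /= !mul0r !addr0. Qed.

Lemma lerp1 a b : lerp a b 1 = b.
Proof. by case: a b => a1 a2 [b1 b2]; rewrite /lerp /= !mul1r !subrKC. Qed.

Definition side a b N := [seq lerp a b (frac R N i) | i <- iota 1 N].

Lemma chain_side (Q : P2 -> P2 -> Prop) a b N : (0 < N)%N ->
  (forall s, 0 <= s -> s + N%:R^-1 <= 1 -> Q (lerp a b s) (lerp a b (s + N%:R^-1))) ->
  chainR Q a (side a b N) /\ last a (side a b N) = b.
Proof.
move=> N0 h.
have gen n k : (n + k <= N)%N ->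
  chainR Q (lerp a b (frac R N n)) [seq lerp a b (frac R N i) | i <- iota n.+1 k] /\
  last (lerp a b (frac R N n)) [seq lerp a b (frac R N i) | i <- iota n.+1 k] = lerp a b (frac R N (n + k)).
  elim: k n => [|k IH] n nk; first by rewrite addn0.
  have [c1 c2] := IH n.+1 (etrans (congr1 (fun m => (m <= N)%N) (addSnnS n k)) nk).
  split => /=; last by rewrite c2 addSnnS.
  split => //; rewrite frac_step //; apply: h.
    by have /andP[] := @frac_bd R N n N0 (leq_trans (leq_addr _ _) nk).
  rewrite -frac_step //; suff /andP[] : 0 <= frac R N n.+1 <= 1 by [].
  apply: frac_bd => //; apply: leq_trans nk; by rewrite addnS ltnS leq_addr.
have [c1 c2] := gen 0%N N (leqnn _); move: c1 c2; rewrite add0n.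
have -> : frac R N 0 = 0 by rewrite /frac mul0r.
have -> : frac R N N = 1 by rewrite /frac divff // pnatr_eq0 -lt0n.
by rewrite lerp0 lerp1.
Qed.

Definition square_side r a (k : nat) (s : R) : P2 :=
  nth (lerp (a.1 + r, a.2 + r) (a.1 - r, a.2 + r) s)
    [:: lerp (a.1 + r, a.2 + r) (a.1 - r, a.2 + r) s; lerp (a.1 - r, a.2 + r) (a.1 - r, a.2 - r) s;
        lerp (a.1 - r, a.2 - r) (a.1 + r, a.2 - r) s; lerp (a.1 + r, a.2 - r) (a.1 + r, a.2 + r) s] k.

(** The winding arguments use the two bounds; the parametrisation is kept for the compactness of the
    square, [ucpt_sqset]. *)
Definition on_square r a z :=
  [/\ ~ box r a z, box (r * 2) a z & exists k s, [/\ (k < 4)%N, 0 <= s <= 1 & z = square_side r a k s]].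

(** Three sides of the square miss the ray from [a]. On the right side [sig a] is the coboundary of
    [a.2 <= u.2], whose values at the two corners differ. *)
Lemma square_loop a r d : 0 < r -> 0 < d -> exists x l,
  [/\ chainR (fun u v => [/\ box d u v, on_square r a u & on_square r a v]) x l,
      last x l = x & psum (sig a) x l = true].
Proof.
move=> r0 d0.
have [N N0 Nd] : exists2 N : nat, (0 < N)%N & N%:R^-1 * (2 * r) < d.
  exists (Num.truncn ((2 * r) / d)).+1 => //.
  have := truncnS_gt ((2 * r) / d); rewrite ltr_pdivrMr // => h.
  by rewrite (mulrC _ (2 * r)) ltr_pdivrMr ?ltr0n //; lra.
have iN : 0 < N%:R^-1 :> R by rewrite invr_gt0 ltr0n.
set h := N%:R^-1 : R; rewrite -/h in Nd iN.
pose c0 : P2 := (a.1 + r, a.2 + r); pose c1 : P2 := (a.1 - r, a.2 + r).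
pose c2 : P2 := (a.1 - r, a.2 - r); pose c3 : P2 := (a.1 + r, a.2 - r).
pose Q u v := [/\ box d u v, on_square r a u & on_square r a v].
pose Qt (f : P2 -> bool) u v := Q u v /\ sig a u v = f u (+) f v.
have s0 : chainR (Qt (fun=> false)) c0 (side c0 c1 N) /\ last c0 (side c0 c1 N) = c1.
  apply: chain_side => // s s0 s1; rewrite -/h in s1 *.
  have sr : 0 <= s * r by apply: mulr_ge0; lra.
  have sr1 : (s + h) * r <= r by rewrite -[leRHS]mul1r ler_pM2r.
  have hr : 0 < h * r by exact: mulr_gt0.
  split; last first.
    rewrite /sig /lerp /=.
    have -> : a.2 <= a.2 + r + s * (a.2 + r - (a.2 + r)) by rewrite subrr mulr0; lra.
    by have -> : a.2 <= a.2 + r + (s + h) * (a.2 + r - (a.2 + r)) by rewrite subrr mulr0; lra.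
  split; first by split => /=; rewrite ?subrr ?mulr0; lra.
    split; [by case=> /=; rewrite ?subrr ?mulr0; lra|by split => /=; rewrite ?subrr ?mulr0; lra|].
    by exists 0%N, s; split=> //; apply/andP; split; lra.
  split; [by case=> /=; rewrite ?subrr ?mulr0; lra|by split => /=; rewrite ?subrr ?mulr0; lra|].
  by exists 0%N, (s + h); split=> //; apply/andP; split; lra.
have s1 : chainR (Qt (fun=> false)) c1 (side c1 c2 N) /\ last c1 (side c1 c2 N) = c2.
  apply: chain_side => // s s1 s2; rewrite -/h in s2 *.
  have sr : 0 <= s * r by apply: mulr_ge0; lra.
  have sr1 : (s + h) * r <= r by rewrite -[leRHS]mul1r ler_pM2r.
  have hr : 0 < h * r by exact: mulr_gt0.
  split; last first.
    rewrite /sig /lerp /= subrr mulr0 addr0 ltNge.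
    have -> : a.1 - r <= a.1 by lra.
    by rewrite andbF.
  split; first by split => /=; rewrite ?subrr ?mulr0; lra.
    split; [by case=> /=; rewrite ?subrr ?mulr0; lra|by split => /=; rewrite ?subrr ?mulr0; lra|].
    by exists 1%N, s; split=> //; apply/andP; split; lra.
  split; [by case=> /=; rewrite ?subrr ?mulr0; lra|by split => /=; rewrite ?subrr ?mulr0; lra|].
  by exists 1%N, (s + h); split=> //; apply/andP; split; lra.
have s2 : chainR (Qt (fun=> false)) c2 (side c2 c3 N) /\ last c2 (side c2 c3 N) = c3.
  apply: chain_side => // s s3 s2; rewrite -/h in s2 *.
  have sr : 0 <= s * r by apply: mulr_ge0; lra.
  have sr1 : (s + h) * r <= r by rewrite -[leRHS]mul1r ler_pM2r.
  have hr : 0 < h * r by exact: mulr_gt0.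
  split; last first.
    rewrite /sig /lerp /= subrr !mulr0 !addr0 leNgt.
    by have -> : a.2 - r < a.2 by lra.
  split; first by split => /=; rewrite ?subrr ?mulr0; lra.
    split; [by case=> /=; rewrite ?subrr ?mulr0; lra|by split => /=; rewrite ?subrr ?mulr0; lra|].
    by exists 2%N, s; split=> //; apply/andP; split; lra.
  split; [by case=> /=; rewrite ?subrr ?mulr0; lra|by split => /=; rewrite ?subrr ?mulr0; lra|].
  by exists 2%N, (s + h); split=> //; apply/andP; split; lra.
have s3 : chainR (Qt (fun u => a.2 <= u.2)) c3 (side c3 c0 N) /\ last c3 (side c3 c0 N) = c0.
  apply: chain_side => // s s3 s4; rewrite -/h in s4 *.
  have sr : 0 <= s * r by apply: mulr_ge0; lra.
  have sr1 : (s + h) * r <= r by rewrite -[leRHS]mul1r ler_pM2r.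
  have hr : 0 < h * r by exact: mulr_gt0.
  split; last first.
    rewrite /sig /=; have -> : a.1 < a.1 + r + s * (a.1 + r - (a.1 + r)) by rewrite subrr mulr0; lra.
    by rewrite andbT.
  split; first by split => /=; rewrite ?subrr ?mulr0; lra.
    split; [by case=> /=; rewrite ?subrr ?mulr0; lra|by split => /=; rewrite ?subrr ?mulr0; lra|].
    by exists 3%N, s; split=> //; apply/andP; split; lra.
  split; [by case=> /=; rewrite ?subrr ?mulr0; lra|by split => /=; rewrite ?subrr ?mulr0; lra|].
  by exists 3%N, (s + h); split=> //; apply/andP; split; lra.
exists c0, (side c0 c1 N ++ side c1 c2 N ++ side c2 c3 N ++ side c3 c0 N).
case: s0 s1 s2 s3 => s0 l0 [s1 l1] [s2 l2] [s3 l3].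
have QQ f u v : Qt f u v -> Q u v by case.
split; last 1 first.
- rewrite !psum_cat l0 l1 l2.
  rewrite (psum_cob (Q := Qt _) (fun u v (H : Qt _ u v) => H.2) s0) ?l0.
  rewrite (psum_cob (Q := Qt _) (fun u v (H : Qt _ u v) => H.2) s1) ?l1.
  rewrite (psum_cob (Q := Qt _) (fun u v (H : Qt _ u v) => H.2) s2) ?l2.
  rewrite (psum_cob (Q := Qt _) (fun u v (H : Qt _ u v) => H.2) s3) ?l3 /=.
  have -> : (a.2 <= a.2 - r) = false by apply/negbTE; rewrite -ltNge; lra.
  by have -> : a.2 <= a.2 + r by lra.
- rewrite !chainR_cat l0 l1 l2; split; first exact: (chainR_sub (@QQ _) s0).
  split; first exact: (chainR_sub (@QQ _) s1).
  by split; [exact: (chainR_sub (@QQ _) s2)|exact: (chainR_sub (@QQ _) s3)].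
- by rewrite !last_cat l0 l1 l2 l3.
Qed.

End PlaneChains.

(** * Connectedness by chains of boxes *)

Section PlaneLinks.
Variable R : realType.
Local Notation P2 := (R * R)%type.
Implicit Types (p q x y z c a b : P2) (r d : R) (l : seq P2) (O K : set P2).

(** The doubled box is the margin that [sig_shift_in] and [sig_shift_out] ask for when [O] is the
    complement of a set carrying the chord or the base point. *)
Definition step O x y := exists c r, [/\ box r c x, box r c y & box (r * 2) c `<=` O].
Definition linked O x y := exists l, chainR (step O) x l /\ last x l = y.

Lemma step_sym O x y : step O x y -> step O y x.
Proof. by case=> c [r [? ? ?]]; exists c, r. Qed.

Lemma step_sub O O' x y : O `<=` O' -> step O x y -> step O' x y.
Proof. by move=> OO [c [r [? ? h]]]; exists c, r; split=> // z /h/OO. Qed.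

Lemma step_in O x y : step O x y -> O x /\ O y.
Proof.
case=> c [r [xr yr h]]; have r0 := box_gt0 xr.
by split; apply: h; [move: xr|move: yr]; apply: box_le; lra.
Qed.

Lemma linked_refl O x : linked O x x.
Proof. by exists nil. Qed.

Lemma linked_step O x y : step O x y -> linked O x y.
Proof. by exists [:: y]. Qed.

Lemma linked_trans O x y z : linked O x y -> linked O y z -> linked O x z.
Proof.
case=> l [cl lx] [l' [cl' ly]]; exists (l ++ l'); rewrite last_cat lx; split=> //.
by apply/chainR_cat; rewrite lx.
Qed.

Lemma linked_sym O x y : linked O x y -> linked O y x.
Proof.
case=> l []; elim: l x => [|z l IH] x /=; first by move=> _ ->; exact: linked_refl.
case=> /step_sym xz /IH h /h zy; apply: linked_trans zy _; exact: linked_step.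
Qed.

Lemma linked_sub O O' x y : O `<=` O' -> linked O x y -> linked O' x y.
Proof.
move=> OO [l [cl lx]]; exists l; split=> //.
by apply: chainR_sub cl => u v; exact: step_sub.
Qed.

Lemma linked_in O x y : O x -> linked O x y -> O y.
Proof.
move=> Ox [l []]; elim: l x Ox => [|z l IH] x Ox /=; first by move=> _ <-.
case=> xz; have [_ Oz] := step_in xz; exact: IH.
Qed.

Definition opn O := forall x, O x -> exists2 r, 0 < r & box r x `<=` O.

Lemma opn_step O x : opn O -> O x -> exists2 r, 0 < r & forall y, box r x y -> step O x y.
Proof.
move=> oO /oO [r r0 h]; exists (r / 2); first by lra.
move=> y xy; exists x, (r / 2); split=> //; first by apply: box_refl; lra.
by have -> : r / 2 * 2 = r by lra.
Qed.

Lemma linked_opn O x : opn O -> O x -> opn (linked O x).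
Proof.
move=> oO Ox y xy; have [r r0 h] := opn_step oO (linked_in Ox xy).
by exists r => // z /h/linked_step; exact: linked_trans.
Qed.

Definition I01P (t : R) := 0 <= t /\ t <= 1.

(** Connectedness of the interval as a continuity induction: a locally constant property that holds
    somewhere holds everywhere. Arguments along a path go through it. *)
Lemma I01_ind (Q : R -> Prop) :
  (forall t, I01P t -> exists2 e, 0 < e & forall s, I01P s -> `|s - t| < e -> (Q s <-> Q t)) ->
  forall t t', I01P t -> I01P t' -> Q t -> Q t'.
Proof.
move=> h t0 t1 I0 I1 Q0.
(* The hypothesis is relative to the interval; [C A] is an open subset of the line with the same
   trace on it. *)
pose C (A : R -> Prop) : set R := [set t | exists t' e, [/\ I01P t', A t', 0 < e, `|t - t'| < e &
  forall s, I01P s -> `|s - t'| < e -> A s]].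
have Co A : open (C A).
  rewrite openE => t [t' [e [I' At' e0 te hs]]].
  apply/nbhs_ballP; exists (e - `|t - t'|) => /=; first by lra.
  move=> s /=; rewrite /ball /= => ts; exists t', e; split=> //.
  have := ler_distD t s t'; rewrite (distrC s t); lra.
have CP A : (forall t, I01P t -> exists2 e, 0 < e & forall s, I01P s -> `|s - t| < e -> (A s <-> A t)) ->
    forall t, I01P t -> C A t <-> A t.
  move=> hA t It; split.
    by case=> t' [e [? ? ? te hs]]; exact: hs.
  move=> At; have [e e0 he] := hA _ It; exists t, e; split=> //; first by rewrite subrr normr0.
  by move=> s Is /(he _ Is) ->.
have hn : forall t, I01P t -> exists2 e, 0 < e & forall s, I01P s -> `|s - t| < e -> (~ Q s <-> ~ Q t).
  by move=> t /h [e e0 he]; exists e => // s Is /(he _ Is) ->.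
have IE (t : R) : `[0, 1]%classic t <-> I01P t.
  by rewrite /= in_itv /=; split => [/andP[]|[-> ->]].
have : [set t | I01P t /\ Q t] = `[0, 1]%classic.
  apply: segment_connected.
  - by exists t0.
  - exists (C Q); first exact: Co.
    apply/seteqP; split => t /=.
      by move=> [It Qt]; split; [apply/IE|apply/(CP _ h)].
    by move=> [/IE It /(CP _ h _ It)].
  - exists (~` C (fun t => ~ Q t)); first by apply: open_closedC; exact: Co.
    apply/seteqP; split => t /=.
      by move=> [It Qt]; split; [apply/IE|move=> /(CP _ hn _ It)].
    by move=> [/IE It nC]; split=> //; apply: contrapT => /(CP _ hn _ It).
by move/seteqP => [_ /(_ t1 (proj2 (IE t1) I1))] [].
Qed.

Definition pcts (g : R -> P2) := forall t, I01P t -> forall e, 0 < e -> exists2 d, 0 < d &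
  forall s, I01P s -> `|s - t| < d -> box e (g t) (g s).

Lemma path_linked O g : opn O -> pcts g -> (forall t, I01P t -> O (g t)) ->
  forall t t', I01P t -> I01P t' -> linked O (g t) (g t').
Proof.
move=> oO cg gO t t' It It'.
apply: (I01_ind (Q := fun s => linked O (g t) (g s))) It It' (linked_refl _ _) => s Is.
have [r r0 h] := opn_step oO (gO _ Is).
have [d d0 hd] := cg _ Is _ r0.
exists d => // s' Is' /(hd _ Is') /h /linked_step ss'.
by split=> hh; apply: linked_trans hh _ => //; exact: linked_sym.
Qed.

Lemma lerp_cts a b : pcts (lerp a b).
Proof.
move=> t It e e0; pose M := `|b.1 - a.1| + `|b.2 - a.2| + 1.
have M0 : 0 < M by have := normr_ge0 (b.1 - a.1); have := normr_ge0 (b.2 - a.2); rewrite /M; lra.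
exists (e / M); first by exact: divr_gt0.
move=> s Is; rewrite ltr_pdivlMr // => h.
have hh (u : R) : `|u| <= M -> - e < (s - t) * u < e.
  move=> uM; rewrite -ltr_norml normrM; apply: le_lt_trans h.
  by rewrite ler_wpM2l.
have /andP[? ?] : - e < (s - t) * (b.1 - a.1) < e.
  by apply: hh; rewrite /M; have := normr_ge0 (b.2 - a.2); lra.
have /andP[? ?] : - e < (s - t) * (b.2 - a.2) < e.
  by apply: hh; rewrite /M; have := normr_ge0 (b.1 - a.1); lra.
by split => /=; lra.
Qed.

Lemma I01P0 : I01P 0. Proof. by split; lra. Qed.
Lemma I01P1 : I01P 1. Proof. by split; lra. Qed.

Lemma seg_linked O a b : opn O -> (forall t, I01P t -> O (lerp a b t)) -> linked O a b.
Proof.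
move=> oO h; have := path_linked oO (@lerp_cts a b) h I01P0 I01P1.
by rewrite lerp0 lerp1.
Qed.

Lemma box_opn r c : opn (box r c).
Proof.
move=> x [h1 h2 h3 h4].
pose d := Num.min (Num.min (x.1 - (c.1 - r)) (c.1 + r - x.1)) (Num.min (x.2 - (c.2 - r)) (c.2 + r - x.2)).
exists d; first by rewrite /d !lt_min; apply/andP; split; apply/andP; split; lra.
have : d <= d by []; rewrite {2}/d !le_min => /andP[/andP[? ?] /andP[? ?]].
by move=> y [*]; split; lra.
Qed.

Lemma lerp_bd (u v a b t : R) : I01P t -> a < u -> u < b -> a < v -> v < b ->
  a < u + t * (v - u) < b.
Proof.
move=> [t0 t1] au ub av vb.
have h1 : 0 <= t * (v - a) by apply: mulr_ge0; lra.
have h2 : 0 <= (1 - t) * (u - a) by apply: mulr_ge0; lra.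
have h3 : 0 <= t * (b - v) by apply: mulr_ge0; lra.
have h4 : 0 <= (1 - t) * (b - u) by apply: mulr_ge0; lra.
(* Strictness comes from the end whose weight is at least one half. *)
case: (leP t (1/2)) => t2.
  have h5 : 0 < (1 - t) * (u - a) by apply: mulr_gt0; lra.
  have h6 : 0 < (1 - t) * (b - u) by apply: mulr_gt0; lra.
  by apply/andP; split; lra.
have h5 : 0 < t * (v - a) by apply: mulr_gt0; lra.
have h6 : 0 < t * (b - v) by apply: mulr_gt0; lra.
by apply/andP; split; lra.
Qed.

Lemma box_lerp r c a b t : I01P t -> box r c a -> box r c b -> box r c (lerp a b t).
Proof.
move=> It [? ? ? ?] [? ? ? ?].
have /andP[? ?] : c.1 - r < a.1 + t * (b.1 - a.1) < c.1 + r by apply: lerp_bd.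
have /andP[? ?] : c.2 - r < a.2 + t * (b.2 - a.2) < c.2 + r by apply: lerp_bd.
by split.
Qed.

Lemma linked_ball O x y z r : box r x `<=` O -> box r x y -> box r x z -> linked O y z.
Proof.
move=> h xy xz; apply: linked_sub h _; apply: seg_linked; first exact: box_opn.
by move=> t It; exact: box_lerp.
Qed.

Definition cls K := opn (~` K).

(* The parity of the winding of a closed chain around a point does not change
   along a path avoiding the chain. *)
Lemma closed_chain_parity K g x l : pcts g -> (forall t, I01P t -> K (g t)) ->
  chainR (step (~` K)) x l -> last x l = x ->
  psum (sig (g 0)) x l = psum (sig (g 1)) x l.
Proof.
move=> cg gK cl lx.
(* Along the finite chain the terms of [shift_cob] telescope, so a small move of [p] changes the
   total by the difference at its two ends, which coincide for a closed chain. *)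
have [d d0 hd] : exists2 d, 0 < d & forall p q, K p -> box d p q ->
    psum (sigd p q) x l = shift_cob p q x (+) shift_cob p q (last x l).
  elim: l x cl {lx} => [|y l IH] x /=; first by move=> _; exists 1 => // *; rewrite addbb.
  case=> -[c [r [cx cy h]]] /IH [d d0 hd]; have r0 := box_gt0 cx.
  exists (Num.min r d); first by rewrite lt_min r0.
  move=> p q Kp pq; rewrite (@sig_shift_out _ c r p q x y) //.
  - rewrite hd //; last by apply: box_le pq; rewrite ge_min lexx orbT.
    by case: (shift_cob p q x); case: (shift_cob p q y); case: (shift_cob p q _).
  - by move=> /h.
  - by apply: box_le pq; rewrite ge_min lexx.
apply/esym; apply: (I01_ind (Q := fun s => psum (sig (g s)) x l = psum (sig (g 0)) x l)) I01P0 I01P1 (erefl _).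
move=> t It; have [e e0 he] := cg _ It _ d0; exists e => // s Is st.
have := hd _ _ (gK _ It) (he _ Is st); rewrite lx addbb psumD.
by case: (psum (sig (g t)) x l); case: (psum (sig (g s)) x l); case: (psum (sig (g 0)) x l).
Qed.

(** A coboundary at some scale: the class of [t] in the first Alexander-Spanier cohomology of [K]
    modulo 2 vanishes. *)
Definition triv (t : P2 -> P2 -> bool) K := exists2 d, 0 < d & exists e : P2 -> bool,
  forall x y, K x -> K y -> box d x y -> t x y = e x (+) e y.

(** The easy half of Borsuk's criterion: each step of the base point adds the coboundary of
    [shift_cob]. *)
Lemma linked_triv K p q : linked (~` K) p q -> triv (sigd p q) K.
Proof.
case=> l []; elim: l p => [|z l IH] p /=.
  by move=> _ ->; exists 1 => //; exists (fun=> false) => x y _ _ _; rewrite /sigd addbb.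
case=> -[c [r [cx cz h]]] /[swap] lq /IH /(_ lq) [d d0 [e he]]; have r0 := box_gt0 cx.
exists (Num.min r d); first by rewrite lt_min r0.
exists (fun x => shift_cob p z x (+) e x) => x y Kx Ky xy.
have h1 : box r x y by apply: box_le xy; rewrite ge_min lexx.
have h2 : box d x y by apply: box_le xy; rewrite ge_min lexx orbT.
have := he _ _ Kx Ky h2; have := @sig_shift_in _ c r p z x y cx cz _ h1.
rewrite /sigd => /(_ (fun hh => h _ hh Kx)).
case: (sig p x y); case: (sig q x y); case: (sig z x y); case: (shift_cob p z x);
  case: (shift_cob p z y); case: (e x); case: (e y) => //= H1 H2; by [move: (H1)|move: (H2)].
Qed.

End PlaneLinks.

(** * Compactness, gluing of primitives, and arcs *)

Section PlaneArcs.
Variable R : realType.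
Local Notation P2 := (R * R)%type.
Implicit Types (p q x y z c a b : P2) (r d : R) (l : seq P2) (O K A B : set P2).

(** Compactness drawn from connectedness: that a bound is uniform on [[0, s]] is a locally constant
    property of [s]. *)
Lemma I01_unif (Q : R -> R -> Prop) :
  (forall t r r', 0 < r' -> r' <= r -> Q t r -> Q t r') ->
  (forall t, I01P t -> exists r e, [/\ 0 < r, 0 < e &
     forall s, I01P s -> `|s - t| < e -> Q s r]) ->
  exists2 r, 0 < r & forall t, I01P t -> Q t r.
Proof.
move=> mono loc.
pose S s := exists2 r, 0 < r & forall t, 0 <= t -> t <= s -> Q t r.
have S1 : S 1.
  apply: (I01_ind (Q := S)) (@I01P0 R) (@I01P1 R) _; last first.
    have [r [e [r0 e0 h]]] := loc _ (@I01P0 R); exists r => // t t0 t1.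
    have -> : t = 0 by lra.
    by apply: h; rewrite ?subrr ?normr0 //; exact: I01P0.
  move=> s Is; have [r [e [r0 e0 h]]] := loc _ Is; exists e => // s' Is' ss'.
  have min0 r1 : 0 < r1 -> 0 < Num.min r r1 by move=> ?; rewrite lt_min r0.
  have [s0 s1] := Is; have [s0' s1'] := Is'.
  move: ss'; rewrite ltr_norml => /andP[? ?].
  split=> -[r1 r10 h1]; exists (Num.min r r1); rewrite ?min0 // => t t0 ts.
    case: (leP t s') => tt.
      by apply: mono (h1 t t0 tt); rewrite ?min0 // ge_min lexx orbT.
    apply: mono (h t _ _); rewrite ?min0 ?ge_min ?lexx //; first by split; lra.
    by rewrite ltr_norml; apply/andP; split; lra.
  case: (leP t s) => tt.
    by apply: mono (h1 t t0 tt); rewrite ?min0 // ge_min lexx orbT.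
  apply: mono (h t _ _); rewrite ?min0 ?ge_min ?lexx //; first by split; lra.
  by rewrite ltr_norml; apply/andP; split; lra.
by case: S1 => r r0 h; exists r => // t [? ?]; exact: h.
Qed.

(* Compactness, in the form in which it is used: local bounds become uniform. *)
Definition ucpt K := forall Q : P2 -> R -> Prop,
  (forall x r r', 0 < r' -> r' <= r -> Q x r -> Q x r') ->
  (forall x, K x -> exists2 r, 0 < r & forall x', K x' -> box r x x' -> Q x' r) ->
  exists2 r, 0 < r & forall x, K x -> Q x r.

Definition arci (g : R -> P2) : set P2 := [set x | exists2 t, I01P t & g t = x].

Lemma ucpt_arc g : pcts g -> ucpt (arci g).
Proof.
move=> cg Q mono loc.
have [|t It|r r0 h] := @I01_unif (fun t r => Q (g t) r).
- by move=> t r r'; exact: mono.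
- have [r r0 h] := loc (g t) (ex_intro2 _ _ t It (erefl _)).
  have [d d0 hd] := cg _ It _ r0.
  exists r, d; split=> // s Is /(hd _ Is); apply: h; by exists s.
- by exists r => // x [t It <-]; exact: h.
Qed.

Lemma ucptU A B : ucpt A -> ucpt B -> ucpt (A `|` B).
Proof.
move=> cA cB Q mono loc.
have [x Ax|r r0 hA] := cA Q mono.
- by have [r r0 h] := loc x (or_introl Ax); exists r => // x' Ax'; apply: h; left.
have [x Bx|r' r'0 hB] := cB Q mono.
- by have [s s0 h] := loc x (or_intror Bx); exists s => // x' Bx'; apply: h; right.
have m0 : 0 < Num.min r r' by rewrite lt_min r0.
exists (Num.min r r') => // x [/hA|/hB]; apply: mono => //; by rewrite ge_min lexx ?orbT.
Qed.

Lemma ucpt0 : ucpt set0.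
Proof. by move=> Q _ _; exists 1. Qed.

Lemma nnr_sep x z : x <> z -> exists2 r, 0 < r & ~ box r z x.
Proof.
case: x z => x1 x2 [z1 z2] xz.
have [e1|n1] := eqVneq x1 z1.
  have n2 : x2 != z2 by apply/eqP => e2; apply: xz; rewrite e1 e2.
  exists `|x2 - z2|; first by rewrite normr_gt0 subr_eq0.
  case=> /= _ _ h3 h4; have : `|x2 - z2| < `|x2 - z2| by rewrite ltr_norml; apply/andP; split; lra.
  by rewrite ltxx.
exists `|x1 - z1|; first by rewrite normr_gt0 subr_eq0.
case=> /= h3 h4 _ _; have : `|x1 - z1| < `|x1 - z1| by rewrite ltr_norml; apply/andP; split; lra.
by rewrite ltxx.
Qed.

Lemma ucpt_cls K : ucpt K -> cls K.
Proof.
move=> cK z Kz.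
have [|x Kx|r r0 h] := cK (fun x r => ~ box r z x).
- by move=> x r r' _ real_ends h; apply: contra_not h; exact: box_le.
- have [r r0 h] : exists2 r, 0 < r & ~ box r z x by apply: nnr_sep => xz; apply: Kz; rewrite -xz.
  exists (r / 2) => [|x' _ xx' zx']; first by lra.
  by apply: h; apply: box_le (box_tri zx' (box_sym xx')); lra.
- by exists r => // x zx Kx; exact: h zx.
Qed.

Lemma box_ex x : exists2 M, 0 < M & box M (0, 0) x.
Proof.
have h1 := normr_ge0 x.1; have h2 := normr_ge0 x.2.
have := ler_norm x.1; have := ler_norm (- x.1); have := ler_norm x.2; have := ler_norm (- x.2).
rewrite !normrN => *; exists (`|x.1| + `|x.2| + 1); first by lra.
by split => /=; lra.
Qed.

Lemma ucpt_bounded K : ucpt K -> exists2 M, 0 < M & forall x, K x -> box M (0, 0) x.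
Proof.
move=> cK; have [|x Kx|r r0 h] := cK (fun x r => box r^-1 (0, 0) x).
- by move=> x r r' r0 real_ends; apply: box_le; rewrite lef_pV2 ?posrE //; exact: lt_le_trans real_ends.
- have [M M0 xM] := box_ex x; exists (M + 1)^-1; first by rewrite invr_gt0; lra.
  move=> x' _ xx'; rewrite invrK.
  have : (M + 1)^-1 <= 1 by rewrite invf_le1; lra.
  by move=> h; apply: box_tri xM _; exact: box_le xx'.
- by exists r^-1; rewrite ?invr_gt0.
Qed.

Lemma cls_away K p : cls K -> ~ K p -> exists2 r, 0 < r & forall x, K x -> ~ box r x p.
Proof. by move=> cK /cK [r r0 h]; exists r => // x Kx /box_sym/h; exact. Qed.

Lemma sigd_coc c r p q x y z : ~ box r c p -> ~ box r c q ->
  box r c x -> box r c y -> box r c z -> sigd p q x y (+) sigd p q y z = sigd p q x z.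
Proof.
move=> h1 h2 cx cy cz; rewrite /sigd -(sig_coc h1 cx cy cz) -(sig_coc h2 cx cy cz).
by case: (sig p x y); case: (sig q x y); case: (sig p y z); case: (sig q y z).
Qed.

Lemma sigd_sym c r p q x y : ~ box r c p -> ~ box r c q ->
  box r c x -> box r c y -> sigd p q x y = sigd p q y x.
Proof. by move=> h1 h2 cx cy; rewrite /sigd (sig_sym h1) // (sig_sym h2). Qed.

(** Mayer-Vietoris for primitives. By compactness of [A], a point of [A] close to [B] is close to a
    common point [k], where the two primitives agree; the cocycle rule on the triangle through [k]
    handles mixed chords. *)
Lemma triv_glue A B p q d (eA eB : P2 -> bool) : ucpt A -> cls B ->
  ~ A p -> ~ A q -> ~ B p -> ~ B q -> 0 < d ->
  (forall x y, A x -> A y -> box d x y -> sigd p q x y = eA x (+) eA y) ->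
  (forall x y, B x -> B y -> box d x y -> sigd p q x y = eB x (+) eB y) ->
  (forall k, A k -> B k -> eA k = eB k) -> triv (sigd p q) (A `|` B).
Proof.
move=> cA cB Ap Aq Bp Bq d0 hA hB eAB.
have [r1 r10 h1] := cls_away (ucpt_cls cA) Ap.
have [r2 r20 h2] := cls_away (ucpt_cls cA) Aq.
(* A box of radius [3 m] around a point of [A] misses [p] and [q] and holds the whole triangle,
   whose sides are short enough for both primitives. *)
pose m := Num.min d (Num.min r1 r2) / 3.
have m0 : 0 < m by rewrite divr_gt0 // !lt_min d0 r10 r20.
have [md m1 m2] : [/\ m * 3 <= d, m * 3 <= r1 & m * 3 <= r2].
  by split; rewrite /m divfK ?pnatr_eq0 // !ge_min lexx ?orbT.
have [|x Ax|r r0 hr] := cA (fun x r => forall y, B y -> box r x y ->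
   exists k, [/\ A k, B k & box m x k]).
- by move=> x r r' _ real_ends h y By xy; apply: h By _; exact: box_le xy.
- case: (pselect (B x)) => Bx.
    by exists m => // x' _ xx' y By x'y; exists x; split=> //; exact: box_sym.
  have [r r0 h] := cB _ Bx; exists (r / 2) => [|x' _ xx' y By x'y]; first by lra.
  by case: (h y) => //; apply: box_le (box_tri xx' x'y); lra.
pose s := Num.min r m.
have s0 : 0 < s by rewrite lt_min r0.
have [sr sm] : s <= r /\ s <= m by split; rewrite ge_min lexx ?orbT.
pose e x := if pselect (A x) then eA x else eB x.
have eA' x : A x -> e x = eA x by rewrite /e; case: pselect.
have eB' x : B x -> e x = eB x by move=> Bx; rewrite /e; case: pselect => // Ax; exact: eAB.
have key x y : A x -> B y -> box s x y ->
    sigd p q x y = e x (+) e y /\ sigd p q y x = e y (+) e x.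
  move=> Ax By xy; have [k [Ak Bk xk]] := hr x Ax y By (box_le sr xy).
  pose m3 := m * 3.
  have n1 : ~ box m3 x p by move=> /(box_le m1); exact: h1.
  have n2 : ~ box m3 x q by move=> /(box_le m2); exact: h2.
  have xx : box m3 x x by apply: box_refl; rewrite /m3; lra.
  have xk' : box m3 x k by apply: box_le xk; rewrite /m3; lra.
  have xy' : box m3 x y by apply: box_le xy; rewrite /m3; lra.
  suff h : sigd p q x y = e x (+) e y by rewrite -(sigd_sym n1 n2 xx xy') h addbC.
  rewrite -(sigd_coc n1 n2 xx xk' xy') hA //; last by apply: box_le xk; lra.
  rewrite hB //; last by apply: box_le (box_tri (box_sym xk) xy); lra.
  rewrite (eA' x) // (eB' y) // (eAB k) //.
  by case: (eA x); case: (eB k); case: (eB y).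
exists s => //; exists e => x y Kx Ky xy.
case: Kx Ky => [Ax|Bx] [Ay|By].
- by rewrite !eA' // hA //; apply: box_le xy; lra.
- by have [] := key x y Ax By xy.
- by have [] := key y x Ay Bx (box_sym xy).
- by rewrite !eB' // hB //; apply: box_le xy; lra.
Qed.

Definition pinj (g : R -> P2) := forall s t : R, I01P (R:=R) s -> I01P t -> g s = g t -> s = t.

Lemma pcts_unif g e : pcts g -> 0 < e -> exists2 d, 0 < d &
  forall s t, I01P (R:=R) s -> I01P t -> `|s - t| < d -> box e (g s) (g t).
Proof.
move=> cg e0.
have [|t It|d d0 h] := @I01_unif (fun t r => forall s, I01P s -> `|t - s| < r -> box e (g t) (g s)).
- by move=> t r r' _ real_ends h s Is ts; apply: h => //; lra.
- have e20 : 0 < e / 2 by lra.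
  have [d d0 h] := cg _ It _ e20; exists (d / 2), (d / 2); split; [by lra|by lra|].
  move=> s Is st s' Is' ss'.
  have ts : box (e / 2) (g t) (g s) by apply: h => //; lra.
  have ts' : box (e / 2) (g t) (g s').
    apply: h => //; have := ler_distD s s' t; rewrite (distrC s' s); lra.
  by apply: box_le (box_tri (box_sym ts) ts'); lra.
- by exists d => // s t Is It; exact: h.
Qed.

(** Uniform continuity of the inverse of an arc. Compactness is used twice: for a fixed [t] over the
    parameters at distance at least [e / 2], then over [t]. *)
Lemma arc_inv_unif g e : pcts g -> pinj g -> 0 < e -> exists2 d, 0 < d &
  forall s t, I01P (R:=R) s -> I01P t -> box d (g s) (g t) -> `|s - t| < e.
Proof.
move=> cg ig e0.
have [|t It|d d0 h] := @I01_unif (fun t r => forall s, I01P s -> box r (g t) (g s) -> `|t - s| < e).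
- by move=> t r r' _ real_ends h s Is ts; apply: h => //; exact: box_le ts.
- have [|t1 It1|d d0 h] := @I01_unif (fun s r => e / 2 <= `|s - t| -> ~ box r (g t) (g s)).
  + by move=> s r r' _ real_ends h /h; apply: contra_not; exact: box_le.
  + case: (ltP `|t1 - t| (e / 2)) => h1.
      exists 1, (e / 2 - `|t1 - t|); split=> //; first by lra.
      by move=> s Is ss; have := ler_distD t1 s t; lra.
    have gg : g t1 <> g t.
      by move=> gg; move: h1; rewrite (ig _ _ It1 It gg) subrr normr0; lra.
    have [r r0 hr] := nnr_sep gg.
    have r20 : 0 < r / 2 by lra.
    have [d d0 hd] := cg _ It1 _ r20; exists (r / 2), d; split=> // s Is /(hd _ Is) n1 _ n2.
    by apply: hr; apply: box_le (box_tri n2 (box_sym n1)); lra.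
  + have d20 : 0 < d / 2 by lra.
    have [d' d'0 hd'] := cg _ It _ d20.
    pose e' := Num.min d' (e / 2); have e'0 : 0 < e' by rewrite lt_min d'0 /=; lra.
    exists (d / 2), e'; split=> // s Is; rewrite lt_min => /andP[st1 st2] s' Is' ss'.
    have n1 := hd' _ Is st1.
    have : ~ (e / 2 <= `|s' - t|).
      move=> /(h _ Is'); apply; apply: box_le (box_tri n1 ss'); lra.
    move=> /negP; rewrite -ltNge => h2; have := ler_distD t s s'; rewrite (distrC t s'); lra.
- by exists d => // s t Is It; exact: h.
Qed.

(** An arc carries no first cohomology: read on the parameter interval, the cocycle lives on a
    star-shaped set, and [arc_inv_unif] brings the primitive back to the points of the arc. *)
Lemma arc_triv g p : pcts g -> pinj g -> ~ arci g p -> triv (sig p) (arci g).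
Proof.
move=> cg ig gp.
have [r r0 hr] := cls_away (ucpt_cls (ucpt_arc cg)) gp.
have [d d0 hd] := pcts_unif cg r0.
(* [coarse_trivial] is stated in the plane, so the interval is laid on the first axis. *)
pose S (x : P2) := I01P x.1 /\ x.2 = 0.
have [x [[x1 x2] x3]|[x1 x2] s [[/= ? ?] ->] /andP[? ?]|x y z|e he] :=
    @coarse_trivial R S 2 d (fun x y => sig p (g x.1) (g y.1)) d0.
- by split => /=; lra.
- split => /=; last by rewrite mulr0.
  split; first exact: mulr_ge0.
  by rewrite -[leRHS]mulr1 ler_pM.
- move=> [Ix _] [Iy _] [Iz _] [a1 a2 _ _] _ [b1 b2 _ _].
  have gx : arci g (g x.1) by exists x.1.
  apply: sig_coc (hr _ gx) _ _ _; first exact: box_refl.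
  - by apply: hd => //; rewrite ltr_norml; apply/andP; split; lra.
  - by apply: hd => //; rewrite ltr_norml; apply/andP; split; lra.
have d20 : 0 < d / 2 by lra.
have [d' d'0 hd'] := arc_inv_unif cg ig d20.
pose k x := xget 0 [set t | I01P t /\ g t = x].
have kP x : arci g x -> I01P (k x) /\ g (k x) = x.
  by move=> [t It gt]; rewrite /k; case: xgetP => [s _ //|/(_ t) []].
exists d' => //; exists (fun x => e (k x, 0)) => x y /kP[Ix gx] /kP[Iy gy] xy.
rewrite -[in LHS]gx -[in LHS]gy; apply: (he (k x, 0) (k y, 0)); try by split.
have : `|k x - k y| < d / 2 by apply: hd' => //; rewrite gx gy.
by rewrite ltr_norml => /andP[? ?]; split => /=; lra.
Qed.

Lemma trivD p q K : triv (sig p) K -> triv (sig q) K -> triv (sigd p q) K.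
Proof.
case=> d d0 [e he] [d' d'0 [e' he']]; exists (Num.min d d'); first by rewrite lt_min d0.
exists (fun x => e x (+) e' x) => x y Kx Ky xy; rewrite /sigd he //; last first.
  by apply: box_le xy; rewrite ge_min lexx.
rewrite he' //; last by apply: box_le xy; rewrite ge_min lexx orbT.
by case: (e x); case: (e y); case: (e' x); case: (e' y).
Qed.

End PlaneArcs.

(** * Borsuk's criterion and its consequences for arcs *)

Section PlaneSeparation.
Variable R : realType.
Local Notation P2 := (R * R)%type.
Implicit Types (p q x y z c a b : P2) (r d : R) (l : seq P2) (O K A B : set P2).

(** The outside of the box is a union of four half planes missing [K], and neighbouring ones overlap
    beyond the corners. *)
Lemma linked_far K M z : 0 < M -> cls K -> (forall x, K x -> box M (0, 0) x) -> ~ box M (0, 0) z ->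
  linked (~` K) (M, M) z.
Proof.
move=> M0 cK KM.
have lin (f : P2 -> R) a b : (forall t, I01P t -> Num.min (f a) (f b) <= f (lerp a b t)) ->
    (forall x, f x >= M -> ~ box M (0, 0) x) -> M <= f a -> M <= f b -> linked (~` K) a b.
  move=> fl fM fa fb; apply: seg_linked cK _ => t It /KM; apply: fM.
  by apply: le_trans (fl t It); rewrite le_min fa.
have lb (u v t : R) : I01P t -> Num.min u v <= u + t * (v - u).
  move=> [t0 t1]; case: (leP u v) => uv.
    have h : 0 <= t * (v - u) by apply: mulr_ge0; lra.
    lra.
  have h : 0 <= (1 - t) * (u - v) by apply: mulr_ge0; lra.
  lra.
have lN (u v t : R) : I01P t -> Num.min (- u) (- v) <= - (u + t * (v - u)).
  by move=> /(lb (- u) (- v)); have -> : - u + t * (- v - - u) = - (u + t * (v - u)) by ring.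
have r1 a b : M <= a.1 -> M <= b.1 -> linked (~` K) a b.
  apply: (lin (fun x => x.1)); first by move=> t; exact: lb.
  by move=> x xM [/= *]; lra.
have r2 a b : M <= a.2 -> M <= b.2 -> linked (~` K) a b.
  apply: (lin (fun x => x.2)); first by move=> t; exact: lb.
  by move=> x xM [/= *]; lra.
have r3 a b : M <= - a.1 -> M <= - b.1 -> linked (~` K) a b.
  apply: (lin (fun x => - x.1)); first by move=> t; exact: lN.
  by move=> x xM [/= *]; lra.
have r4 a b : M <= - a.2 -> M <= - b.2 -> linked (~` K) a b.
  apply: (lin (fun x => - x.2)); first by move=> t; exact: lN.
  by move=> x xM [/= *]; lra.
case/nnr => /= h.
- apply: (linked_trans (y := (- M, M))); first by apply: r2 => /=; lra.
  by apply: r3 => /=; lra.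
- by apply: r1 => /=; lra.
- apply: (linked_trans (y := (M, - M))); first by apply: r1 => /=; lra.
  by apply: r4 => /=; lra.
- by apply: r2 => /=; lra.
Qed.

(* Otherwise the cocycles [sig p] off the component of p and [sig q] on it would
   glue, along K, to a cocycle on a disc that winds around its boundary. *)
Lemma borsuk_bounded K M p q : 0 < M -> cls K -> ~ K p -> ~ K q ->
  (forall z, linked (~` K) p z -> box M (0, 0) z) -> triv (sigd p q) K -> linked (~` K) p q.
Proof.
move=> M0 cK Kp Kq DM [d d0 [e he]]; apply: contrapT => npq.
pose D := linked (~` K) p.
have Dp : D p by exact: linked_refl.
have DK z : D z -> ~ K z by move=> /(linked_in Kp).
have [r1 r10 hr1] := linked_opn cK Kp Dp.
have [r2 r20 hr2] := linked_opn cK Kq (linked_refl _ q).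
have [r3 r30 hr3] := cls_away cK Kq.
have n1 z : ~ D z -> ~ box r1 z p by move=> nz /box_sym /hr1.
have n2 z : D z -> ~ box r2 z q.
  by move=> Dz /box_sym /hr2 qz; apply: npq; apply: linked_trans Dz _; exact: linked_sym.
have n1K k : K k -> ~ box r1 k p by move=> Kk; apply: n1 => /DK.
pose m := Num.min (Num.min r1 r2) (Num.min r3 d) / 8.
have m0 : 0 < m by rewrite divr_gt0 // !lt_min r10 r20 r30.
have [m1 m2 m3 m4] : [/\ m * 8 <= r1, m * 8 <= r2, m * 8 <= r3 & m * 8 <= d].
  by split; rewrite /m divfK ?pnatr_eq0 // !ge_min lexx ?orbT.
have cross u y : ~ D u -> D y -> box m u y -> exists2 k, K k & box m y k.
  move=> Du Dy uy.
  have [t It Kt] : exists2 t, I01P t & K (lerp u y t).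
    apply: contrapT => hh; apply: Du; apply: linked_trans Dy _; apply: linked_sym.
    by apply: seg_linked cK _ => t It Kt; apply: hh; exists t.
  by exists (lerp u y t) => //; apply: box_lerp => //; [exact: box_sym|exact: box_refl].
(* For a point of the component close to its outside, [ka] picks a point of [K] nearby; elsewhere it
   may be the default [p]. *)
pose ka z := xget p [set k | K k /\ box m z k].
have kaP u y : ~ D u -> D y -> box m u y -> K (ka y) /\ box m y (ka y).
  move=> Du Dy /(cross _ _ Du Dy) [k Kk yk]; rewrite /ka; case: xgetP => [k' _ //|/(_ k) []].
  by split.
pose f z := `[< D z >] && (sigd p q z (ka z) (+) e (ka z)).
(* The glued cocycle: [sig q] inside the component, [sig p] outside, corrected by [f] so that the
   two agree near the frontier; [f] carries the primitive [e] from [K] to the points beside it. *)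
pose t x y := if `[< D x >] && `[< D y >] then sig q x y else sig p x y (+) (f x (+) f y).
have fD z : D z -> f z = sigd p q z (ka z) (+) e (ka z).
  by rewrite /f => /asboolP ->.
have tN u x y : ~ D u -> box m u x -> box m u y -> t x y = sig p x y (+) (f x (+) f y).
  move=> Du ux uy; rewrite /t; case: asboolP => //= Dx; case: asboolP => //= Dy.
  have [Kx xk] := kaP _ _ Du Dx ux; have [Ky yk] := kaP _ _ Du Dy uy.
  set kx := ka x in Kx xk *; set ky := ka y in Ky yk *; pose M8 := m * 8.
  have b1 : ~ box M8 kx p by move=> /(box_le m1); exact: n1K.
  have b2 : ~ box M8 kx q by move=> /(box_le m3); exact: hr3.
  have xy := box_tri (box_sym ux) uy.
  have c1 : box M8 kx x by apply: box_le (box_sym xk); rewrite /M8; lra.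
  have c0 : box M8 kx kx by apply: box_refl; rewrite /M8; lra.
  have c2 : box M8 kx y by apply: box_le (box_tri (box_sym xk) xy); rewrite /M8; lra.
  have c3' := box_tri (box_tri (box_sym xk) xy) yk.
  have c3 : box M8 kx ky by apply: box_le c3'; rewrite /M8; lra.
  have h1 := sigd_coc b1 b2 c1 c0 c2.
  have h2 := sigd_coc b1 b2 c0 c3 c2.
  rewrite (sigd_sym b1 b2 c3 c2) in h2.
  rewrite (fD x) // (fD y) // -/kx -/ky.
  have h3 : sigd p q kx ky = e kx (+) e ky by apply: he => //; apply: box_le c3'; lra.
  rewrite h3 in h2; move: h1; rewrite -h2 /(sigd p q x y).
  case: (sig q x y); case: (sig p x y); case: (sigd p q x kx); case: (sigd p q y ky);
  by case: (e kx); case: (e ky).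
have coc x y z : box m x y -> box m y z -> box m x z -> t x y (+) t y z = t x z.
  move=> xy yz xz; have xx := box_refl x m0; have yy := box_refl y m0; have zz := box_refl z m0.
  have main u : ~ D u -> box m u x -> box m u y -> box m u z -> t x y (+) t y z = t x z.
    move=> Du ux uy uz; rewrite !(tN u) //.
    have m1' : m <= r1 by lra.
    rewrite -(@sig_coc R u r1 p x y z (n1 _ Du) (box_le m1' ux) (box_le m1' uy) (box_le m1' uz)).
    by case: (sig p x y); case: (sig p y z); case: (f x); case: (f y); case: (f z).
  case: (pselect (D x)) => Dx; last exact: (main x).
  case: (pselect (D y)) => Dy; last by apply: (main y) => //; exact: box_sym.
  case: (pselect (D z)) => Dz; last by apply: (main z) => //; exact: box_sym.
  rewrite /t; do 3![case: asboolP => //= _].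
  have m2' : m <= r2 by lra.
  by apply: (sig_coc (n2 _ Dx)); [exact: box_le xx|exact: box_le xy|exact: box_le xz].
(* [5 M] leaves room for a square of size [2 M] around [p]: its points are within [4 M] of [p], and
   [p] is within [M] of the origin. *)
have [x hx|x s [/= ? ? ? ?] /andP[s0 s1]|x y z _ _ _|ep hep] :=
  @coarse_trivial R (box (M * 5) (0, 0)) (M * 5) m t m0; [by []| |exact: coc|].
  have pos (u : R) : - (M * 5) < u -> u < M * 5 -> - (M * 5) < s * u < M * 5.
    move=> *; rewrite -ltr_norml normrM ger0_norm //; apply: (@le_lt_trans _ _ (1 * `|u|)).
      by rewrite ler_wpM2r.
    by rewrite mul1r ltr_norml; apply/andP; split; lra.
  have /andP[? ?] : - (M * 5) < s * x.1 < M * 5 by apply: pos; lra.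
  have /andP[? ?] : - (M * 5) < s * x.2 < M * 5 by apply: pos; lra.
  by split => /=; lra.
have [M20 m20] : 0 < M * 2 /\ 0 < m / 2 by split; lra.
(* The square lies off the component, where the cocycle is [sig p] alone; a primitive would make its
   winding parity zero. *)
have [x [l [cl lx]]] := square_loop p M20 m20.
have pM := DM _ Dp.
have far z : on_square (M * 2) p z -> ~ D z /\ box (M * 5) (0, 0) z.
  case=> h1 h2 _; split; last by apply: box_le (box_tri pM h2); lra.
  by move=> /DM zM; apply: h1; apply: box_le (box_tri (box_sym pM) zM); lra.
rewrite (psum_cob (e := ep) _ cl) ?lx ?addbb //.
move=> u v [uv /far [Du uM] /far [Dv vM]].
rewrite -hep // /t; case: asboolP => //= _.
by rewrite /f; case: asboolP => //= _; case: asboolP => //= _; rewrite addbF.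
Qed.

Lemma triv_sym p q K : triv (sigd p q) K -> triv (sigd q p) K.
Proof.
by case=> d d0 [e he]; exists d => //; exists e => x y Kx Ky xy; rewrite -he // /sigd addbC.
Qed.

(** If one of the two components is bounded, [borsuk_bounded] applies; two unbounded ones meet
    outside a large box. *)
Lemma borsuk K p q : ucpt K -> ~ K p -> ~ K q -> triv (sigd p q) K -> linked (~` K) p q.
Proof.
move=> uK Kp Kq tr; have cK := ucpt_cls uK; have [M M0 KM] := ucpt_bounded uK.
case: (pselect (forall z, linked (~` K) p z -> box M (0, 0) z)) => hp.
  exact: borsuk_bounded hp tr.
case: (pselect (forall z, linked (~` K) q z -> box M (0, 0) z)) => hq.
  by apply: linked_sym; apply: borsuk_bounded hq _ => //; exact: triv_sym.
move/existsNP: hp => [z /not_implyP [pz nz]]; move/existsNP: hq => [y /not_implyP [qy ny]].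
have far := linked_far M0 cK KM.
apply: linked_trans pz _; apply: linked_trans (linked_sym (far _ nz)) _.
by apply: linked_trans (far _ ny) _; exact: linked_sym.
Qed.

(** The primitive on [B] may be changed by a constant to agree with the one on [A] at [a]; the last
    hypothesis makes them agree at [b] as well. *)
Lemma linked_glue A B a b p q d (eA eB : P2 -> bool) : ucpt A -> ucpt B ->
  (forall k, A k -> B k -> k = a \/ k = b) -> ~ (A `|` B) p -> ~ (A `|` B) q -> 0 < d ->
  (forall x y, A x -> A y -> box d x y -> sigd p q x y = eA x (+) eA y) ->
  (forall x y, B x -> B y -> box d x y -> sigd p q x y = eB x (+) eB y) ->
  eA a (+) eB a = eA b (+) eB b -> linked (~` (A `|` B)) p q.
Proof.
move=> cA cB AB np nq d0 hA hB hab; apply: borsuk => //; first exact: ucptU.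
apply: (@triv_glue R A B p q d eA (fun x => eB x (+) (eA a (+) eB a))) => //.
- exact: ucpt_cls.
- by move=> ?; apply: np; left.
- by move=> ?; apply: nq; left.
- by move=> ?; apply: np; right.
- by move=> ?; apply: nq; right.
- move=> x y Bx By /(hB _ _ Bx By) ->.
  by case: (eB x); case: (eB y); case: (eA a); case: (eB a).
- move=> k Ak Bk; case: (AB k Ak Bk) => ->; last rewrite hab.
    by case: (eA a); case: (eB a).
  by case: (eA b); case: (eB b).
Qed.

Lemma triv_common (t : P2 -> P2 -> bool) A B : triv t A -> triv t B -> exists d eA eB, [/\ 0 < d,
  (forall x y, A x -> A y -> box d x y -> t x y = eA x (+) eA y) &
  (forall x y, B x -> B y -> box d x y -> t x y = eB x (+) eB y)].
Proof.
case=> d1 d10 [e1 h1] [d2 d20 [e2 h2]]; exists (Num.min d1 d2), e1, e2; split.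
- by rewrite lt_min d10.
- by move=> x y Ax Ay xy; apply: h1 => //; apply: box_le xy; rewrite ge_min lexx.
- by move=> x y Ax Ay xy; apply: h2 => //; apply: box_le xy; rewrite ge_min lexx orbT.
Qed.

(** With a single common point the constant in [linked_glue] can always be adjusted. *)
Lemma janiszewski A B a p q : ucpt A -> ucpt B -> (forall k, A k -> B k -> k = a) ->
  ~ (A `|` B) p -> ~ (A `|` B) q -> linked (~` A) p q -> linked (~` B) p q ->
  linked (~` (A `|` B)) p q.
Proof.
move=> cA cB AB np nq /linked_triv tA /linked_triv tB.
have [d [eA [eB [d0 hA hB]]]] := triv_common tA tB.
by apply: (linked_glue (a := a) (b := a) cA cB _ np nq d0 hA hB) => // k Ak Bk; left; exact: AB.
Qed.

Lemma arc_sigd_triv g p q : pcts g -> pinj g -> ~ arci g p -> ~ arci g q -> triv (sigd p q) (arci g).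
Proof. by move=> cg ig gp gq; apply: trivD; exact: arc_triv. Qed.

Lemma linked_attach A g a p q : ucpt A -> pcts g -> pinj g ->
  (forall k, A k -> arci g k -> k = a) -> ~ (A `|` arci g) p -> ~ (A `|` arci g) q ->
  linked (~` A) p q -> linked (~` (A `|` arci g)) p q.
Proof.
move=> cA cg ig AB np nq pq; have cB := ucpt_arc cg; apply: (janiszewski (a := a)) => //.
by apply: borsuk => //; [|  |apply: arc_sigd_triv => //];
   move=> ?; [apply: np|apply: nq|apply: np|apply: nq]; right.
Qed.

(* Pigeonhole on the parity by which the trivialisations on A and on the arc
   disagree at the two contact points. *)
Lemma arc_two_sides A g a b p q z0 : ucpt A -> pcts g -> pinj g ->
  (forall k : P2, A k -> arci g k -> k = a \/ k = b) ->
  let U := A `|` arci g in ~ U p -> ~ U q -> ~ U z0 ->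
  linked (~` A) p q -> linked (~` A) p z0 ->
  [\/ linked (~` U) p q, linked (~` U) p z0 | linked (~` U) q z0].
Proof.
move=> cA cg ig AB U np nq box'.
have cB := ucpt_arc cg.
have nB z : ~ U z -> ~ arci g z by move=> h ?; apply: h; right.
move=> /linked_triv t1 /linked_triv t2.
have [d1 [e1 [f1 [d10 h1 k1]]]] := triv_common t1 (arc_sigd_triv cg ig (nB _ np) (nB _ nq)).
have [d2 [e2 [f2 [d20 h2 k2]]]] := triv_common t2 (arc_sigd_triv cg ig (nB _ np) (nB _ box')).
case E1: (e1 a (+) f1 a == e1 b (+) f1 b).
  by apply: Or31; apply: (linked_glue cA cB AB np nq d10 h1 k1); exact/eqP.
case E2: (e2 a (+) f2 a == e2 b (+) f2 b).
  by apply: Or32; apply: (linked_glue cA cB AB np box' d20 h2 k2); exact/eqP.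
have sumE x y : sigd q z0 x y = sigd p q x y (+) sigd p z0 x y.
  by rewrite /sigd; case: (sig p x y); case: (sig q x y); case: (sig z0 x y).
have m0 : 0 < Num.min d1 d2 by rewrite lt_min d10.
apply: Or33; apply: (linked_glue (eA := fun x => e1 x (+) e2 x) (eB := fun x => f1 x (+) f2 x)
  cA cB AB nq box' m0).
- move=> x y Ax Ay xy; rewrite sumE h1 ?h2 //; last 2 first.
  + by apply: box_le xy; rewrite ge_min lexx orbT.
  + by apply: box_le xy; rewrite ge_min lexx.
  by case: (e1 x); case: (e2 x); case: (e1 y); case: (e2 y).
- move=> x y Ax Ay xy; rewrite sumE k1 ?k2 //; last 2 first.
  + by apply: box_le xy; rewrite ge_min lexx orbT.
  + by apply: box_le xy; rewrite ge_min lexx.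
  by case: (f1 x); case: (f2 x); case: (f1 y); case: (f2 y).
move: E1 E2; case: (e1 a); case: (e2 a); case: (f1 a); case: (f2 a);
by case: (e1 b); case: (e2 b); case: (f1 b); case: (f2 b).
Qed.


Definition thin K := forall x r, 0 < r -> exists2 y, box r x y & ~ K y.

Lemma thinU A B : cls A -> thin A -> thin B -> thin (A `|` B).
Proof.
move=> cA tA tB x r r0; have [y xy Ay] := tA x r r0.
have [d d0 hd] := cA _ Ay; have [d' d'0 hd'] := box_opn xy.
have m0 : 0 < Num.min d d' by rewrite lt_min d0.
have [z yz Bz] := tB y _ m0; exists z.
  by apply: hd'; apply: box_le yz; rewrite ge_min lexx orbT.
case=> // Az; apply: (hd z) => //; by apply: box_le yz; rewrite ge_min lexx.
Qed.

Lemma thin0 : thin set0.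
Proof. by move=> x r r0; exists x => //; exact: box_refl. Qed.

Definition sub_arc (g : R -> P2) (u v t : R) : P2 := g (u + t * (v - u)).

Lemma sub_param (u v t : R) : I01P u -> I01P v -> I01P t -> I01P (u + t * (v - u)).
Proof.
move=> [u0 u1] [v0 v1] [t0 t1].
have := mulr_ge0 t0 v0; have h1 : 0 <= (1 - t) * u by apply: mulr_ge0; lra.
have h2 : 0 <= t * (1 - v) by apply: mulr_ge0; lra.
have h3 : 0 <= (1 - t) * (1 - u) by apply: mulr_ge0; lra.
by move=> *; split; lra.
Qed.

Lemma sub_pcts g u v : pcts g -> I01P u -> I01P v -> pcts (sub_arc g u v).
Proof.
move=> cg Iu Iv t It e e0; have [d d0 hd] := cg _ (sub_param Iu Iv It) _ e0.
exists d => // s Is st; apply: hd; first exact: sub_param.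
have -> : u + s * (v - u) - (u + t * (v - u)) = (s - t) * (v - u) by ring.
rewrite normrM; apply: le_lt_trans st; rewrite -[leRHS]mulr1 ler_wpM2l // ler_norml.
by case: Iu Iv => ? ? [? ?]; apply/andP; split; lra.
Qed.

Lemma sub_pinj g u v : pinj g -> I01P u -> I01P v -> u != v -> pinj (sub_arc g u v).
Proof.
move=> ig Iu Iv uv s t Is It /(ig _ _ (sub_param Iu Iv Is) (sub_param Iu Iv It)).
move/addrI/mulIf; apply; by rewrite subr_eq0 eq_sym.
Qed.

Lemma sub_arciP g u v x : u < v ->
  arci (sub_arc g u v) x <-> exists t, [/\ u <= t, t <= v & g t = x].
Proof.
move=> uv; have d0 : 0 < v - u by lra.
split=> [[t [t0 t1] <-]|[t [ut tv <-]]].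
  exists (u + t * (v - u)); split=> //.
    by have := mulr_ge0 t0 (ltW d0); lra.
  have h : 0 <= (1 - t) * (v - u) by apply: mulr_ge0; lra.
  lra.
exists ((t - u) / (v - u)).
  split; first by apply: divr_ge0; lra.
  by rewrite ler_pdivrMr //; lra.
by rewrite /sub_arc divfK ?lt0r_neq0 // subrKC.
Qed.

Lemma sub_arci_sub g u v : I01P u -> I01P v -> arci (sub_arc g u v) `<=` arci g.
Proof. by move=> Iu Iv x [t It <-]; exists (u + t * (v - u)) => //; exact: sub_param. Qed.

(** The stretch of the arc beyond [t0 + e]; [arc_thin] applies this to the arc and to its reverse,
    which removes a neighbourhood of an inner point. *)
Lemma arc_off_point g t0 e q : pcts g -> pinj g -> I01P t0 -> 0 < e -> t0 + e < 1 -> ~ arci g q ->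
  exists A, [/\ ucpt A, triv (sigd (g t0) q) A, ~ A (g t0), A `<=` arci g &
    forall x, A x <-> exists t, [/\ t0 + e <= t, t <= 1 & g t = x]].
Proof.
move=> cg ig It0 e0 h gq.
have I1 : I01P (t0 + e) by case: It0 => ? ?; split; lra.
have I2 := @I01P1 R.
have cs := sub_pcts cg I1 I2.
have is_ : pinj (sub_arc g (t0 + e) 1) by apply: sub_pinj => //; rewrite lt_eqF.
have sub := sub_arci_sub (g := g) I1 I2.
have nA : ~ arci (sub_arc g (t0 + e) 1) (g t0).
  move/(sub_arciP _ _ h) => [t [ht t1 gt]].
  have Itt : I01P t by case: I1 => ? ?; split; lra.
  by have := ig _ _ Itt It0 gt; lra.
exists (arci (sub_arc g (t0 + e) 1)); split=> //.
- exact: ucpt_arc.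
- by apply: arc_sigd_triv => // /sub.
- by move=> x; exact: sub_arciP.
Qed.

Definition rev_arc (g : R -> P2) t := g (1 - t).

Lemma rev_I01 (t : R) : I01P t -> I01P (1 - t).
Proof. by case=> ? ?; split; lra. Qed.

Lemma rev_pcts g : pcts g -> pcts (rev_arc g).
Proof.
move=> cg t /rev_I01 /cg h e /h [d d0 hd]; exists d => // s /rev_I01 /hd hs st; apply: hs.
have -> : 1 - s - (1 - t) = - (s - t) by ring.
by rewrite normrN.
Qed.

Lemma rev_pinj g : pinj g -> pinj (rev_arc g).
Proof. move=> ig s t /rev_I01 Is /rev_I01 It /(ig _ _ Is It); lra. Qed.

Lemma rev_arci g : arci (rev_arc g) = arci g.
Proof.
apply/seteqP; split=> x [t /rev_I01 It <-]; exists (1 - t) => //.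
by rewrite /rev_arc; congr g; ring.
Qed.

(* An arc containing a square would, with the centre deleted, be a disjoint
   union of two arcs, around which the square cannot wind. *)
Lemma arc_thin g : pcts g -> pinj g -> thin (arci g).
Proof.
move=> cg ig x0 r0 r00; apply: contrapT => hn.
have {hn} hb z : box r0 x0 z -> arci g z by move=> h; apply: contrapT => nz; apply: hn; exists z.
(* Of three points of the square at most two are ends of the arc, so one has an inner parameter. *)
have [t0 [r [It0 r_gt0 hr]]] : exists t0 r, [/\ 0 < t0 /\ t0 < 1, 0 < r & box r (g t0) `<=` arci g].
  have nz k : -1 < k < 1 -> box r0 x0 (x0.1 + k * r0, x0.2).
    move=> /andP[k1 k2]; have h1 : 0 < (1 - k) * r0 by apply: mulr_gt0; lra.
    have h2 : 0 < (k + 1) * r0 by apply: mulr_gt0; lra.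
    by split => /=; lra.
  have [|t1 I1 g1] := hb _ (nz 0 _); first by apply/andP; split; lra.
  have [|t2 I2 g2] := hb _ (nz (1/2) _); first by apply/andP; split; lra.
  have [|t3 I3 g3] := hb _ (nz (1/3) _); first by apply/andP; split; lra.
  have fin t k : -1 < k < 1 -> g t = (x0.1 + k * r0, x0.2) -> 0 < t /\ t < 1 ->
      exists t0 r, [/\ 0 < t0 /\ t0 < 1, 0 < r & box r (g t0) `<=` arci g].
    move=> kb gt It; have [r rp h] := box_opn (nz k kb).
    by exists t, r; split=> //; rewrite gt => z /h; exact: hb.
  have d12 : t1 <> t2 by move=> e; move: g1; rewrite e g2 => -[]; lra.
  have d13 : t1 <> t3 by move=> e; move: g1; rewrite e g3 => -[]; lra.
  have d23 : t2 <> t3 by move=> e; move: g2; rewrite e g3 => -[]; lra.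
  have cases (t : R) : I01P t -> [\/ t = 0, t = 1 | 0 < t /\ t < 1].
    move=> [ta tb]; case: (leP t 0) => t0; first by apply: Or31; lra.
    by case: (leP 1 t) => t1'; [apply: Or32; lra|apply: Or33].
  case: (cases _ I1) => c1; last by apply: (fin _ 0 _ g1 c1); apply/andP; split; lra.
    case: (cases _ I2) => c2; [lra| |apply: (fin _ (1/2) _ g2 c2); apply/andP; split; lra].
    by case: (cases _ I3) => c3; [lra|lra|apply: (fin _ (1/3) _ g3 c3); apply/andP; split; lra].
  case: (cases _ I2) => c2; [|lra|apply: (fin _ (1/2) _ g2 c2); apply/andP; split; lra].
  by case: (cases _ I3) => c3; [lra|lra|apply: (fin _ (1/3) _ g3 c3); apply/andP; split; lra].
have It : I01P t0 by split; lra.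
have r4 : 0 < r / 4 by lra.
have [d d0 hd] := cg _ It _ r4.
pose e := Num.min d (Num.min t0 (1 - t0)) / 2.
have e0 : 0 < e by case: It0 => h1 h2; rewrite divr_gt0 // !lt_min d0 h1 subr_gt0 h2.
have [ed e1 e2] : [/\ e * 2 <= d, e * 2 <= t0 & e * 2 <= 1 - t0].
  by split; rewrite /e divfK ?pnatr_eq0 // !ge_min lexx ?orbT.
have ca := ucpt_arc cg.
have [M M0 gM] := ucpt_bounded ca.
(* To the right of the whole arc, so that [sig q] vanishes on it and [sigd] reduces to
   [sig (g t0)]. *)
pose q : P2 := (M, 0).
have gq : ~ arci g q by move=> /gM [/= *]; lra.
have sq x y : arci g x -> sig q x y = false.
  move=> /gM [/= *]; rewrite /sig /= ltNge; have -> : x.1 <= M by lra.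
  by rewrite andbF.
have te : t0 + e < 1 by lra.
have te' : 1 - t0 + e < 1 by lra.
have [A [cA tA nA sA hA]] := arc_off_point cg ig It e0 te gq.
have := arc_off_point (rev_pcts cg) (rev_pinj ig) (rev_I01 It) e0 te' (q := q).
rewrite rev_arci => /(_ gq) [B [cB tB nB sB hB]].
have real_ends : rev_arc g (1 - t0) = g t0 by rewrite /rev_arc; congr g; ring.
rewrite real_ends in nB tB.
have AB k : A k -> B k -> False.
  move=> /hA [t [t1 t2 gt]] /hB [t' [t1' t2' gt']].
  have I1 : I01P t by split; lra.
  have I2 : I01P (1 - t') by split; lra.
  have : g t = g (1 - t') by rewrite gt -gt'.
  by move/(ig _ _ I1 I2); lra.
have [d1 [eA [eB [d10 kA kB]]]] := triv_common tA tB.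
have [m m0 [f hf]] : triv (sigd (g t0) q) (A `|` B).
  apply: (triv_glue cA (ucpt_cls cB) nA _ nB _ d10 kA kB).
  - by move=> /sA.
  - by move=> /sB.
  - by move=> k Ak Bk; case: (AB k).
have r2 : 0 < r / 4 by lra.
have [x [l [cl lx]]] := square_loop (g t0) r2 m0.
rewrite (psum_cob (e := f) _ cl) ?lx ?addbb //.
move=> u v [uv [u1 u2 _] [v1 v2 _]].
(* Outside the inner square the parameter is at least [d >= 2 e] away from [t0], so the point
   survives in [A] or in [B]. *)
have inAB z : ~ box (r / 4) (g t0) z -> box (r / 4 * 2) (g t0) z -> (A `|` B) z.
  move=> z1 z2; have [t It' gt] : arci g z by apply: hr; apply: box_le z2; lra.
  have : ~ (`|t - t0| < d) by move=> /(hd _ It'); rewrite gt.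
  case: It' => ta tb.
  move=> /negP; rewrite -leNgt ler_normr => /orP[hh|hh].
    by left; apply/hA; exists t; split=> //; lra.
  right; apply/hB; exists (1 - t); split; [lra|lra|].
  by rewrite -gt /rev_arc; congr g; ring.
have Au := inAB _ u1 u2; have Av := inAB _ v1 v2.
rewrite -hf // /sigd sq ?addbF //.
by case: Au => [/sA|/sB].
Qed.

End PlaneSeparation.

(** * The separation half of the Jordan curve theorem *)

Section PlaneJordan.
Variable R : realType.
Local Notation P2 := (R * R)%type.
Implicit Types (p q x y z c a b : P2) (r d : R) (l : seq P2) (O K A B : set P2).

Definition sqset r a : set P2 :=
  [set z | exists k s, [/\ (k < 4)%N, 0 <= s <= 1 & z = square_side r a k s]].

Lemma ucpt_sqset r a : ucpt (sqset r a).
Proof.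
have -> : sqset r a = arci (square_side r a 0) `|` arci (square_side r a 1) `|`
   (arci (square_side r a 2) `|` arci (square_side r a 3)).
  apply/seteqP; split=> z.
    move=> [k [s [k4 /andP[s0 s1] ->]]]; have Is : I01P s by split.
    case: k k4 => [|[|[|[|//]]]] _; [left; left|left; right|right; left|right; right];
    by exists s.
  have mk k t : (k < 4)%N -> I01P t -> sqset r a (square_side r a k t).
    by move=> k4 [? ?]; exists k, t; split=> //; apply/andP.
  by case=> -[] [t It <-]; apply: mk.
by apply: ucptU; apply: ucptU; apply: ucpt_arc; exact: lerp_cts.
Qed.

(* Steps inside ~A are replaced by paths in ~(A u B); closed chains in ~A have
   zero total parity, so the total does not change. *)
Lemma mixed_chain A B a b x l : A a -> A b ->
  (forall x l, chainR (step (~` A)) x l -> last x l = x -> psum (sigd a b) x l = false) ->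
  (forall x y, ~ (A `|` B) x -> ~ (A `|` B) y -> linked (~` A) x y -> linked (~` (A `|` B)) x y) ->
  chainR (fun u v => [/\ ~ (A `|` B) u, ~ (A `|` B) v & step (~` A) u v \/ step (~` B) u v]) x l ->
  exists l', [/\ chainR (step (~` B)) x l', last x l' = last x l & psum (sigd a b) x l' = psum (sigd a b) x l].
Proof.
move=> Aa Ab zA H; elim: l x => [|y l IH] x /=; first by exists nil.
case=> -[nx ny st] /IH [l2 [c2 e2 s2]].
case: st => st; last by exists (y :: l2) => /=; rewrite s2.
have [l1 [c1 e1]] := H x y nx ny (linked_step st).
have cA : chainR (step (~` A)) x l1.
  by apply: chainR_sub c1 => u v; apply: step_sub => z hz Az; apply: hz; left.
have cB : chainR (step (~` B)) x l1.
  by apply: chainR_sub c1 => u v; apply: step_sub => z hz Az; apply: hz; right.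
exists (l1 ++ l2); split.
- by apply/chainR_cat; rewrite e1.
- by rewrite last_cat e1.
- rewrite psum_cat e1 s2; congr (_ (+) _).
  have := zA x (l1 ++ [:: x]); rewrite psum_cat e1 last_cat /= addbF => h.
  have ss : sigd a b y x = sigd a b x y.
    case: st => c [r [cx cy hr]]; have r0 := box_gt0 cx.
    have real_ends : r <= r * 2 by lra.
    by apply: (@sigd_sym R c (r * 2)); [move=> /hr|move=> /hr|exact: box_le cy|exact: box_le cx].
  have : psum (sigd a b) x l1 (+) sigd a b y x = false.
    apply: h => //; apply/chainR_cat; rewrite e1; split=> //=; split=> //; exact: step_sym.
  by rewrite ss; case: (psum _ _ _); case: (sigd _ _ _ _).
Qed.

(** If [B] separated nothing new, take a loop on a small square around [a] with [b] outside. Pushed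
    off [A] and [B], each of its steps misses one of the two sets, so [mixed_chain] turns it into a
    loop off [B] with the same parity. That parity is 1, as the loop winds around [a] and not around
    [b], against the last hypothesis. *)
Lemma jordan_separation A B a b : cls A -> cls B -> thin (A `|` B) -> a <> b ->
  A a -> A b -> (forall k, A k -> B k -> k = a \/ k = b) ->
  (forall x l, chainR (step (~` A)) x l -> last x l = x -> psum (sigd a b) x l = false) ->
  (forall x l, chainR (step (~` B)) x l -> last x l = x -> psum (sigd a b) x l = false) ->
  exists x y, [/\ ~ (A `|` B) x, ~ (A `|` B) y, linked (~` A) x y & ~ linked (~` (A `|` B)) x y].
Proof.
move=> cA cB tAB ab Aa Ab AB zA zB; apply: contrapT => hn.
have H x y : ~ (A `|` B) x -> ~ (A `|` B) y -> linked (~` A) x y -> linked (~` (A `|` B)) x y.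
  by move=> nx ny xy; apply: contrapT => nxy; apply: hn; exists x, y.
have [r4 r40 hr4] : exists2 r, 0 < r & ~ box r a b by apply: nnr_sep => e; apply: ab.
pose r := r4 / 4; have r0 : 0 < r by rewrite /r; lra.
have nab : ~ box (r * 4) a b by rewrite /r; have -> : r4 / 4 * 4 = r4 by lra.
have onsq z : on_square r a z -> z <> a /\ z <> b.
  case=> z1 z2 _; split=> e.
    by apply: z1; rewrite e; exact: box_refl.
  by apply: nab; rewrite -e; apply: box_le z2; lra.
(* On the square the common points [a] and [b] are out of reach, so every point has a box missing
   [A] or [B]; compactness makes the radius uniform. *)
have [|z Gz|rho rho0 hrho] := @ucpt_sqset r a (fun z d => on_square r a z ->
    box d z `<=` ~` A \/ box d z `<=` ~` B).
- move=> z d d' _ dd h /h [h1|h1]; [left|right] => y /(box_le dd); exact: h1.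
- have loc X : cls X -> ~ X z -> exists2 d, 0 < d & forall x', box d z x' -> box d x' `<=` ~` X.
    move=> cX /cX [d d0 hd]; exists (d / 2) => [|x' zx' y x'y]; first by lra.
    by apply: hd; apply: box_le (box_tri zx' x'y); lra.
  case: (pselect (A z)) => Az; last first.
    by have [d d0 hd] := loc A cA Az; exists d => // x' _ zx' _; left; exact: hd.
  case: (pselect (B z)) => Bz; last first.
    by have [d d0 hd] := loc B cB Bz; exists d => // x' _ zx' _; right; exact: hd.
  have zab := AB _ Az Bz.
  have zz : forall x', z <> x' -> exists2 d, 0 < d & forall y, box d z y -> y <> x'.
    move=> x' zx'; have [d d0 hd] := nnr_sep zx'; exists d => // y zy e; apply: hd; rewrite -e.
    exact: box_sym.
  have sep : ~ on_square r a z by move=> /onsq []; case: zab.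
  case: zab => ze.
    exists r => // x' _ zx' [n1 _ _]; exfalso; apply: n1; by rewrite -ze.
  exists r => // x' _ zx' [_ n2 _]; exfalso; apply: nab; rewrite -ze.
  by apply: box_le (box_tri n2 (box_sym zx')); lra.
pose d := Num.min rho r / 8.
have d0 : 0 < d by rewrite divr_gt0 // lt_min rho0.
have [d1 d2] : d * 8 <= rho /\ d * 8 <= r.
  by split; rewrite /d divfK ?pnatr_eq0 // !ge_min lexx ?orbT.
have [x [l [cl lx sl]]] := square_loop a r0 d0.
(* [w] pushes a point of the loop off both sets, which thinness allows within [d]. *)
pose w z := xget z [set y | box d z y /\ ~ (A `|` B) y].
have wP z : box d z (w z) /\ ~ (A `|` B) (w z).
  rewrite /w; case: xgetP => [y _ //|]; have [y y1 y2] := tAB z _ d0.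
  by move=> /(_ y) [].
have sqin z : on_square r a z -> ~ box r z a /\ box (r * 4) a (w z).
  case=> z1 z2 _; split; first by move/box_sym.
  by have [zw _] := wP z; apply: box_le (box_tri z2 zw); lra.
pose Q u v := [/\ box (r * 4) a (w u), box (r * 4) a (w v) &
  [/\ ~ (A `|` B) (w u), ~ (A `|` B) (w v) & step (~` A) (w u) (w v) \/ step (~` B) (w u) (w v)]].
have QP u v : [/\ box d u v, on_square r a u & on_square r a v] -> Q u v /\
   sig a (w u) (w v) = sig a u v (+) (sig a u (w u) (+) sig a v (w v)).
  case=> uv su sv; have [nu wu] := sqin _ su; have [nv wv] := sqin _ sv.
  have [uw Kuw] := wP u; have [vw Kvw] := wP v.
  have uwv := box_tri uv vw.
  split.
    split=> //; split=> //.
    have [k [s [k4 s01 eu]]] : exists k s, [/\ (k < 4)%N, 0 <= s <= 1 & u = square_side r a k s].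
      by case: su.
    have sA : sqset r a u by exists k, s.
    have stp X : box rho u `<=` ~` X -> step (~` X) (w u) (w v).
      move=> h; exists u, (rho / 2); split.
      - by apply: box_le uw; lra.
      - by apply: box_le uwv; lra.
      - by have -> : rho / 2 * 2 = rho by lra.
    by case: (hrho _ sA su) => /stp; [left|right].
  have u0 : box r u u by exact: box_refl.
  have u1 : box r u v by apply: box_le uv; lra.
  have u2 : box r u (w u) by apply: box_le uw; lra.
  have u3 : box r u (w v) by apply: box_le uwv; lra.
  have := sig_coc nu u0 u2 u3; have := sig_coc nu u0 u1 u3.
  by case: (sig a u v); case: (sig a u (w u)); case: (sig a v (w v));
     case: (sig a (w u) (w v)); case: (sig a u (w v)).
(* Pushing changes the parity by a telescoping term, which vanishes once the loop closes. *)
have psw : psum (sig a) (w x) (map w l) =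
    psum (sig a) x l (+) (sig a x (w x) (+) sig a (last x l) (w (last x l))).
  elim: l x cl {lx sl} => [|y l IH] x /=; first by rewrite addbb.
  case=> /QP [_ ->] /IH ->.
  by case: (sig a x y); case: (sig a x (w x)); case: (sig a y (w y)); case: (psum _ _ _);
     case: (sig a _ _).
have clw : chainR (fun u v => [/\ box (r * 4) a u, box (r * 4) a v &
    [/\ ~ (A `|` B) u, ~ (A `|` B) v & step (~` A) u v \/ step (~` B) u v]]) (w x) (map w l).
  by elim: l x cl {lx sl psw} => [|y l IH] x //= [/QP [[? ? ?] _] /IH].
have lw : last (w x) (map w l) = w x by rewrite last_map lx.
have sb : psum (sig b) (w x) (map w l) = false.
  rewrite (psum_cob (e := sig b a) _ clw) ?lw ?addbb // => u v [au av _].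
  have aa : box (r * 4) a a by apply: box_refl; lra.
  by rewrite -(sig_coc nab aa au av); case: (sig b a u); case: (sig b u v).
have [|l' [cl' ll' sl']] := @mixed_chain A B a b (w x) (map w l) Aa Ab zA H.
  by apply: chainR_sub clw => u v [].
have := zB _ _ cl' (etrans ll' lw).
by rewrite sl' /sigd psumD sb psw lx sl; case: (sig a x _).
Qed.

End PlaneJordan.

(** * Plane graphs *)

Section PlaneGraph.
Variable R : realType.
Local Notation P2 := (R * R)%type.

(** Injectivity on the closed interval excludes loops; parallel segments are allowed. *)
Record plane_graph (S N : finType) (src tgt : S -> N) (pos : N -> P2) (arc : S -> R -> P2) : Prop := {
  pg_pos : injective pos;
  pg_cts : forall s, pcts (arc s);
  pg_inj : forall s, pinj (arc s);
  pg_src : forall s, arc s 0 = pos (src s);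
  pg_tgt : forall s, arc s 1 = pos (tgt s);
  pg_node : forall s t v, 0 < t -> t < 1 -> arc s t <> pos v;
  pg_disj : forall s s' t t', s != s' -> 0 < t -> t < 1 -> 0 < t' -> t' < 1 -> arc s t <> arc s' t'
}.

Variables (S N : finType) (src tgt : S -> N) (pos : N -> P2) (arc : S -> R -> P2).
Hypothesis G : plane_graph src tgt pos arc.
Implicit Types (H C T : {set S}) (p q x y z : P2) (s : S).

Definition Kset H : set P2 := [set x | exists2 s, s \in H & arci (arc s) x].
Definition open_arc s : set P2 := [set x | exists t, [/\ 0 < t, t < 1 & arc s t = x]].

Lemma set_ind (P : {set S} -> Prop) : P finset.set0 -> (forall s H, s \notin H -> P H -> P (s |: H)) ->
  forall H, P H.
Proof.
move=> P0 PS H; have [n] := ubnP #|H|; elim: n H => // n IH H.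
have [->//|[s sH] ltn] := set_0Vmem H.
rewrite -(finset.setD1K sH); apply: PS; first by rewrite !inE eqxx.
by apply: IH; move: ltn; rewrite (cardsD1 s) sH.
Qed.

Lemma Kset0 : Kset finset.set0 = classical_sets.set0.
Proof. by apply/seteqP; split=> x // [s]; rewrite inE. Qed.

Lemma KsetU1 s H : Kset (s |: H) = Kset H `|` arci (arc s).
Proof.
apply/seteqP; split=> x.
  by case=> s'; rewrite !inE => /predU1P[->|s'H] h; [right|left; exists s'].
by case=> [[s' s'H h]|h]; [exists s'; rewrite // !inE s'H orbT|exists s; rewrite // !inE eqxx].
Qed.

Lemma Kset_sub H H' : H \subset H' -> Kset H `<=` Kset H'.
Proof. by move=> /fintype.subsetP HH x [s /HH sH h]; exists s. Qed.

Lemma ucpt_Kset H : ucpt (Kset H).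
Proof.
apply: (set_ind (P := fun H => ucpt (Kset H))) => [|s {}H _ IH]; first by rewrite Kset0; exact: ucpt0.
by rewrite KsetU1; apply: ucptU => //; apply: ucpt_arc; exact: (pg_cts G).
Qed.

Lemma cls_Kset H : cls (Kset H).
Proof. exact/ucpt_cls/ucpt_Kset. Qed.

Lemma thin_Kset H : thin (Kset H).
Proof.
apply: (set_ind (P := fun H => thin (Kset H))) => [|s {}H _ IH]; first by rewrite Kset0; exact: thin0.
by rewrite KsetU1; apply: thinU => //; [exact: cls_Kset|apply: arc_thin; [exact: (pg_cts G)|exact: (pg_inj G)]].
Qed.

Lemma arciP s x : arci (arc s) x -> [\/ open_arc s x, x = pos (src s) | x = pos (tgt s)].
Proof.
case=> t [t0 t1] <-; case: (ltP 0 t) => t0'; last first.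
  by apply: Or32; rewrite -(pg_src G); congr arc; lra.
case: (ltP t 1) => t1'; last by apply: Or33; rewrite -(pg_tgt G); congr arc; lra.
by apply: Or31; exists t.
Qed.

Lemma open_arc_sub s : open_arc s `<=` arci (arc s).
Proof. by move=> x [t [t0 t1 <-]]; exists t => //; split; exact: ltW. Qed.

Lemma open_arc_node s v : ~ open_arc s (pos v).
Proof. by case=> t [t0 t1]; exact: (pg_node G). Qed.

Lemma open_arc_inj s s' x : open_arc s x -> arci (arc s') x -> s = s'.
Proof.
move=> [t [t0 t1 <-]] /arciP [[t' [t0' t1' e]]|e|e]; last 2 first.
- by case: (pg_node G t0 t1 e).
- by case: (pg_node G t0 t1 e).
apply/eqP; apply: contrapT => /negP ne; exact: (pg_disj G ne t0 t1 t0' t1').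
Qed.

Lemma Kset_arci_ends s H x : s \notin H -> Kset H x -> arci (arc s) x ->
  x = pos (src s) \/ x = pos (tgt s).
Proof.
move=> sH [s' s'H h'] /arciP [oz|->|->]; [|by left|by right].
by move: s'H; rewrite -(open_arc_inj oz h') (negbTE sH).
Qed.

Lemma pos_src_arc s : arci (arc s) (pos (src s)).
Proof. by exists 0; [exact: I01P0|exact: (pg_src G)]. Qed.

Lemma pos_tgt_arc s : arci (arc s) (pos (tgt s)).
Proof. by exists 1; [exact: I01P1|exact: (pg_tgt G)]. Qed.

Lemma src_neq_tgt s : pos (src s) <> pos (tgt s).
Proof.
rewrite -(pg_src G) -(pg_tgt G) => /(pg_inj G (@I01P0 R) (@I01P1 R)) /eqP.
by rewrite eq_sym oner_eq0.
Qed.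

(** The homological shadow of [u] and [v] being joined inside [H]: no loop off [H] winds differently
    around them. This is the form in which [jordan_separation] uses connectedness. *)
Definition parity_eq H u v := forall x l, chainR (step (~` Kset H)) x l -> last x l = x ->
  psum (sig (pos u)) x l = psum (sig (pos v)) x l.

Lemma parity_eq_arc H s : s \in H -> parity_eq H (src s) (tgt s).
Proof.
move=> sH x l cl lx; rewrite -(pg_src G) -(pg_tgt G).
apply: (closed_chain_parity (K := Kset H) (pg_cts G s) _ cl lx).
by move=> t It; exists s => //; exists t.
Qed.

Lemma parity_eq_trans H u v w : parity_eq H u v -> parity_eq H v w -> parity_eq H u w.
Proof. by move=> h1 h2 x l cl lx; rewrite h1 // h2. Qed.

Lemma parity_eq_sym H u v : parity_eq H u v -> parity_eq H v u.
Proof. by move=> h x l cl lx; rewrite h. Qed.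

Lemma parity_eq_sub H H' u v : H \subset H' -> parity_eq H u v -> parity_eq H' u v.
Proof.
move=> HH h x l cl; apply: h; apply: chainR_sub cl => a b; apply: step_sub => z nz /(Kset_sub HH).
exact: nz.
Qed.

Definition node_adj : rel N := fun u v =>
  [exists s, ((src s == u) && (tgt s == v)) || ((src s == v) && (tgt s == u))].

(** Grown one node at a time. Of the tree, its size, the parity relation and its passing through
    every node are recorded; with a single node it is empty, whence the guard in the last clause. *)
Lemma spanning_tree : (forall u v, connect node_adj u v) -> (0 < #|N|)%N ->
  exists T, [/\ (#|T| < #|N|)%N, forall u v, parity_eq T u v &
    (1 < #|N|)%N -> forall u, Kset T (pos u)].
Proof.
move=> conn /card_gt0P[r _].
have grow k : (k < #|N|)%N -> exists (W : {set N}) T,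
    [/\ r \in W, #|W| = k.+1, (#|T| <= k)%N & forall w, w \in W -> parity_eq T r w /\ ((0 < k)%N -> Kset T (pos w))].
  elim: k => [_|k IH kN].
    by exists [set r]%SET, finset.set0; split; rewrite ?inE ?cards1 ?cards0 // => w; rewrite inE => /eqP ->; split.
  have [W [T [rW cW cT hW]]] := IH (ltnW kN).
  have [u [v [uW vW uv]]] : exists u v, [/\ u \in W, v \notin W & node_adj u v].
    apply: contrapT => hn.
    have clos l (x : N) : x \in W -> path node_adj x l -> last x l \in W.
      elim: l x => [|y l IHl] x xW //= /andP [xy]; apply: IHl.
      by apply/negPn/negP => yW; apply: hn; exists x, y.
    have WT : W = [set: N]%SET.
      apply/finset.setP => v; rewrite [RHS]inE; have /connectP [l pl ->] := conn r v.
      exact: clos.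
    by move: kN; rewrite -cW WT cardsT ltnn.
  case/existsP: uv => s hs; exists (v |: W), (s |: T); split.
  - by rewrite !inE rW orbT.
  - by rewrite cardsU1 vW cW.
  - by rewrite cardsU1; case: (s \in T) => /=; lia.
  - have sub : T \subset s |: T by exact: finset.subsetUr.
    have sT : s \in s |: T by rewrite !inE eqxx.
    have [Ks Kt] : Kset (s |: T) (pos (src s)) /\ Kset (s |: T) (pos (tgt s)).
      by split; exists s => //; [exact: pos_src_arc|exact: pos_tgt_arc].
    have [ps Ku Kv] : [/\ parity_eq (s |: T) u v, Kset (s |: T) (pos u) & Kset (s |: T) (pos v)].
      case/orP: hs => /andP [/eqP <- /eqP <-]; first by split=> //; exact: parity_eq_arc.
      by split=> //; apply: parity_eq_sym; exact: parity_eq_arc.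
    move=> w; rewrite !inE => /predU1P [->|wW].
      split=> //; apply: parity_eq_trans ps; exact: parity_eq_sub (hW _ uW).1.
    split=> [|_]; first exact: parity_eq_sub (hW _ wW).1.
    case: k IH kN cW cT hW => [_ _ cW cT hW|k _ _ cW cT hW].
      have /cards1P [z Wz] : #|W| == 1%N by rewrite cW.
      by move: wW uW; rewrite Wz !inE => /eqP -> /eqP <-.
    by apply: (Kset_sub sub); apply: (hW _ wW).2.
have N0 : (#|N|.-1 < #|N|)%N by rewrite prednK //; apply/card_gt0P; exists r.
have [W [T [rW cW cT hW]]] := grow _ N0.
have WT w : w \in W.
  suff -> : W = [set: N]%SET by rewrite inE.
  by apply/eqP; rewrite finset.eqEcard finset.subsetT cardsT cW; lia.
exists T; split; first by lia.
- by move=> u v; apply: (parity_eq_trans (v := r)); [apply: parity_eq_sym|]; exact: (hW _ (WT _)).1.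
- by move=> N1 u; apply: (hW _ (WT _)).2; lia.
Qed.

(** Nothing says that every face is represented, so [F] is a lower bound for the number of faces. *)
Definition face_reps H F (p : nat -> P2) :=
  (forall i, (i < F)%N -> ~ Kset H (p i)) /\
  (forall i j, (i < F)%N -> (j < F)%N -> i != j -> ~ linked (~` Kset H) (p i) (p j)).

(** A representative may lie on the segment about to be added; thinness lets it move off. *)
Lemma perturb H H' x : ~ Kset H x -> exists2 x', linked (~` Kset H) x x' & ~ Kset H' x'.
Proof.
move=> Hx; have [r r0 hr] := opn_step (@cls_Kset H) Hx.
by have [y xy ny] := thin_Kset H' x r0; exists y => //; apply: linked_step; exact: hr.
Qed.

Lemma face_reps_perturb H H' F (p : nat -> P2) : face_reps H F p -> exists p' : nat -> P2, [/\
   forall i, (i < F)%N -> ~ Kset H' (p' i),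
   forall i, (i < F)%N -> linked (~` Kset H) (p i) (p' i) &
   forall i j, (i < F)%N -> (j < F)%N -> i != j -> ~ linked (~` Kset H) (p' i) (p' j)].
Proof.
case=> hK hl.
have /choice [f hf] : forall i, exists y, (i < F)%N -> linked (~` Kset H) (p i) y /\ ~ Kset H' y.
  move=> i.
  case: (ltnP i F) => iF; last by exists (0, 0).
  by have [x' h1 h2] := perturb H' (hK _ iF); exists x'.
exists f; split=> [i /hf[]//|i /hf[]//|i j iF jF ij hij].
apply: (hl i j iF jF ij); apply: linked_trans (hf _ iF).1 _; apply: linked_trans hij _.
by apply: linked_sym; case: (hf _ jF).
Qed.

(** [jordan_separation] yields two points of one old face that [s] separates. If that face is
    represented, its point is replaced by one of them and the other is added; otherwise one of them
    is a new representative. *)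
Lemma face_reps_add H s F (p : nat -> P2) : s \notin H -> face_reps H F p -> parity_eq H (src s) (tgt s) ->
  Kset H (pos (src s)) -> Kset H (pos (tgt s)) ->
  exists p' : nat -> P2, face_reps (s |: H) F.+1 p'.
Proof.
move=> sH fp par Ha Hb; have [f [f1 f2 f3]] := face_reps_perturb (s |: H) fp.
have thinU' : thin (Kset H `|` arci (arc s)) by rewrite -KsetU1; exact: thin_Kset.
have [x [y [nx ny xy nxy]]] : exists x y, [/\ ~ Kset (s |: H) x, ~ Kset (s |: H) y,
    linked (~` Kset H) x y & ~ linked (~` Kset (s |: H)) x y].
  rewrite KsetU1; apply: (jordan_separation (a := pos (src s)) (b := pos (tgt s))) => //.
  - exact: cls_Kset.
  - by apply: ucpt_cls; apply: ucpt_arc; exact: (pg_cts G).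
  - exact: src_neq_tgt.
  - by move=> k; exact: Kset_arci_ends.
  - by move=> z l cl lz; rewrite /sigd psumD (par z l cl lz) addbb.
  - move=> z l cl lz; rewrite -(pg_src G) -(pg_tgt G) /sigd psumD.
    rewrite (closed_chain_parity (K := arci (arc s)) (pg_cts G s) _ cl lz) ?addbb // => t It.
    by exists t.
have sub z z' : linked (~` Kset (s |: H)) z z' -> linked (~` Kset H) z z'.
  by apply: linked_sub => w nw Hw; apply: nw; apply: Kset_sub Hw; exact: finset.subsetUr.
case: (pselect (exists i0, (i0 < F)%N /\ linked (~` Kset H) (f i0) x)) => [[i0 [i0F i0x]]|ni].
  exists (fun i => if i == i0 then x else if i == F then y else f i).
  have fx j : (j < F)%N -> j != i0 -> ~ linked (~` Kset H) (f j) x.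
    by move=> jF ji h; apply: (f3 j i0 jF i0F ji); apply: linked_trans h (linked_sym i0x).
  have fy j : (j < F)%N -> j != i0 -> ~ linked (~` Kset H) (f j) y.
    by move=> jF ji h; apply: (fx j jF ji); apply: linked_trans h (linked_sym xy).
  split=> [i|i j]; first by rewrite ltnS; case: eqP => // _; case: eqP => // ? ?; apply: f1; lia.
  rewrite !ltnS; case: (eqVneq i i0) => [->|ii]; case: (eqVneq j i0) => [->|jj].
  - by [].
  - by case: (eqVneq j F) => [_ //|jF] _ jF' _ /sub /linked_sym; apply: fx => //; lia.
  - case: (eqVneq i F) => [_ _ _ _ /linked_sym //|iF] iF' _ _ /sub; apply: fx => //; lia.
  - case: (eqVneq i F) => [->|iF]; case: (eqVneq j F) => [->|jF]; rewrite ?eqxx //.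
    + by move=> _ jF' _ /sub /linked_sym; apply: fy => //; lia.
    + by move=> iF' _ _ /sub; apply: fy => //; lia.
    + by move=> iF' jF' ij /sub; apply: f3 => //; lia.
exists (fun i => if i == F then x else f i); split=> [i|i j].
  by rewrite ltnS; case: eqP => // ? ?; apply: f1; lia.
have nf m : (m < F)%N -> ~ linked (~` Kset H) (f m) x by move=> mF h; apply: ni; exists m.
rewrite !ltnS; case: (eqVneq i F) => [->|iF]; case: (eqVneq j F) => [->|jF]; rewrite ?eqxx //.
- by move=> _ jF' _ /sub /linked_sym; apply: nf; lia.
- by move=> iF' _ _ /sub; apply: nf; lia.
- by move=> iF' jF' ij /sub; apply: f3 => //; lia.
Qed.

Theorem many_faces : (forall u v, connect node_adj u v) -> (1 < #|N|)%N ->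
  exists F (p : nat -> P2), face_reps [set: S]%SET F p /\ (#|S| + 2 <= F + #|N|)%N.
Proof.
move=> conn N1; have [T [cT par KT]] := spanning_tree conn (ltnW N1).
have grow k : (k <= #|S| - #|T|)%N -> exists H (p : nat -> P2), [/\ T \subset H, #|H| = (#|T| + k)%N & face_reps H k.+1 p].
  elim: k => [_|k IH kS].
    have [y _ ny] := @thin_Kset T (0, 0) 1 ltr01.
    exists T, (fun=> y); rewrite addn0; split=> //; split=> // i j.
    by rewrite !ltnS !leqn0 => /eqP -> /eqP ->.
  have [H [p [TH cH fp]]] := IH (ltnW kS).
  have [s sH] : exists s, s \notin H.
    apply: contrapT => hn; have HT : H = [set: S]%SET.
      by apply/finset.setP => s; rewrite [RHS]inE; apply/negPn/negP => sH; apply: hn; exists s.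
    by move: cH; rewrite HT cardsT; lia.
  have [p' fp'] := face_reps_add sH fp (parity_eq_sub TH (par _ _))
    (Kset_sub TH (KT N1 _)) (Kset_sub TH (KT N1 _)).
  exists (s |: H), p'; split=> //; last by rewrite cardsU1 sH cH; lia.
  exact: (fintype.subset_trans TH (finset.subsetUr _ _)).
have [H [p [TH cH fp]]] := grow _ (leqnn _).
have TS : (#|T| <= #|S|)%N by exact: max_card.
have HS : H = [set: S]%SET.
  by apply/eqP; rewrite finset.eqEcard finset.subsetT cardsT cH; lia.
by exists (#|S| - #|T|).+1, p; rewrite -HS; split=> //; lia.
Qed.

End PlaneGraph.

(** * How a chain leaves a component *)

Section Exit.
Variable R : realType.
Local Notation P2 := (R * R)%type.
Implicit Types (p q x y z k : P2) (O K : set P2).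

Definition limit_of (D : set P2) k := forall r, 0 < r -> exists2 y, box r k y & D y.

(** If no point of [K] in [O] were adherent to the component, membership in it would be locally
    constant along the chain, and the chain could not leave. *)
Lemma linked_exit O K x y : opn O -> cls K -> ~ K x -> linked O x y -> ~ linked (~` K) x y ->
  exists k, [/\ O k, K k & limit_of (linked (~` K) x) k].
Proof.
move=> oO cK Kx [l [cl lx]] nxy; apply: contrapT => hn.
suff gen u : linked (~` K) x u -> chainR (step O) u l -> linked (~` K) x (last u l).
  by apply: nxy; rewrite -lx; apply: gen => //; exact: linked_refl.
elim: l u {cl lx} => [|v l IH] u xu //= [uv cl]; apply: IH cl.
case: uv => c [r [cu cv h]]; have r0 := box_gt0 cu.
have := @I01_ind R (fun t => linked (~` K) x (lerp u v t)) _ 0 1 (@I01P0 R) (@I01P1 R).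
rewrite lerp0 lerp1; apply=> // t It.
set z := lerp u v t.
have cz : box r c z by exact: box_lerp.
have Oz : O z by apply: h; apply: box_le cz; lra.
have loc (Q : set P2) e : 0 < e -> (forall y, box e z y -> (Q y <-> Q z)) -> exists2 e', 0 < e' &
    forall s, I01P s -> `|s - t| < e' -> (Q (lerp u v s) <-> Q z).
  move=> e0 he; have [d d0 hd] := lerp_cts u v It e0; exists d => // s Is /(hd _ Is); exact: he.
case: (pselect (linked (~` K) x z)) => xz.
  have [e e0 he] := linked_opn cK Kx xz; apply: (loc _ e) => // y0 /he xy; by split.
case: (pselect (K z)) => Kz; last first.
  have [e e0 he] := opn_step cK Kz; apply: (loc _ e) => // y0 /he /linked_step zy; split=> // xy.
  exact: linked_trans xy (linked_sym zy).
have [e e0 he] : exists2 e, 0 < e & forall y, box e z y -> ~ linked (~` K) x y.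
  apply: contrapT => hh; apply: hn; exists z; split=> // e e0; apply: contrapT => h2.
  by apply: hh; exists e => // y0 zy xy; apply: h2; exists y0.
by apply: (loc _ e) => // y0 /he nxy0; split.
Qed.

Lemma opnI O O' : opn O -> opn O' -> opn (O `&` O').
Proof.
move=> o o' x [/o [r r0 h] /o' [r' r'0 h']].
have m0 : 0 < Num.min r r' by rewrite lt_min r0.
exists (Num.min r r') => // y xy; split; [apply: h|apply: h']; apply: box_le xy;
by rewrite ge_min lexx ?orbT.
Qed.

Lemma opn_neq z : opn (~` [set z]).
Proof.
move=> x /= xz; have [r r0 h] := nnr_sep xz; exists r => // y xy /= e; apply: h.
by rewrite -e; exact: box_sym.
Qed.

Lemma clsU K K' : cls K -> cls K' -> cls (K `|` K').
Proof. by move=> c c'; rewrite /cls setCU; exact: opnI. Qed.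

(** Four open half boxes cover the punctured box, and each meets its neighbours. This serves to walk
    around a node. *)
Lemma linked_punctured r z y y' : box r z y -> box r z y' -> y <> z -> y' <> z ->
  linked (box r z `&` ~` [set z]) y y'.
Proof.
move=> zy zy' ny ny'; have r0 := box_gt0 zy.
have oO : opn (box r z `&` ~` [set z]) by apply: opnI; [exact: box_opn|exact: opn_neq].
have lin (f : P2 -> R) a b : (forall a b t, I01P t -> 0 < f a -> 0 < f b -> 0 < f (lerp a b t)) ->
    ~ (0 < f z) -> box r z a -> box r z b -> 0 < f a -> 0 < f b -> linked (box r z `&` ~` [set z]) a b.
  move=> fl fz za zb fa fb; apply: seg_linked oO _ => t It; split; first exact: box_lerp.
  by move=> /= e; apply: fz; rewrite -e; exact: fl.
have lb (u v c t : R) : I01P t -> 0 < u - c -> 0 < v - c -> 0 < u + t * (v - u) - c.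
  move=> It uc vc; have /andP[] : c < u + t * (v - u) < u + v - c by apply: lerp_bd => //; lra.
  lra.
have lb' (u v c t : R) : I01P t -> 0 < c - u -> 0 < c - v -> 0 < c - (u + t * (v - u)).
  move=> It uc vc; have /andP[] : u + v - c < u + t * (v - u) < c by apply: lerp_bd => //; lra.
  lra.
have L1 a b : box r z a -> box r z b -> z.1 < a.1 -> z.1 < b.1 -> linked (box r z `&` ~` [set z]) a b.
  move=> za zb *; apply: (lin (fun x : P2 => x.1 - z.1)) => //=; [by move=> a' b' t It; exact: lb|by rewrite subrr ltxx|lra|lra].
have L2 a b : box r z a -> box r z b -> a.1 < z.1 -> b.1 < z.1 -> linked (box r z `&` ~` [set z]) a b.
  move=> za zb *; apply: (lin (fun x : P2 => z.1 - x.1)) => //=; [by move=> a' b' t It; exact: lb'|by rewrite subrr ltxx|lra|lra].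
have L3 a b : box r z a -> box r z b -> z.2 < a.2 -> z.2 < b.2 -> linked (box r z `&` ~` [set z]) a b.
  move=> za zb *; apply: (lin (fun x : P2 => x.2 - z.2)) => //=; [by move=> a' b' t It; exact: lb|by rewrite subrr ltxx|lra|lra].
have L4 a b : box r z a -> box r z b -> a.2 < z.2 -> b.2 < z.2 -> linked (box r z `&` ~` [set z]) a b.
  move=> za zb *; apply: (lin (fun x : P2 => z.2 - x.2)) => //=; [by move=> a' b' t It; exact: lb'|by rewrite subrr ltxx|lra|lra].
pose pp : P2 := (z.1 + r / 2, z.2 + r / 2).
have zpp : box r z pp by split => /=; lra.
suff to x : box r z x -> x <> z -> linked (box r z `&` ~` [set z]) x pp.
  by apply: linked_trans (to _ zy ny) _; apply: linked_sym; exact: to.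
move=> zx nx.
case: (ltgtP x.1 z.1) => h1; [|by apply: L1 => //=; lra|].
  apply: (linked_trans (y := (z.1 - r / 2, z.2 + r / 2))).
    by apply: L2 => //=; [split => /=; lra|lra].
  by apply: L3 => //=; [split => /=; lra|lra|lra].
case: (ltgtP x.2 z.2) => h2; [|by apply: L3 => //=; lra|].
  apply: (linked_trans (y := (z.1 + r / 2, z.2 - r / 2))).
    by apply: L4 => //=; [split => /=; lra|lra].
  by apply: L1 => //=; [split => /=; lra|lra|lra].
by case: nx; case: (x) (z) h1 h2 => x1 x2 [z1 z2] /= -> ->.
Qed.

End Exit.

(** * Faces along a segment *)

Section Faces.
Variable R : realType.
Local Notation P2 := (R * R)%type.
Variables (S N : finType) (src tgt : S -> N) (pos : N -> P2) (arc : S -> R -> P2).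
Hypothesis G : plane_graph src tgt pos arc.
Implicit Types (H C T : {set S}) (p q x y z : P2) (s : S).

Local Notation K := (Kset arc [set: S]%SET).

Definition touches p s := exists2 z, open_arc arc s z & limit_of (linked (~` K) p) z.

Lemma touches_linked p q s : linked (~` K) p q -> touches p s -> touches q s.
Proof.
move=> pq [z oz lz]; exists z => // r /lz [y zy py]; exists y => //.
exact: linked_trans (linked_sym pq) py.
Qed.

Lemma KsetT s : K = Kset arc [set~ s]%SET `|` arci (arc s).
Proof. by rewrite -KsetU1 //; congr Kset; apply/finset.setP => s'; rewrite !inE; case: eqP. Qed.

Lemma open_arc_K s z : open_arc arc s z -> ~ Kset arc [set~ s]%SET z.
Proof.
move=> oz [s']; rewrite !inE => ss' hz.
by rewrite (open_arc_inj G oz hz) eqxx in ss'.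
Qed.

Lemma open_arc_linked s z z' : open_arc arc s z -> open_arc arc s z' ->
  linked (~` Kset arc [set~ s]%SET) z z'.
Proof.
move=> [t [t0 t1 <-]] [t' [t0' t1' <-]].
have It : I01P t by split; exact: ltW.
have It' : I01P t' by split; exact: ltW.
have := path_linked (cls_Kset G (H := [set~ s]%SET)) (sub_pcts (pg_cts G s) It It') _ (@I01P0 R) (@I01P1 R).
rewrite /sub_arc mul0r addr0 mul1r subrKC; apply=> u Iu.
apply: open_arc_K; exists (t + u * (t' - t)).
by have /andP[? ?] : 0 < t + u * (t' - t) < 1 by apply: lerp_bd.
Qed.

(* If the face of p avoided a neighbourhood of some point of the open arc, it
   would be separated from that point by the graph with an inner piece of the arc
   deleted; but the two remaining stubs separate nothing. *)
Lemma touches_everywhere p s z : ~ K p -> touches p s -> open_arc arc s z -> limit_of (linked (~` K) p) z.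
Proof.
move=> Kp [z0 oz0 lz0] oz; apply: contrapT => hn.
have [r1 r10 hr1] : exists2 r, 0 < r & forall y, box r z y -> ~ linked (~` K) p y.
  apply: contrapT => hh; apply: hn => r r0; apply: contrapT => h2; apply: hh.
  by exists r => // y zy py; apply: h2; exists y.
have [w [w0 w1 zE]] := oz.
have Iw : I01P w by split; exact: ltW.
have [d d0 hd] := (pg_cts G s) _ Iw _ r10.
pose e := Num.min d (Num.min w (1 - w)) / 2.
have e0 : 0 < e by rewrite divr_gt0 // !lt_min d0 w0 subr_gt0 w1.
have [ed e1 e2] : [/\ e * 2 <= d, e * 2 <= w & e * 2 <= 1 - w].
  by split; rewrite /e divfK ?pnatr_eq0 // !ge_min lexx ?orbT.
set H := [set~ s]%SET; have cH := ucpt_Kset G (H := H).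
have sH : s \notin H by rewrite !inE eqxx.
have I0 := @I01P0 R; have I1 := @I01P1 R.
have Iu : I01P (w - e) by split; lra.
have Iv : I01P (w + e) by split; lra.
have u0 : 0 < w - e by lra.
have v1 : w + e < 1 by lra.
pose s1 := sub_arc (arc s) 0 (w - e); pose s2 := sub_arc (arc s) (w + e) 1.
have c1 : pcts s1 by apply: sub_pcts => //; exact: (pg_cts G).
have c2 : pcts s2 by apply: sub_pcts => //; exact: (pg_cts G).
have i1 : pinj s1 by apply: sub_pinj => //; [exact: (pg_inj G)|rewrite lt_eqF].
have i2 : pinj s2 by apply: sub_pinj => //; [exact: (pg_inj G)|rewrite lt_eqF].
have sub1 : arci s1 `<=` arci (arc s) by exact: sub_arci_sub.
have sub2 : arci s2 `<=` arci (arc s) by exact: sub_arci_sub.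
have nH : ~ Kset arc H z by exact: open_arc_K.
have n1 : ~ arci s1 z.
  move/(sub_arciP _ _ u0) => [t [t0 t1]]; rewrite -zE => /(pg_inj G _ Iw) tw.
  have : t = w by apply: tw; split; lra.
  lra.
have n2 : ~ arci s2 z.
  move/(sub_arciP _ _ v1) => [t [t0 t1]]; rewrite -zE => /(pg_inj G _ Iw) tw.
  have : t = w by apply: tw; split; lra.
  lra.
have KH x : Kset arc H x -> K x by apply: Kset_sub; exact: finset.subsetT.
have Ks x : arci (arc s) x -> K x by move=> h; exists s; rewrite ?inE.
have pz : linked (~` Kset arc H) p z.
  have [r r0 hr] := (cls_Kset G (H := H)) _ (open_arc_K oz0).
  have [y zy py] := lz0 _ r0.
  apply: (linked_trans (y := y)); first by apply: linked_sub py => x nx /KH.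
  apply: (linked_trans (y := z0)); last exact: open_arc_linked.
  by apply: linked_ball hr zy _; exact: box_refl.
have pz1 : linked (~` (Kset arc H `|` arci s1)) p z.
  apply: (linked_attach (a := pos (src s)) cH c1 i1) pz => //.
  - move=> k Hk; move/(sub_arciP _ _ u0) => [t [t0 t1 tk]].
    case: (ltP 0 t) => t0'.
      case: (open_arc_K (s := s) (z := k)) => //; exists t; split=> //; lra.
    by rewrite -tk -(pg_src G); congr arc; lra.
  - by case=> [/KH|/sub1/Ks].
  - by case.
have pz2 : linked (~` (Kset arc H `|` arci s1 `|` arci s2)) p z.
  apply: (linked_attach (a := pos (tgt s)) (ucptU cH (ucpt_arc c1)) c2 i2) pz1 => //.
  - move=> k Hk; move/(sub_arciP _ _ v1) => [t [t0 t1 tk]].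
    case: (ltP t 1) => t1'; last by rewrite -tk -(pg_tgt G); congr arc; lra.
    case: Hk => [Hk|].
      by case: (open_arc_K (s := s) (z := k)) => //; exists t; split=> //; lra.
    move/(sub_arciP _ _ u0) => [t' [t0' t1'' tk']].
    have : t = t'.
      apply: (pg_inj G (s := s)); [split; lra|split; lra|by rewrite tk tk'].
    by move=> tt; exfalso; lra.
  - by case=> [[/KH|/sub1/Ks]|/sub2/Ks].
  - by case=> [[]|].
have cO : opn (~` (Kset arc H `|` arci s1 `|` arci s2)).
  by apply: ucpt_cls; apply: ucptU; [apply: ucptU => //; exact: ucpt_arc|exact: ucpt_arc].
have Kz : K z by apply: Ks; exact: open_arc_sub.
(* The exit point is on the graph but off the stubs, so on the inner piece removed, which lies
   within [r1] of [z]. *)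
have [|k [Ok Kk lk]] := linked_exit cO (cls_Kset G (H := [set: S]%SET)) Kp pz2.
  by move=> /(linked_in Kp).
have zk : box r1 z k.
  move: Kk; rewrite (KsetT s) => -[Hk|[t It tk]]; first by case: Ok; left; left.
  rewrite -zE -tk; apply: hd => //; rewrite ltr_norml.
  case: It => t0 t1; apply/andP; split; rewrite ltNge; apply/negP => hh; apply: Ok.
    by left; right; apply/(sub_arciP _ _ u0); exists t; split=> //; lra.
  by right; apply/(sub_arciP _ _ v1); exists t; split=> //; lra.
have [r r0 hr] := box_opn zk.
by have [y /hr zy /(hr1 _ zy)] := lk _ r0.
Qed.

(** All three faces come close to one inner point of [s], inside a box that misses the rest of the
    graph; [arc_two_sides] then joins two of them. *)
Lemma touches_two p q x s : ~ K p -> ~ K q -> ~ K x -> touches p s -> touches q s -> touches x s ->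
  [\/ linked (~` K) p q, linked (~` K) p x | linked (~` K) q x].
Proof.
move=> Kp Kq Kx tp tq tx.
have [z oz] : exists z, open_arc arc s z by exists (arc s (1/2)), (1/2); split=> //; lra.
have [r r0 hr] := (cls_Kset G (H := [set~ s]%SET)) _ (open_arc_K oz).
have lim u : ~ K u -> touches u s -> exists y, [/\ box r z y, linked (~` K) u y & ~ K y].
  move=> Ku tu; have [y zy uy] := touches_everywhere Ku tu oz r0.
  by exists y; split=> //; exact: linked_in uy.
have [p' [zp pp Kp']] := lim _ Kp tp; have [q' [zq qq Kq']] := lim _ Kq tq.
have [x' [zx xx Kx']] := lim _ Kx tx.
have KE := KsetT s; rewrite KE in Kp' Kq' Kx' pp qq xx *.
have := arc_two_sides (ucpt_Kset G (H := [set~ s]%SET)) (pg_cts G s) (pg_inj G (s := s))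
  (fun k => @Kset_arci_ends _ _ _ _ _ _ _ G s [set~ s]%SET k _) Kp' Kq' Kx'
  (linked_ball hr zp zq) (linked_ball hr zp zx).
case=> [|h|h|h]; first by rewrite !inE eqxx.
- by apply: Or31; apply: linked_trans pp (linked_trans h (linked_sym qq)).
- by apply: Or32; apply: linked_trans pp (linked_trans h (linked_sym xx)).
- by apply: Or33; apply: linked_trans qq (linked_trans h (linked_sym xx)).
Qed.

End Faces.

(** * Unions of faces and segments; multiplicities *)

Section Merge.
Variable R : realType.
Local Notation P2 := (R * R)%type.
Variables (S N : finType) (src tgt : S -> N) (pos : N -> P2) (arc : S -> R -> P2).
Hypothesis G : plane_graph src tgt pos arc.
Implicit Types (H C T : {set S}) (p q x y z : P2) (s t : S) (v : N).

Local Notation K := (Kset arc [set: S]%SET).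
Local Notation touches := (touches arc).

Lemma Karc s x : arci (arc s) x -> K x.
Proof. by exists s; rewrite ?inE. Qed.

Lemma Kset_K C x : Kset arc C x -> K x.
Proof. by apply: Kset_sub; exact: finset.subsetT. Qed.

Lemma open_arc_ball s z : open_arc arc s z -> exists2 r, 0 < r &
  forall y, box r z y -> K y -> open_arc arc s y.
Proof.
move=> oz.
have o1 := cls_Kset G (H := [set~ s]%SET); have o2 := opn_neq (z := pos (src s)).
have o3 := opn_neq (z := pos (tgt s)).
have [|r r0 hr] := (opnI (opnI o1 o2) o3) z.
- split; first split.
  + exact: (open_arc_K G).
  + by move=> /= e; move: oz; rewrite e; exact: (open_arc_node G).
  + by move=> /= e; move: oz; rewrite e; exact: (open_arc_node G).
exists r => // y /hr [[h1 h2] h3]; rewrite (KsetT arc s) => -[//|/(arciP G)].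
by case.
Qed.

Lemma Kset_node C v : Kset arc C (pos v) -> exists2 s, s \in C & src s = v \/ tgt s = v.
Proof.
case=> s sC /(arciP G) [/(open_arc_node G) //|/(pg_pos G) e|/(pg_pos G) e]; exists s => //.
  by left.
by right.
Qed.

Lemma incident_near s v r : src s = v \/ tgt s = v -> 0 < r -> exists2 y, open_arc arc s y & box r (pos v) y.
Proof.
move=> e r0; case: e => <-.
  have [d d0 hd] := pg_cts G s (@I01P0 R) r0.
  pose u := Num.min d 1 / 2; have u0 : 0 < u by rewrite divr_gt0 // lt_min d0 ltr01.
  have [u1 u2] : u * 2 <= d /\ u * 2 <= 1.
    by split; rewrite /u divfK ?pnatr_eq0 // ge_min lexx ?orbT.
  exists (arc s u); first by exists u; split=> //; lra.
  rewrite -(pg_src G); apply: hd; first by split; lra.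
  by rewrite subr0 gtr0_norm //; lra.
have [d d0 hd] := pg_cts G s (@I01P1 R) r0.
pose u := Num.min d 1 / 2; have u0 : 0 < u by rewrite divr_gt0 // lt_min d0 ltr01.
have [u1 u2] : u * 2 <= d /\ u * 2 <= 1.
  by split; rewrite /u divfK ?pnatr_eq0 // ge_min lexx ?orbT.
exists (arc s (1 - u)); first by exists (1 - u); split=> //; lra.
rewrite -(pg_tgt G); apply: hd; first by split; lra.
by rewrite ltr_norml; apply/andP; split; lra.
Qed.

(* Faces p in Ps together with the open arcs in T form an open and relatively
   closed part of the complement of C. *)
Lemma merge (Ps : P2 -> Prop) C T p0 y0 :
  (forall v, exists s, src s = v \/ tgt s = v) ->
  (forall p, Ps p -> ~ K p) ->
  (forall p s, Ps p -> touches p s -> s \in C \/ s \in T) ->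
  (forall t, t \in T -> Kset arc C (pos (src t)) /\ Kset arc C (pos (tgt t))) ->
  (forall t q, t \in T -> ~ K q -> touches q t -> exists2 p, Ps p & linked (~` K) p q) ->
  Ps p0 -> linked (~` Kset arc C) p0 y0 ->
  (exists2 p, Ps p & linked (~` K) p y0) \/ (exists2 t, t \in T & open_arc arc t y0).
Proof.
move=> deg PK PT TC TP Pp0 [l [cl <-]].
set Y := fun y => (exists2 p, Ps p & linked (~` K) p y) \/ (exists2 t, t \in T & open_arc arc t y).
suff gen u : Y u -> chainR (step (~` Kset arc C)) u l -> Y (last u l).
  by apply: gen cl; left; exists p0 => //; exact: linked_refl.
elim: l u {cl} => [|v l IH] u Yu //= [uv cl]; apply: IH cl.
case: uv => c [r [cu cv h]]; have r0 := box_gt0 cu.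
have := @I01_ind R (fun t : R => Y (lerp u v t)) _ 0 1 (@I01P0 R) (@I01P1 R).
rewrite lerp0 lerp1; apply=> // tt It.
set z := lerp u v tt.
have cz : box r c z by exact: box_lerp.
have Cz : ~ Kset arc C z by apply: h; apply: box_le cz; lra.
suff [e e0 he] : exists2 e, 0 < e & forall y, box e z y -> (Y y <-> Y z).
  by have [d d0 hd] := lerp_cts u v It e0; exists d => // s Is /(hd _ Is); exact: he.
have oK := cls_Kset G (H := [set: S]%SET).
case: (pselect (K z)) => Kz; last first.
  have [e e0 he] := opn_step oK Kz; exists e => // y /he /linked_step zy; split.
    move=> [[p Pp py]|[t' _ /open_arc_sub /Karc Ky]].
      by left; exists p => //; apply: linked_trans py (linked_sym zy).
    by case: (linked_in Kz zy).
  move=> [[p Pp pz]|[t' _ /open_arc_sub /Karc //]].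
  by left; exists p => //; exact: linked_trans pz zy.
have [s _ /(arciP G) sz] := Kz.
have nlK y : K y -> (exists2 p, Ps p & linked (~` K) p y) -> False.
  by move=> Ky [p /PK Kp /(linked_in Kp)].
(* Near an inner point of a segment the graph is that segment, and every face present touches it, so
   [PT] and [TP] decide. *)
have on_arc s' : open_arc arc s' z -> exists2 e, 0 < e & forall y, box e z y -> (Y y <-> Y z).
  move=> oz; have [e e0 he] := open_arc_ball oz.
  have face y : box e z y -> ~ K y -> touches y s'.
    move=> zy Ky.
    have [||k [Ok Kk lk]] := linked_exit (box_opn (r := e) (c := z)) oK Ky (y := z).
    - by apply: linked_ball zy _; [|exact: box_refl].
    - by move=> /(linked_in Ky).
    - by exists k => //; exact: he.
  exists e => // y zy; case: (pselect (K y)) => Ky.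
    have oy := he _ zy Ky; split.
      move=> [/(nlK _ Ky)//|[t' t'T oy']]; right; exists t' => //.
      by rewrite (open_arc_inj G oy' (open_arc_sub oy)).
    move=> [/(nlK _ Kz)//|[t' t'T oz']]; right; exists t' => //.
    by rewrite (open_arc_inj G oz' (open_arc_sub oz)).
  split.
    move=> [[p Pp py]|[t' _ /open_arc_sub /Karc //]].
    have tp : touches p s' by apply: touches_linked (linked_sym py) (face _ zy Ky).
    case: (PT _ _ Pp tp) => s'C; last by right; exists s'.
    by case: Cz; exists s' => //; exact: open_arc_sub.
  move=> [/(nlK _ Kz)//|[t' t'T oz']]; left.
  apply: (TP t') => //; by rewrite (open_arc_inj G oz' (open_arc_sub oz)); exact: face.
suff on_node w : z = pos w -> exists2 e, 0 < e & forall y, box e z y -> (Y y <-> Y z).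
  by case: sz => [|zE|zE]; [exact: on_arc|exact: on_node zE|exact: on_node zE].
move=> zE {sz}.
(* A node is never in [Y], so it remains to keep every face of [Ps] and every segment of [T] away
   from a node off [C]. *)
have nz : ~ Y z by move=> [/(nlK _ Kz)//|[t' _]]; rewrite zE => /(open_arc_node G).
have wT t' : t' \in T -> src t' <> w /\ tgt t' <> w.
  by move=> /TC [h1 h2]; split=> e; apply: Cz; rewrite zE -e.
have o1 := cls_Kset G (H := C); have o2 := cls_Kset G (H := T).
have nT : ~ Kset arc T z by rewrite zE => /Kset_node [t' /wT [h1 h2]] [].
have [e1 e10 he1] := opnI o1 o2 (conj Cz nT).
have [e2 e20 he2] : exists2 e, 0 < e & forall v', v' != w -> ~ box e z (pos v').
  have fin (L : seq N) : exists2 e, 0 < e & forall v', v' \in L -> v' != w -> ~ box e z (pos v').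
    elim: L => [|v1 L [e e0 he]]; first by exists 1.
    case: (eqVneq v1 w) => [->|v1w].
      by exists e => // v'; rewrite inE => /predU1P [->|]; [rewrite eqxx|exact: he].
    have [e' e'0 he'] : exists2 r, 0 < r & ~ box r (pos v1) z.
      by apply: nnr_sep => zv; move: v1w; rewrite zE in zv; rewrite (pg_pos G zv) eqxx.
    exists (Num.min e e'); first by rewrite lt_min e0.
    move=> v'; rewrite inE => /predU1P [->|v'L] v'w hh.
      by apply: he'; apply: box_sym; apply: box_le hh; rewrite ge_min lexx orbT.
    by apply: (he v') => //; apply: box_le hh; rewrite ge_min lexx.
  by have [e e0 he] := fin (enum N); exists e => // v'; apply: he; exact: mem_enum.
pose e := Num.min e1 e2; have e0 : 0 < e by rewrite lt_min e10.
have [l1 l2] : e <= e1 /\ e <= e2 by split; rewrite ge_min lexx ?orbT.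
exists e => // y zy; split=> // -[[p Pp py]|[t' t'T oy]]; last first.
  by have [_ []] := he1 _ (box_le l1 zy); exists t' => //; exact: open_arc_sub.
have [s' hs'] := deg w; have [y' oy' zy'] := incident_near hs' e0; rewrite -zE in zy'.
have Kp := PK _ Pp; have Ky := linked_in Kp py.
have Ky' : K y' by apply: Karc; exact: open_arc_sub oy'.
have yz : y <> z by move=> yz; rewrite yz in Ky.
have y'z : y' <> z by move=> yz'; move: oy'; rewrite yz' zE; exact: (open_arc_node G).
(* A face of [Ps] near the node would reach a segment inside the punctured box, on the way to the
   incident one. It touches that segment, which is then in [C] or [T], but the box misses both. *)
have [|k [[zk nk] Kk lk]] := linked_exit (opnI (box_opn (r := e) (c := z)) (opn_neq (z := z))) oK Ky
       (linked_punctured zy zy' yz y'z).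
  by move=> /(linked_in Ky).
have bad v' : k = pos v' -> False.
  move=> kE; case: (eqVneq v' w) => [vw|vw]; first by apply: nk; rewrite /= kE vw zE.
  by apply: (he2 _ vw); rewrite -kE; exact: box_le zk.
have [s2 _ /(arciP G) [ok|/bad//|/bad//]] := Kk.
have tp : touches p s2 by apply: touches_linked (linked_sym py) _; exists k.
have [h1 h2] := he1 _ (box_le l1 zk).
by case: (PT _ _ Pp tp) => hs2; [case: h1|case: h2]; exists s2 => //; exact: open_arc_sub.
Qed.

Definition nonsep C := forall p q, ~ Kset arc C p -> ~ Kset arc C q -> linked (~` Kset arc C) p q.

Lemma nonsep0 : nonsep finset.set0.
Proof.
have full : opn (~` Kset arc finset.set0) by exact: (cls_Kset G).
move=> p q _ _; apply: seg_linked full _ => t It; rewrite Kset0; exact.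
Qed.

(** As [v] is a free end, [s] meets [C] at its other end at most. *)
Lemma nonsep_attach C s v : nonsep C -> s \notin C -> src s = v \/ tgt s = v ->
  (forall s', s' \in C -> src s' <> v /\ tgt s' <> v) -> nonsep (s |: C).
Proof.
move=> nC sC sv hv p q; rewrite KsetU1 => np nq.
have [a ha] : exists a, forall k, Kset arc C k -> arci (arc s) k -> k = a.
  have nv : ~ Kset arc C (pos v) by move=> /Kset_node [s' /hv [h1 h2]] [].
  case: sv => sv; [exists (pos (tgt s))|exists (pos (src s))] => k Ck sk.
    by case: (Kset_arci_ends G sC Ck sk) => // kE; move: Ck; rewrite kE sv.
  by case: (Kset_arci_ends G sC Ck sk) => // kE; move: Ck; rewrite kE sv.
apply: (linked_attach (a := a) (ucpt_Kset G (H := C)) (pg_cts G s) (pg_inj G (s := s))) => //.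
by apply: nC => h; [apply: np|apply: nq]; left.
Qed.

(* The face of p is the whole complement of a non-separating part C of the graph,
   so there is nothing else in the graph. *)
Lemma touches_nonsep C p : (forall v, exists s, src s = v \/ tgt s = v) -> ~ K p ->
  (forall s, touches p s -> s \in C) -> nonsep C -> forall s, s \in C.
Proof.
move=> deg Kp pC nC s; apply/negPn/negP => sC.
have oz : open_arc arc s (arc s (1/2)) by exists (1/2); split=> //; lra.
have Kz := Karc (open_arc_sub oz).
have Cz : ~ Kset arc C (arc s (1/2)).
  by case=> s' s'C /(open_arc_inj G oz) ss'; move: sC; rewrite ss' s'C.
have pz : linked (~` Kset arc C) p (arc s (1/2)) by apply: nC => // /Kset_K.
case: (@merge (fun y => y = p) C finset.set0 p (arc s (1/2)) deg _ _ _ _ erefl pz).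
- by move=> _ ->.
- by move=> _ s' -> /pC; left.
- by move=> t; rewrite inE.
- by move=> t q; rewrite inE.
- by case=> _ -> /(linked_in Kp).
- by case=> t; rewrite inE.
Qed.

(** How many sides of [s] lie on the face of [p], read off without a facial walk: both of them when
    no other face touches [s]. *)
Definition mult p s : nat :=
  if `[< touches p s >] then
    (if `[< exists q, [/\ ~ K q, touches q s & ~ linked (~` K) p q] >] then 1 else 2)%N
  else 0%N.

Lemma mult_gt0 p s : (0 < mult p s)%N <-> touches p s.
Proof. by rewrite /mult; case: asboolP => // ?; case: asboolP. Qed.

Lemma mult_le2 p s : (mult p s <= 2)%N.
Proof. by rewrite /mult; case: asboolP => // ?; case: asboolP. Qed.

Lemma sum_mult_le2 F (p : nat -> P2) s : face_reps arc [set: S]%SET F p ->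
  (\sum_(i < F) mult (p i) s <= 2)%N.
Proof.
case=> pK pl.
case: (pselect (exists i : 'I_F, touches (p i) s)) => [[i ti]|ni]; last first.
  rewrite big1 // => i _; apply/eqP; rewrite -leqn0 leqNgt; apply/negP => /mult_gt0 ti.
  by apply: ni; exists i.
rewrite (bigD1 i) //=.
case: (pselect (exists j : 'I_F, j != i /\ touches (p j) s)) => [[j [ji tj]]|nj]; last first.
  rewrite big1 ?addn0 ?mult_le2 // => j ji; apply/eqP; rewrite -leqn0 leqNgt; apply/negP => /mult_gt0 tj.
  by apply: nj; exists j.
have one (a b : 'I_F) : a != b -> touches (p a) s -> touches (p b) s -> mult (p a) s = 1%N.
  move=> ab ta tb; rewrite /mult; case: asboolP => // _; case: asboolP => // -[].
  by exists (p b); split=> //; [exact: pK|exact: pl].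
rewrite (bigD1 j) //= (one i j) 1?eq_sym // (one j i) // big1 // => k /andP [ki kj].
apply/eqP; rewrite -leqn0 leqNgt; apply/negP => /mult_gt0 tk.
have [||] := touches_two G (pK i (ltn_ord i)) (pK j (ltn_ord j)) (pK k (ltn_ord k)) ti tj tk; apply: pl => //.
- by rewrite eq_sym.
- by rewrite eq_sym.
- by rewrite eq_sym.
Qed.

End Merge.

(** * Stereographic projection *)

Section Stereo.
Variable R : realType.
Local Notation P2 := (R * R)%type.
Local Notation pt := (R * R * R)%type.

Definition dot3 (x y : pt) : R := x.1.1 * y.1.1 + x.1.2 * y.1.2 + x.2 * y.2.

(* Reflection exchanging [o] and the north pole; when they coincide the division
   by 0 makes it the identity. *)
Definition swap_axis (o : pt) : pt := (o.1.1, o.1.2, o.2 - 1).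
Definition mirror c (v x : pt) : pt :=
  let k := c * dot3 x v in (x.1.1 - k * v.1.1, x.1.2 - k * v.1.2, x.2 - k * v.2).
Definition swap (o x : pt) : pt :=
  mirror (2 / dot3 (swap_axis o) (swap_axis o)) (swap_axis o) x.

Lemma mirror_dot c v x y : c * dot3 v v = 2 -> dot3 (mirror c v x) (mirror c v y) = dot3 x y.
Proof.
case: v x y => [[A B] C] [[x1 x2] x3] [[y1 y2] y3]; rewrite /dot3 /mirror /dot3 /= => h.
set X := x1 * A + x2 * B + x3 * C; set Y := y1 * A + y2 * B + y3 * C.
transitivity (x1 * y1 + x2 * y2 + x3 * y3 + c * X * Y * (c * (A * A + B * B + C * C) - 2)).
  by rewrite /X /Y; ring.
by rewrite h subrr mulr0 addr0.
Qed.

Lemma mirrorK c v : c * dot3 v v = 2 -> involutive (mirror c v).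
Proof.
case: v => [[A B] C] + [[x1 x2] x3]; rewrite /mirror /dot3 /= => h.
set X := x1 * A + x2 * B + x3 * C.
have -> : c * ((x1 - c * X * A) * A + (x2 - c * X * B) * B + (x3 - c * X * C) * C) = - (c * X).
  transitivity (c * X * (1 - c * (A * A + B * B + C * C))); first by rewrite /X; ring.
  by rewrite h; ring.
by congr (_, _, _); ring.
Qed.

Lemma mirror0 c x : mirror c (0, 0, 0) x = x.
Proof. by rewrite /mirror /= !mulr0 !subr0; case: x => [[]]. Qed.

Definition stereo_n (x : pt) : P2 := (x.1.1 / (1 - x.2), x.1.2 / (1 - x.2)).
Definition stereo_inv_n (y : P2) : pt :=
  let s := y.1 ^+ 2 + y.2 ^+ 2 in (2 * y.1 / (s + 1), 2 * y.2 / (s + 1), (s - 1) / (s + 1)).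

Definition stereo o x := stereo_n (swap o x).
Definition stereo_inv o y := swap o (stereo_inv_n y).

Lemma sphereE (x : pt) : sphere x <-> dot3 x x = 1.
Proof. by rewrite /sphere /dot3 /= -!expr2. Qed.

Lemma swap_coef o : let v := swap_axis o in 2 / dot3 v v * dot3 v v = 2 \/ v = (0, 0, 0).
Proof.
move=> v; case: (eqVneq (dot3 v v) 0) => [d0|]; last by left; rewrite divfK.
right; move: d0; rewrite /dot3; case: v => [[a b] c] /= /eqP.
rewrite -!expr2 paddr_eq0 ?addr_ge0 ?sqr_ge0 // paddr_eq0 ?sqr_ge0 // !sqrf_eq0.
by move=> /andP[/andP[/eqP -> /eqP ->] /eqP ->].
Qed.

Lemma swap_dot o x y : dot3 (swap o x) (swap o y) = dot3 x y.
Proof.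
by case: (swap_coef o) => [h|v0]; [exact: mirror_dot|rewrite /swap v0 !mirror0].
Qed.

Lemma swapK o : involutive (swap o).
Proof.
move=> x; case: (swap_coef o) => [h|v0]; first exact: mirrorK.
by rewrite /swap v0 !mirror0.
Qed.

Lemma swap_pole o : sphere o -> swap o o = (0, 0, 1).
Proof.
move/sphereE=> so; case: (swap_coef o) => [|v0]; last first.
  rewrite /swap v0 mirror0; move: v0; case: (o) => [[a b] c]; rewrite /swap_axis /= => -[-> -> h].
  by congr (_, _, _); lra.
rewrite /swap; set k := 2 / _; clearbody k; move: so; case: o => [[a b] c].
rewrite /mirror /dot3 /swap_axis /= => so h.
have e : k * (a * a + b * b + c * (c - 1)) = 1.
  have e1 : a * a + b * b + (c - 1) * (c - 1) = (1 - c) * 2 by lra.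
  have e2 : a * a + b * b + c * (c - 1) = 1 - c by lra.
  by move: h; rewrite e1 e2 mulrA; lra.
by rewrite e !mul1r; congr (_, _, _); ring.
Qed.

Lemma stereo_nK x : dot3 x x = 1 -> x.2 != 1 -> stereo_inv_n (stereo_n x) = x.
Proof.
case: x => [[a b] c]; rewrite /dot3 /stereo_inv_n /stereo_n /= => h c1.
have d : 1 - c != 0 by rewrite subr_eq0 eq_sym.
have sE : (a / (1 - c)) ^+ 2 + (b / (1 - c)) ^+ 2 = (1 + c) / (1 - c).
  have -> : (a / (1 - c)) ^+ 2 + (b / (1 - c)) ^+ 2 = (a * a + b * b) / ((1 - c) * (1 - c)) by field.
  have -> : a * a + b * b = (1 + c) * (1 - c) by lra.
  by field.
have s1 : (1 + c) / (1 - c) + 1 = 2 / (1 - c) by field.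
rewrite sE s1; congr (_, _, _); field; by rewrite ?d ?pnatr_eq0.
Qed.

Lemma stereo_inv_n_sphere y : dot3 (stereo_inv_n y) (stereo_inv_n y) = 1.
Proof.
case: y => a b; rewrite /dot3 /stereo_inv_n /=.
have d : a ^+ 2 + b ^+ 2 + 1 != 0.
  by rewrite gt_eqF // ltr_wpDl // addr_ge0 // sqr_ge0.
by field.
Qed.

Lemma stereo_inv_n_pole y : (stereo_inv_n y).2 != 1.
Proof.
case: y => a b; rewrite /stereo_inv_n /=.
have d : 0 < a ^+ 2 + b ^+ 2 + 1 by rewrite ltr_wpDl // addr_ge0 // sqr_ge0.
by rewrite lt_eqF // ltr_pdivrMr // mul1r; lra.
Qed.

Lemma stereo_inv_nK y : stereo_n (stereo_inv_n y) = y.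
Proof.
case: y => a b; rewrite /stereo_inv_n /stereo_n /=.
have d : a ^+ 2 + b ^+ 2 + 1 != 0.
  by rewrite gt_eqF // ltr_wpDl // addr_ge0 // sqr_ge0.
have -> : 1 - (a ^+ 2 + b ^+ 2 - 1) / (a ^+ 2 + b ^+ 2 + 1) = 2 / (a ^+ 2 + b ^+ 2 + 1) by field.
by congr (_, _); field; rewrite ?d ?pnatr_eq0.
Qed.

Lemma swap_pole_eq o x : sphere o -> sphere x -> x <> o -> (swap o x).2 != 1.
Proof.
move=> so sx; apply: contra_notN => /eqP h.
have := swap_dot o x x; rewrite (sphereE x).1 //.
move: h; case E: (swap o x) => [[a b] c] /= c1; rewrite /dot3 /= c1 mul1r => e.
have /eqP : a ^+ 2 + b ^+ 2 = 0 by rewrite !expr2; lra.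
rewrite paddr_eq0 ?sqr_ge0 // !sqrf_eq0 => /andP[/eqP a0 /eqP b0].
by rewrite -(swapK o x) E a0 b0 c1 -(swap_pole so) swapK.
Qed.

Lemma stereoK o x : sphere o -> sphere x -> x <> o -> stereo_inv o (stereo o x) = x.
Proof.
move=> so sx xo; rewrite /stereo_inv /stereo stereo_nK ?swapK ?swap_pole_eq //.
by rewrite swap_dot; exact/sphereE.
Qed.

Lemma stereo_invK o y : stereo o (stereo_inv o y) = y.
Proof. by rewrite /stereo /stereo_inv swapK stereo_inv_nK. Qed.

Lemma stereo_inv_sphere o y : sphere (stereo_inv o y).
Proof. by apply/sphereE; rewrite swap_dot stereo_inv_n_sphere. Qed.

Lemma stereo_inv_neq o y : sphere o -> stereo_inv o y <> o.
Proof.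
move=> so; rewrite /stereo_inv => e.
have : swap o (swap o (stereo_inv_n y)) = swap o o by rewrite e.
rewrite swapK swap_pole // => e2; have := stereo_inv_n_pole y.
by rewrite e2 eqxx.
Qed.

(** On the sphere the squared norm of the projection is [(1 + h) / (1 - h)] with [h] the height
    after [swap]; cleared of its denominator, the bound still makes sense at the pole. *)
Lemma stereo_far o x M : sphere o -> sphere x -> x <> o -> box M (0, 0) (stereo o x) ->
  1 + (swap o x).2 < 2 * M ^+ 2 * (1 - (swap o x).2).
Proof.
move=> so sx xo; have := swap_pole_eq so sx xo; have := swap_dot o x x.
rewrite (sphereE x).1 // /stereo /stereo_n; case: (swap o x) => [[a b] c]; rewrite /dot3 /= => e c1 [/= h1 h2 h3 h4].
have c1' : c < 1.
  rewrite lt_neqAle c1 /=.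
  rewrite leNgt; apply/negP => c2.
  have : 0 < (c - 1) * (c - 1) by apply: mulr_gt0; lra.
  by have := sqr_ge0 a; have := sqr_ge0 b; rewrite !expr2; lra.
have d : 0 < 1 - c by lra.
have sq u : 0 - M < u -> u < 0 + M -> u ^+ 2 < M ^+ 2.
  by move=> u1 u2; rewrite -(real_normK (num_real u)) ltr_pXn2r ?nnegrE //; [rewrite ltr_norml; apply/andP; split; lra|lra].
have := ltrD (sq _ h1 h2) (sq _ h3 h4).
have -> : (a / (1 - c)) ^+ 2 + (b / (1 - c)) ^+ 2 = (1 + c) / (1 - c).
  have d' : 1 - c != 0 by rewrite gt_eqF.
  have -> : (a / (1 - c)) ^+ 2 + (b / (1 - c)) ^+ 2 = (a * a + b * b) / ((1 - c) * (1 - c)) by field.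
  have -> : a * a + b * b = (1 + c) * (1 - c) by lra.
  by field.
by rewrite ltr_pdivrMr //; lra.
Qed.

End Stereo.

(** * Continuity of the projection *)

Section StereoCont.
Variable R : realType.
Local Notation P2 := (R * R)%type.
Local Notation pt := (R * R * R)%type.

Lemma cts_pair (T U V : topologicalType) (f : T -> U) (g : T -> V) (x : T) :
  {for x, continuous f} -> {for x, continuous g} -> {for x, continuous (fun y => (f y, g y))}.
Proof. by move=> cf cg; exact: cvg_pair. Qed.

Lemma cts_fst (T U V : topologicalType) (f : T -> U * V) (x : T) :
  {for x, continuous f} -> {for x, continuous (fun y => (f y).1)}.
Proof. by move=> cf; apply: (@cvg_comp _ _ _ f fst); [exact: cf|exact: cvg_fst]. Qed.

Lemma cts_snd (T U V : topologicalType) (f : T -> U * V) (x : T) :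
  {for x, continuous f} -> {for x, continuous (fun y => (f y).2)}.
Proof. by move=> cf; apply: (@cvg_comp _ _ _ f snd); [exact: cf|exact: cvg_snd]. Qed.

Lemma cts_id (T : topologicalType) (x : T) : {for x, continuous (fun y : T => y)}.
Proof. exact: cvg_id. Qed.

(** Decomposes continuity along the body of the function. A non-constant inverse is left as a goal,
    since it needs a nonzero denominator. *)
Local Ltac cts := lazymatch goal with
  | |- context [fun y => (@?f y, @?g y)] => apply: (@cts_pair _ _ _ f g); cts
  | |- context [fun y => @?f y + @?g y] => apply: (@continuousD _ _ _ f g); cts
  | |- context [fun y => @?f y * @?g y] => apply: (@continuousM _ _ f g); cts
  | |- context [fun y => @?f y ^+ 2] => apply: (@continuousM _ _ f f); cts
  | |- context [fun y => - @?f y] => apply: (@continuousN _ _ _ f); cts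
  | |- context [fun y => (@?f y).1] => apply: (@cts_fst _ _ _ f); cts
  | |- context [fun y => (@?f y).2] => apply: (@cts_snd _ _ _ f); cts
  | |- context [fun y => y] => exact: cts_id
  | |- context [fun y => (@?f y)^-1] => try exact: cst_continuous
  | |- _ => exact: cst_continuous
  end.

Lemma swap_cts o (x : pt) : {for x, continuous (swap o)}.
Proof. rewrite /swap /mirror /dot3 /=. cts. Qed.

Lemma stereo_n_cts (x : pt) : x.2 != 1 -> {for x, continuous (@stereo_n R)}.
Proof.
move=> h; rewrite /stereo_n; cts; (apply: continuousV; [by rewrite subr_eq0 eq_sym|cts]).
Qed.

Lemma stereo_cts o (x : pt) : sphere o -> sphere x -> x <> o -> {for x, continuous (stereo o)}.
Proof.
move=> so sx xo; apply: (@continuous_comp _ _ _ (swap o) (@stereo_n R)); first exact: swap_cts.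
by apply: stereo_n_cts; exact: swap_pole_eq.
Qed.

Lemma stereo_inv_cts o (y : P2) : {for y, continuous (stereo_inv o)}.
Proof.
apply: (@continuous_comp _ _ _ (@stereo_inv_n R) (swap o)); last exact: swap_cts.
have d : y.1 ^+ 2 + y.2 ^+ 2 + 1 != 0.
  by rewrite gt_eqF // ltr_wpDl // addr_ge0 // sqr_ge0.
rewrite /stereo_inv_n /=.
cts; (apply: continuousV => //; cts).
Qed.

Lemma box_nbhs (r : R) (x : P2) : 0 < r -> nbhs x (box r x).
Proof.
move=> r0; apply/nbhs_ballP; exists r => //= y [/= h1 h2]; move: h1 h2.
by rewrite /ball /= !ltr_norml => /andP[? ?] /andP[? ?]; split; lra.
Qed.

Lemma nbhs_box (x : P2) A : nbhs x A -> exists2 r, 0 < r & box r x `<=` A.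
Proof.
move=> /nbhs_ballP [r /= r0 h]; exists r => // y [? ? ? ?]; apply: h; split; rewrite /ball /= ltr_norml;
by apply/andP; split; lra.
Qed.

(** [f] is the difference of the two sides in [stereo_far]; it is positive at [o], hence nearby. *)
Lemma stereo_infinity o M : sphere o -> exists2 W : set pt, nbhs o W &
  forall x, W x -> sphere x -> x <> o -> ~ box M (0, 0) (stereo o x).
Proof.
move=> so; pose f (x : pt) : R := 1 + (swap o x).2 - 2 * M ^+ 2 * (1 - (swap o x).2).
have cf : {for o, continuous f}.
  have c2 : {for o, continuous (fun x => (swap o x).2)} by apply: cts_snd; exact: swap_cts.
  rewrite /f; apply: continuousD; first by apply: continuousD => //; cts.
  apply: continuousN; apply: continuousM; first by cts.
  by apply: continuousD; [cts|apply: continuousN].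
have f0 : 0 < f o by rewrite /f swap_pole //= subrr mulr0 subr0 ltr_pwDl.
exists (f @^-1` [set y | 0 < y]) => [|x /= fx sx xo /(stereo_far so sx xo)]; last by rewrite /f in fx; lra.
by apply: cf; apply: open_nbhs_nbhs; split => //; exact: open_gt.
Qed.

Lemma stereo_pcts o (g : R -> pt) (a b : R) : sphere o -> 0 <= a -> a <= b -> b <= 1 ->
  {within I01 (R:=R), continuous g} -> (forall t, I01P t -> sphere (g t)) ->
  (forall t, a <= t -> t <= b -> g t <> o) ->
  pcts (fun t => stereo o (g (a + t * (b - a)))).
Proof.
move=> so a0 ab b1 cg sg go t It e e0.
have par s : I01P s -> a <= a + s * (b - a) <= b.
  case=> s0 s1; have h1 : 0 <= s * (b - a) by apply: mulr_ge0; lra.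
  have h2 : 0 <= (1 - s) * (b - a) by apply: mulr_ge0; lra.
  by apply/andP; split; lra.
set u := a + t * (b - a); have /andP[u1 u2] := par _ It; rewrite -/u in u1 u2.
have Iu : I01P u by split; lra.
have I01E s : I01 (R:=R) s <-> I01P s by rewrite /I01 /=; split => [/andP[]|[-> ->]].
have := (subspace_continuousP _ _).1 cg u ((I01E u).2 Iu) => cgu.
have h : (stereo o \o g) @ within (I01 (R:=R)) (nbhs u) --> stereo o (g u).
  apply: cvg_comp cgu _; apply: stereo_cts => //; [exact: sg|exact: go].
have /nbhs_ballP [d /= d0 hd] : nbhs u [set s | I01 (R:=R) s -> box e (stereo o (g u)) (stereo o (g s))].
  exact: (h _ (box_nbhs _ e0)).
exists d => // s Is st; apply: hd; last by apply/I01E; have /andP[? ?] := par _ Is; split; lra.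
rewrite /ball /=; have -> : u - (a + s * (b - a)) = (t - s) * (b - a) by rewrite /u; ring.
rewrite normrM distrC; apply: le_lt_trans st; rewrite -[leRHS]mulr1 ler_wpM2l // ler_norml.
by apply/andP; split; lra.
Qed.

End StereoCont.

(** * A point off the drawing *)

Section OffGraph.
Variable R : realType.
Local Notation P2 := (R * R)%type.
Local Notation pt := (R * R * R)%type.

Lemma I01E (s : R) : I01 (R:=R) s <-> I01P s.
Proof. by rewrite /I01 /=; split => [/andP[]|[-> ->]]. Qed.

Lemma I01oE (s : R) : I01o (R:=R) s <-> 0 < s /\ s < 1.
Proof. by rewrite /I01o /=; split => [/andP[]|[-> ->]]. Qed.

Lemma thin_point (p : P2) : thin [set p].
Proof.
move=> x r r0; case: (pselect (x = p)) => [->|xp]; last by exists x => //; exact: box_refl.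
exists (p.1 + r / 2, p.2); first by split => /=; lra.
by move=> /=; case: p => p1 p2 /= -[]; lra.
Qed.

Lemma cls_point (p : P2) : cls [set p].
Proof. exact: opn_neq. Qed.

Lemma within_near (g : R -> pt) (u : R) (W : set pt) :
  {within I01 (R:=R), continuous g} -> I01P u -> nbhs (g u) W ->
  exists2 d, 0 < d & forall s, I01P s -> `|s - u| < d -> W (g s).
Proof.
move=> cg Iu nW; have := (subspace_continuousP _ _).1 cg u ((I01E u).2 Iu) => cgu.
have /nbhs_ballP [d /= d0 hd] : nbhs u [set s | I01 (R:=R) s -> W (g s)] by exact: cgu.
exists d => // s Is su; apply: hd; last exact/I01E.
by rewrite /ball /= distrC.
Qed.

Lemma stereo_pinj o (g : R -> pt) (a b : R) : sphere o -> 0 <= a -> a < b -> b <= 1 ->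
  (forall s t, I01P s -> I01P t -> g s = g t -> s = t) -> (forall t, I01P t -> sphere (g t)) ->
  (forall t, a <= t -> t <= b -> g t <> o) ->
  pinj (fun t => stereo o (g (a + t * (b - a)))).
Proof.
move=> so a0 ab b1 ig sg go s t Is It e.
have par u : I01P u -> a <= a + u * (b - a) /\ a + u * (b - a) <= b.
  case=> u0 u1; have h1 : 0 <= u * (b - a) by apply: mulr_ge0; lra.
  have h2 : 0 <= (1 - u) * (b - a) by apply: mulr_ge0; lra.
  by split; lra.
have [s1 s2] := par _ Is; have [t1 t2] := par _ It.
have Iu : I01P (a + s * (b - a)) by split; lra.
have Iv : I01P (a + t * (b - a)) by split; lra.
have := congr1 (stereo_inv o) e; rewrite !stereoK //; [|exact: sg|exact: go|exact: sg|exact: go].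
by move=> /(ig _ _ Iu Iv) /addrI /mulIf; apply; rewrite subr_eq0 gt_eqF.
Qed.

Variables (V E : finType) (ends : E -> V * V) (D : drawing R V E).
Hypothesis isD : is_drawing ends D.

Lemma D_sphere v : sphere (pos D v). Proof. by case: isD => -[]. Qed.
Lemma D_cts e : {within I01 (R:=R), continuous (darc D e)}.
Proof. by case: isD => -[_ _ h] _; case: (h e). Qed.
Lemma D_inj e s t : I01P s -> I01P t -> darc D e s = darc D e t -> s = t.
Proof. by move=> /I01E Is /I01E It; case: isD => -[_ _ h] _; case: (h e) => _ + _ _ _; apply. Qed.
Lemma D_arc_sphere e t : I01P t -> sphere (darc D e t).
Proof.
move=> /I01E It; case: isD => -[_ _ h] _; case: (h e) => _ _ + _ _; apply; by exists t.
Qed.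
Lemma D_src e : darc D e 0 = pos D (ends e).1.
Proof. by case: isD => -[_ _ h] _; case: (h e). Qed.
Lemma D_tgt e : darc D e 1 = pos D (ends e).2.
Proof. by case: isD => -[_ _ h] _; case: (h e). Qed.
Lemma D_node e t v : 0 < t -> t < 1 -> darc D e t <> pos D v.
Proof. by move=> t0 t1; case: isD => _ [+ _ _ _]; apply; apply/I01oE. Qed.
Lemma D_cross e f s t : e != f -> 0 < s -> s < 1 -> 0 < t -> t < 1 -> darc D e s = darc D f t ->
  proper_crossing (edge_img D e) (edge_img D f) (darc D e s).
Proof.
move=> ef s0 s1 t0 t1 est; case: isD => _ [_ _ h _].
apply: (h e f s t ef _ _ est); exact/I01oE.
Qed.
Lemma D_triple e f g s t u : e != f -> f != g -> e != g ->
  0 < s -> s < 1 -> 0 < t -> t < 1 -> 0 < u -> u < 1 ->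
  darc D e s = darc D f t -> darc D f t = darc D g u -> False.
Proof.
move=> ef fg eg s0 s1 t0 t1 u0 u1; case: isD => _ [_ _ _ h].
apply: (h e f g s t u ef fg eg); exact/I01oE.
Qed.

Lemma D_end e t v : I01P t -> darc D e t = pos D v -> t = 0 \/ t = 1.
Proof.
move=> [t0 t1] h; case: (ltP 0 t) => t0'; last by left; lra.
by case: (ltP t 1) => t1'; [case: (D_node t0' t1' h)|right; lra].
Qed.

(* A point off the drawing: project from a vertex and use that arcs are thin. *)
Lemma off_drawing (v0 : V) : exists o, [/\ sphere o, forall v, o <> pos D v & forall e t, I01P t -> o <> darc D e t].
Proof.
set o1 := pos D v0; have so1 : sphere o1 by exact: D_sphere.
have [W nW hW] := stereo_infinity 1 so1.
(* The arc without a piece near the pole, where at most one of its ends can sit. What is cut off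
   lies in [W], so its image avoids the box of radius 1 in which [y] is chosen. *)
have piece e : exists a b, [/\ 0 <= a, a < b, b <= 1,
    forall t, a <= t -> t <= b -> darc D e t <> o1 &
    forall t, I01P t -> ~ (a <= t /\ t <= b) -> W (darc D e t)].
  have I0 := @I01P0 R; have I1 := @I01P1 R.
  case: (pselect (darc D e 0 = o1)) => h0.
    have nW0 : nbhs (darc D e 0) W by rewrite h0.
    have [d d0 hd] := within_near (D_cts (e := e)) I0 nW0.
    pose u := Num.min d 1 / 2; have u0 : 0 < u by rewrite divr_gt0 // lt_min d0 ltr01.
    have [u1 u2] : u * 2 <= d /\ u * 2 <= 1 by split; rewrite /u divfK ?pnatr_eq0 // ge_min lexx ?orbT.
    exists u, 1; split; [lra|lra|lra| |].
      move=> t t0 t1; rewrite -h0 => h; have It : I01P t by split; lra.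
      by have := D_inj It I0 h; lra.
    move=> t [t0 t1] ht; apply: hd => //; rewrite subr0 ger0_norm //.
    case: (ltP t u) => htu; first by lra.
    by case: ht.
  case: (pselect (darc D e 1 = o1)) => h1.
    have nW1 : nbhs (darc D e 1) W by rewrite h1.
    have [d d0 hd] := within_near (D_cts (e := e)) I1 nW1.
    pose u := Num.min d 1 / 2; have u0 : 0 < u by rewrite divr_gt0 // lt_min d0 ltr01.
    have [u1 u2] : u * 2 <= d /\ u * 2 <= 1 by split; rewrite /u divfK ?pnatr_eq0 // ge_min lexx ?orbT.
    exists 0, (1 - u); split; [lra|lra|lra| |].
      move=> t t0 t1; rewrite -h1 => h; have It : I01P t by split; lra.
      by have := D_inj It I1 h; lra.
    move=> t [t0 t1] ht; apply: hd => //; rewrite distrC ger0_norm; last by lra.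
    case: (ltP (1 - u) t) => htu; first by lra.
    by case: ht.
  exists 0, 1; split; [lra|lra|lra| |by move=> t [t0 t1] []].
  move=> t t0 t1 h; have It : I01P t by split.
  by case: (D_end It h) => ht; [apply: h0|apply: h1]; rewrite -ht.
have /choice [A hA] := piece; have /choice [B hB] := hA.
pose g e t := stereo o1 (darc D e (A e + t * (B e - A e))).
have gc e : pcts (g e).
  case: (hB e) => a0 ab b1 go _; apply: stereo_pcts => //; [exact: ltW|exact: D_cts|].
  by move=> t; exact: D_arc_sphere.
have gi e : pinj (g e).
  case: (hB e) => a0 ab b1 go _; apply: stereo_pinj => //; first exact: D_inj.
  by move=> t; exact: D_arc_sphere.
have [K [cK tK KE KV]] : exists K : set P2, [/\ cls K, thin K, forall e, arci (g e) `<=` K &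
    forall v, K (stereo o1 (pos D v))].
  have edges (L : seq E) : exists K : set P2, [/\ cls K, thin K & forall e, e \in L -> arci (g e) `<=` K].
    elim: L => [|e L [K [cK tK hK]]].
      exists classical_sets.set0; split=> //; [exact: (ucpt_cls (@ucpt0 R))|exact: thin0].
    exists (K `|` arci (g e)); split.
    - by apply: clsU => //; apply: ucpt_cls; exact: ucpt_arc.
    - by apply: thinU => //; exact: arc_thin.
    - move=> e'; rewrite inE => /predU1P [->|/hK h] x hx; [by right|left; exact: h].
  have verts (L : seq V) : exists K : set P2, [/\ cls K, thin K & forall v, v \in L -> K (stereo o1 (pos D v))].
    elim: L => [|v L [K [cK tK hK]]].
      exists classical_sets.set0; split=> //; [exact: (ucpt_cls (@ucpt0 R))|exact: thin0].
    exists (K `|` [set stereo o1 (pos D v)]); split.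
    - by apply: clsU => //; exact: cls_point.
    - by apply: thinU => //; exact: thin_point.
    - by move=> e'; rewrite inE => /predU1P [->|/hK h]; [right|left].
  have [K1 [c1 t1 h1]] := edges (enum E); have [K2 [c2 t2 h2]] := verts (enum V).
  exists (K1 `|` K2); split; [exact: clsU|exact: thinU| |].
  - by move=> e x hx; left; apply: h1 hx; rewrite mem_enum.
  - by move=> v; right; apply: h2; rewrite mem_enum.
have [y y1 yK] := tK (0, 0) 1 ltr01.
exists (stereo_inv o1 y); split; first exact: stereo_inv_sphere.
  by move=> v h; apply: yK; rewrite -(stereo_invK o1 y) h.
move=> e t It h.
have xo : darc D e t <> o1 by rewrite -h; exact: stereo_inv_neq.
have yE : y = stereo o1 (darc D e t) by rewrite -h stereo_invK.
case: (hB e) => a0 ab b1 go hout.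
case: (pselect (A e <= t /\ t <= B e)) => [[at_ tb]|nt]; last first.
  apply: (hW _ (hout _ It nt)) => //; first exact: D_arc_sphere.
  by rewrite -yE.
apply: yK; apply: (KE e); exists ((t - A e) / (B e - A e)).
  split; first by apply: divr_ge0; lra.
  by rewrite ler_pdivrMr; lra.
rewrite /g yE; congr (stereo o1 (darc D e _)); rewrite divfK ?subrKC // subr_eq0 gt_eqF //.
Qed.

End OffGraph.

(** * The planarized drawing *)

(** Meant for the crossings, which are listed once on each of their two edges. *)
Lemma size_undup_double (T : eqType) (s : seq T) :
  (forall x, x \in s -> (2 <= count_mem x s)%N) -> (2 * size (undup s) <= size s)%N.
Proof.
move=> h; rewrite -[X in (_ <= X)%N](perm_size (perm_count_undup s)) size_flatten /shape -map_comp.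
have {}h : forall x, x \in undup s -> (2 <= count_mem x s)%N by move=> x; rewrite mem_undup; exact: h.
elim: (undup s) h => [|x l IH] h //=; rewrite size_nseq mulnS leq_add ?h ?mem_head //.
by apply: IH => y yl; apply: h; rewrite inE yl orbT.
Qed.

Section FiniteParams.
Variable R : realType.
Lemma finite_params (T : eqType) (A : R -> Prop) (h : R -> T) (s : seq T) :
  (forall t u, A t -> A u -> h t = h u -> t = u) -> (forall t, A t -> h t \in s) ->
  exists c : seq R, [/\ sorted <%R c, (size c <= size s)%N & forall t, t \in c <-> A t].
Proof.
move=> inj hs; pose f p := xget 0 [set t | A t /\ h t = p].
exists (sort <=%R (undup [seq t <- map f s | `[< A t >]])); split.
- by rewrite sort_lt_sorted undup_uniq.
- rewrite size_sort; apply: leq_trans (size_undup _) _.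
  by rewrite size_filter; apply: leq_trans (count_size _ _) _; rewrite size_map.
- move=> t; rewrite mem_sort mem_undup mem_filter; split=> [/andP[/asboolP //]|At].
  rewrite (introT (asboolP _) At) /=; apply/mapP; exists (h t); first exact: hs.
  by rewrite /f; case: xgetP => [u _ [Au hu]|/(_ t)[]//]; apply: inj.
Qed.
End FiniteParams.

Section Planarization.
Variable R : realType.
Local Notation P2 := (R * R)%type.
Local Notation pt := (R * R * R)%type.
Variables (V E : finType) (ends : E -> V * V) (D : drawing R V E) (o : pt).
Hypothesis isD : is_drawing ends D.
Hypotheses (so : sphere o) (ov : forall v, o <> pos D v) (oe : forall e t, I01P t -> o <> darc D e t).

Definition parc e t : P2 := stereo o (darc D e t).
Definition vpos v : P2 := stereo o (pos D v).

Lemma parcE e t : parc e t = stereo o (darc D e t). Proof. by []. Qed.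

Lemma parc_inv e t : I01P t -> stereo_inv o (parc e t) = darc D e t.
Proof. by move=> It; apply: stereoK => //; [exact: (D_arc_sphere isD)|exact/nesym/oe]. Qed.

Lemma vpos_inv v : stereo_inv o (vpos v) = pos D v.
Proof. by apply: stereoK => //; [exact: (D_sphere isD)|exact/nesym/ov]. Qed.

Lemma parc_eq e f s t : I01P s -> I01P t -> parc e s = parc f t -> darc D e s = darc D f t.
Proof. by move=> Is It h; rewrite -(parc_inv e Is) h parc_inv. Qed.

Lemma parc_cts e : pcts (parc e).
Proof.
have := @stereo_pcts R o (darc D e) 0 1 so (lexx 0) ler01 (lexx 1) (D_cts isD (e := e)).
have -> : (fun t => stereo o (darc D e (0 + t * (1 - 0)))) = parc e.
  by apply/funext => t; rewrite subr0 mulr1 add0r.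
apply; first by move=> t; exact: (D_arc_sphere isD).
by move=> t t0 t1; apply/nesym/oe; split.
Qed.

Lemma parc_inj e : pinj (parc e).
Proof. by move=> s t Is It /(parc_eq Is It); exact: (D_inj isD). Qed.

Lemma parc0 e : parc e 0 = vpos (ends e).1.
Proof. by rewrite /parc (D_src isD). Qed.

Lemma parc1 e : parc e 1 = vpos (ends e).2.
Proof. by rewrite /parc (D_tgt isD). Qed.

Lemma parc_vpos e t v : 0 < t -> t < 1 -> parc e t <> vpos v.
Proof.
move=> t0 t1 h; have It : I01P t by split; exact: ltW.
by case: (D_node isD (e := e) (t := t) (v := v)) => //; rewrite -(parc_inv e It) h vpos_inv.
Qed.

Definition crosses e t := [/\ 0 < t, t < 1 & exists f s, [/\ f != e, 0 < s, s < 1 & parc f s = parc e t]].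

Lemma crossing_params : k_planar 2 D -> exists c : E -> seq R, forall e,
  [/\ sorted <%R (c e), (size (c e) <= 2)%N & forall t, t \in c e <-> crosses e t].
Proof.
move=> kp; suff /choice [c hc] : forall e, exists c : seq R,
  [/\ sorted <%R c, (size c <= 2)%N & forall t, t \in c <-> crosses e t] by exists c.
move=> e; have [s [s2 hs]] := kp e.
have [||c [c1 c2 c3]] := @finite_params R _ (crosses e) (darc D e) s.
- by move=> t u [t0 t1 _] [u0 u1 _] tu; apply: (D_inj isD) tu; split; exact: ltW.
- move=> t [t0 t1 [f [u [fe u0 u1 fu]]]]; apply: hs; exists t; split=> //; first exact/I01oE.
  exists f; split=> //.
  exists u; first by apply/I01E; split; exact: ltW.
  by apply: parc_eq => //; split; exact: ltW.
- by exists c; split=> //; exact: leq_trans c2 s2.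
Qed.

Variable c : E -> seq R.
Hypotheses (c_sorted : forall e, sorted <%R (c e)) (c_size : forall e, (size (c e) <= 2)%N)
  (cP : forall e t, t \in c e <-> crosses e t).

Definition ncr e := size (c e).
(** Breakpoints of [e]: 0, the crossings, then 1, which the default value of [nth] supplies at index
    [(ncr e).+1]. *)
Definition bp e i : R := nth 1 (0 :: c e) i.
Definition bpt e i : P2 := parc e (bp e i).

Lemma ncrE e : ncr e = size (c e). Proof. by []. Qed.
Lemma bptE e i : bpt e i = parc e (bp e i). Proof. by []. Qed.
Lemma bp_index e t : t \in c e -> bp e (index t (c e)).+1 = t. Proof. exact: nth_index. Qed.

Lemma c_bd e t : t \in c e -> 0 < t /\ t < 1.
Proof. by move=> /cP []. Qed.

Lemma bp0 e : bp e 0 = 0. Proof. by []. Qed.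

Lemma bp_last e : bp e (ncr e).+1 = 1.
Proof. by rewrite /bp /= nth_default. Qed.

Lemma bp_mid e i : (0 < i)%N -> (i <= ncr e)%N -> bp e i \in c e.
Proof. by case: i => // i _ im; rewrite /bp /= mem_nth. Qed.

Lemma bp_lt e i j : (i < j)%N -> (j <= (ncr e).+1)%N -> bp e i < bp e j.
Proof.
move=> ij jm.
have st : sorted <%R (0 :: rcons (c e) 1).
  rewrite /= rcons_path; apply/andP; split.
    have := c_sorted e; case: (c e) (@c_bd e) => [//|x l] h /= ->.
    by rewrite andbT; have [] := h x (mem_head _ _).
  have := mem_last 0 (c e); rewrite inE => /predU1P [->|/c_bd[]//]; exact: ltr01.
have bE k : (k <= (ncr e).+1)%N -> bp e k = nth 1 (0 :: rcons (c e) 1) k.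
  case: k => [//|k] kk; rewrite /bp /= nth_rcons; case: ltnP => // h.
  by rewrite nth_default //; case: eqP.
rewrite !bE //; last by apply: leq_trans jm; exact: ltnW.
by apply: (sorted_ltn_nth lt_trans) => //; rewrite inE /= size_rcons -/(ncr e); lia.
Qed.

Lemma bp_le e i j : (i <= j)%N -> (j <= (ncr e).+1)%N -> bp e i <= bp e j.
Proof. by rewrite leq_eqVlt => /predU1P [->//|ij jm]; apply/ltW/bp_lt. Qed.

Lemma bp_I01 e i : (i <= (ncr e).+1)%N -> I01P (bp e i).
Proof. by move=> im; split; [rewrite -(bp0 e) bp_le|rewrite -(bp_last e) bp_le]. Qed.

Lemma bp_gap e i t : (i <= ncr e)%N -> bp e i < t -> t < bp e i.+1 -> t \notin c e.
Proof.
move=> im it ti; apply/negP => tc; have [j jm jt] : exists2 j, (j < ncr e)%N & nth 1 (c e) j = t.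
  by exists (index t (c e)); rewrite ?index_mem ?nth_index.
have {jt} jt : bp e j.+1 = t by [].
case: (leqP j.+1 i) => ji; first by have := bp_le ji (leq_trans im (leqnSn _)); lra.
by have := bp_le ji (leqW jm); lra.
Qed.

Lemma bp_loc e i j t : (i < j)%N -> (j <= (ncr e).+1)%N -> bp e i <= t -> t <= bp e j ->
  exists k, [/\ (i <= k)%N, (k < j)%N, bp e k <= t & t <= bp e k.+1].
Proof.
elim: j => // j IH; rewrite ltnS leq_eqVlt => /predU1P [->|ij] jm it tj.
  by exists j; split.
case: (leP t (bp e j)) => h; last by exists j; split=> //; [exact: ltnW|exact: ltW].
have [k [k1 k2 k3 k4]] := IH ij (ltnW jm) it h.
by exists k; split=> //; exact: ltnW.
Qed.

Lemma bpt_inj e i j : (i <= (ncr e).+1)%N -> (j <= (ncr e).+1)%N -> bpt e i = bpt e j -> i = j.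
Proof.
move=> im jm /(parc_inj (bp_I01 im) (bp_I01 jm)) h.
by case: (ltngtP i j) => // ij; [have := bp_lt ij jm|have := bp_lt ij im]; rewrite h ltxx.
Qed.

Lemma crosses_sym e f s t : e != f -> 0 < s -> s < 1 -> 0 < t -> t < 1 -> parc e s = parc f t ->
  s \in c e /\ t \in c f.
Proof.
move=> ef s0 s1 t0 t1 h; split; apply/cP; split=> //.
  by exists f, t; split=> //; rewrite eq_sym.
by exists e, s.
Qed.

(** Two edges meet either at an end of both or at a crossing of both, because no inner point of an
    edge is a vertex. *)
Lemma meet_bp e f s t : e != f -> I01P s -> I01P t -> parc e s = parc f t ->
  exists i j, [/\ (i <= (ncr e).+1)%N, (j <= (ncr f).+1)%N, s = bp e i & t = bp f j].
Proof.
have endp g u : I01P u -> u = 0 \/ u = 1 -> exists2 i, (i <= (ncr g).+1)%N & u = bp g i.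
  by move=> _ [->|->]; [exists 0%N|exists (ncr g).+1; rewrite ?bp_last].
have inn (u : R) : I01P u -> (u = 0 \/ u = 1) \/ (0 < u /\ u < 1).
  move=> [u0 u1]; case: (ltP 0 u) => h; last by left; left; lra.
  by case: (ltP u 1) => h'; [right|left; right; lra].
have vert g u : u = 0 \/ u = 1 -> exists v, parc g u = vpos v.
  by case=> ->; [rewrite parc0; exists (ends g).1|rewrite parc1; exists (ends g).2].
have mid g u : u \in c g -> exists2 i, (i <= (ncr g).+1)%N & u = bp g i.
  move=> uc; exists (index u (c g)).+1; first by rewrite ltnS ltnW // /ncr index_mem.
  by rewrite /bp /= nth_index.
move=> ef Is It h.
case: (inn _ Is) => hs; case: (inn _ It) => ht.
- have [i i1 i2] := endp e _ Is hs; have [j j1 j2] := endp f _ It ht; by exists i, j.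
- have [v hv] := vert e _ hs; case: ht => t0 t1.
  by case: (parc_vpos (e := f) (v := v) t0 t1); rewrite -h.
- have [v hv] := vert f _ ht; case: hs => s0 s1.
  by case: (parc_vpos (e := e) (v := v) s0 s1); rewrite h.
case: hs ht => s0 s1 [t0 t1]; have [sc tc] := crosses_sym ef s0 s1 t0 t1 h.
by have [i i1 i2] := mid _ _ sc; have [j j1 j2] := mid _ _ tc; exists i, j.
Qed.

(** An edge with at most two crossings has at most three segments, so indices in ['I_3] suffice and
    [seg] is a finite type. *)
Definition seg := {x : E * 'I_3 | (x.2 <= ncr x.1)%N}.
Definition se (s : seg) : E := (val s).1.
Definition si (s : seg) : nat := (val s).2.
Definition sarc (s : seg) : R -> P2 := sub_arc (parc (se s)) (bp (se s) (si s)) (bp (se s) (si s).+1).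

Lemma si_le s : (si s <= ncr (se s))%N. Proof. exact: (valP s). Qed.

Lemma seg_ex e i : (i <= ncr e)%N -> exists s : seg, se s = e /\ si s = i.
Proof.
move=> im; have i3 : (i < 3)%N by exact: leq_ltn_trans im (leq_ltn_trans (c_size e) _).
by exists (exist (fun x : E * 'I_3 => is_true (x.2 <= ncr x.1)%N) (e, Ordinal i3) im).
Qed.

Lemma seg_eq (s s' : seg) : se s = se s' -> si s = si s' -> s = s'.
Proof.
case: s s' => [[e i] h] [[f j] h'] /= ef ij; apply: val_inj => /=.
by congr (_, _) => //; exact: val_inj.
Qed.

(** Every crossing is listed once for each edge through it; [card_node] exploits the repetition. *)
Definition xpts : seq P2 := flatten [seq [seq parc e t | t <- c e] | e <- enum E].
Definition nodes : seq P2 := undup ([seq vpos v | v <- enum V] ++ xpts).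
Definition node := seq_sub nodes.
Definition npos (x : node) : P2 := val x.

Lemma xptsP x : reflect (exists e t, t \in c e /\ x = parc e t) (x \in xpts).
Proof.
apply: (iffP flatten_mapP) => [[e _ /mapP [t tc ->]]|[e [t [tc ->]]]]; first by exists e, t.
by exists e; [rewrite mem_enum|exact: map_f].
Qed.

Lemma nodesP x : x \in nodes <-> (exists v, x = vpos v) \/ (exists e t, t \in c e /\ x = parc e t).
Proof.
rewrite /nodes mem_undup mem_cat; split.
  by move=> /orP[/mapP [v _ ->]|/xptsP h]; [left; exists v|right].
by move=> [[v ->]|/xptsP ->]; rewrite ?orbT // map_f // mem_enum.
Qed.

Lemma bpt_node e i : (i <= (ncr e).+1)%N -> bpt e i \in nodes.
Proof.
move=> im; apply/nodesP; case: i im => [_|i]; first by left; exists (ends e).1; rewrite -parc0.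
rewrite ltnS leq_eqVlt => /predU1P [->|im].
  by left; exists (ends e).2; rewrite /bpt bp_last parc1.
by right; exists e, (bp e i.+1); split=> //; exact: bp_mid.
Qed.

Lemma count_xpts x : x \in xpts -> (2 <= count_mem x xpts)%N.
Proof.
move=> /xptsP [e [t [tc ->]]]; have [t0 t1 [f [s [fe s0 s1 fs]]]] := (cP e t).1 tc.
have sc : s \in c f by apply/cP; split=> //; exists e, t; split=> //; rewrite eq_sym.
rewrite /xpts count_flatten -map_comp sumnE big_map big_enum /=.
rewrite (bigD1 e) //= (bigD1 f) //= addnA; apply: leq_trans (leq_addr _ _).
have pos1 (g : E) u : u \in c g -> parc g u = parc e t -> (1 <= count_mem (parc e t) [seq parc g t | t <- c g])%N.
  by move=> uc <-; rewrite -has_count has_pred1 map_f.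
by apply: (@leq_add 1 1); apply: pos1 tc _ || apply: pos1 sc _.
Qed.

Lemma size_xpts : size xpts = (\sum_e ncr e)%N.
Proof.
rewrite /xpts size_flatten /shape -map_comp sumnE big_map big_enum /=.
by apply: eq_bigr => e _; rewrite size_map.
Qed.

Lemma card_node : (2 * #|{: node}| <= 2 * #|V| + \sum_e ncr e)%N.
Proof.
rewrite card_seq_sub ?undup_uniq // /nodes undup_cat size_cat -size_xpts mulnDr.
apply: leq_add; last exact: size_undup_double count_xpts.
rewrite leq_mul2l /= size_filter; apply: leq_trans (count_size _ _) _.
by apply: leq_trans (size_undup _) _; rewrite size_map -cardE.
Qed.

Variable v0 : V.
Lemma v0_node : vpos v0 \in nodes. Proof. by apply/nodesP; left; exists v0. Qed.

Definition mknode (x : P2) : node := insubd (SeqSub v0_node) x.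
Definition ssrc s := mknode (bpt (se s) (si s)).
Definition stgt s := mknode (bpt (se s) (si s).+1).

Lemma npos_mknode x : x \in nodes -> npos (mknode x) = x.
Proof. by move=> h; rewrite /npos /mknode insubdK. Qed.

Lemma npos_src s : npos (ssrc s) = bpt (se s) (si s).
Proof. by apply: npos_mknode; apply: bpt_node; rewrite ltnW // ltnS si_le. Qed.

Lemma npos_tgt s : npos (stgt s) = bpt (se s) (si s).+1.
Proof. by apply: npos_mknode; apply: bpt_node; rewrite ltnS si_le. Qed.

Lemma seg_bp s : [/\ I01P (bp (se s) (si s)), I01P (bp (se s) (si s).+1) & bp (se s) (si s) < bp (se s) (si s).+1].
Proof.
have h := si_le s; split; [apply: bp_I01|apply: bp_I01|apply: bp_lt] => //; first exact: leqW.
Qed.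

Lemma open_sarcP s x : open_arc sarc s x <->
  exists t, [/\ bp (se s) (si s) < t, t < bp (se s) (si s).+1 & parc (se s) t = x].
Proof.
have [_ _ lt] := seg_bp s; have d0 : 0 < bp (se s) (si s).+1 - bp (se s) (si s) by lra.
split=> [[t [t0 t1 <-]]|[t [t0 t1 <-]]].
  exists (bp (se s) (si s) + t * (bp (se s) (si s).+1 - bp (se s) (si s))); split=> //.
    by have := mulr_gt0 t0 d0; lra.
  have h : 0 < (1 - t) * (bp (se s) (si s).+1 - bp (se s) (si s)) by apply: mulr_gt0; lra.
  lra.
exists ((t - bp (se s) (si s)) / (bp (se s) (si s).+1 - bp (se s) (si s))); split.
- by apply: divr_gt0; lra.
- by rewrite ltr_pdivrMr //; lra.
- by rewrite /sarc /sub_arc divfK ?gt_eqF // subrKC.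
Qed.

Lemma arci_sarcP s x : arci (sarc s) x <->
  exists t, [/\ bp (se s) (si s) <= t, t <= bp (se s) (si s).+1 & parc (se s) t = x].
Proof. by have [_ _ lt] := seg_bp s; exact: sub_arciP. Qed.

Lemma open_not_node s x : open_arc sarc s x -> x \notin nodes.
Proof.
move=> /open_sarcP [t [t0 t1 <-]]; have [[b0 b1] [b0' b1'] lt] := seg_bp s.
have t00 : 0 < t by lra.
have t11 : t < 1 by lra.
apply/negP => /nodesP [[v]|[f [u [uc e]]]]; first exact: parc_vpos.
have [u0 u1] := c_bd uc; have It : I01P t by split; exact: ltW.
have Iu : I01P u by split; exact: ltW.
have /negP := bp_gap (si_le s) t0 t1; apply.
case: (eqVneq (se s) f) => [ef|nef]; last by have [] := crosses_sym nef t00 t11 u0 u1 e.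
by move: e uc; rewrite -ef => /(parc_inj It Iu) ->.
Qed.

Lemma planarization : plane_graph ssrc stgt npos sarc.
Proof.
split.
- exact: val_inj.
- by move=> s; have [? ? _] := seg_bp s; apply: sub_pcts => //; exact: parc_cts.
- by move=> s; have [? ? lt] := seg_bp s; apply: sub_pinj => //; [exact: parc_inj|rewrite lt_eqF].
- by move=> s; rewrite npos_src /sarc /sub_arc mul0r addr0.
- by move=> s; rewrite npos_tgt /sarc /sub_arc mul1r subrKC.
- move=> s t x t0 t1 e; have o1 : open_arc sarc s (sarc s t) by exists t.
  by have := open_not_node o1; rewrite e /npos (valP x).
- move=> s s' t t' ss' t0 t1 t0' t1' e.
  have o1 : open_arc sarc s (sarc s t) by exists t.
  have o2 : open_arc sarc s' (sarc s t) by exists t'; split=> //; rewrite e.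
  move/open_sarcP: o1 => [u [u0 u1 eu]]; move/open_sarcP: o2 => [u' [u0' u1' eu']].
  have [[? ?] [? ?] _] := seg_bp s; have [[? ?] [? ?] _] := seg_bp s'.
  have Iu : I01P u by split; lra.
  have Iu' : I01P u' by split; lra.
  case: (eqVneq (se s) (se s')) => [ee|ne].
    have uu : u = u' by apply: (parc_inj (e := se s) Iu Iu'); rewrite eu -eu' ee.
    case: (ltngtP (si s) (si s')) => hi.
    + have : bp (se s') (si s).+1 <= bp (se s') (si s') by apply: bp_le => //; apply: leqW; exact: si_le.
      by rewrite -ee in u0' *; lra.
    + have : bp (se s) (si s').+1 <= bp (se s) (si s) by apply: bp_le => //; apply: leqW; exact: si_le.
      by rewrite -ee in u1'; lra.
    + by move: ss'; rewrite (seg_eq ee hi) eqxx.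
  have [i [j [i1 i2 hu _]]] := meet_bp ne Iu Iu' (etrans eu (esym eu')).
  have : bpt (se s) i \in nodes by exact: bpt_node.
  rewrite /bpt -hu eu; apply/negP; apply: (@open_not_node s); by exists t.
Qed.

End Planarization.

(** * Charts at a crossing *)

Section Chart.
Variable R : realType.
Local Notation P2 := (R * R)%type.
Local Notation pt := (R * R * R)%type.
Variables (V E : finType) (ends : E -> V * V) (D : drawing R V E) (o : pt).
Hypothesis isD : is_drawing ends D.
Hypotheses (so : sphere o) (ov : forall v, o <> pos D v) (oe : forall e t, I01P t -> o <> darc D e t).
Local Notation parc := (parc D o).

Lemma box_disk (y : P2) : box (1 / 2) (0, 0) y -> open_disk y.
Proof.
have sq (u : R) : 0 - 1 / 2 < u -> u < 0 + 1 / 2 -> u ^+ 2 < 1 / 4.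
  move=> *; have : 0 < (1 / 2 - u) * (1 / 2 + u) by apply: mulr_gt0; lra.
  by rewrite expr2; lra.
case=> /= h1 h2 h3 h4; have := sq _ h1 h2; have := sq _ h3 h4; rewrite /open_disk /=; lra.
Qed.

Lemma avoid_center (p : pt) : sphere p -> p <> o -> nbhs p [set x | x <> o].
Proof.
move=> sp po; have f1 := swap_pole_eq so sp po.
have cf : {for p, continuous (fun x => (swap o x).2)} by apply: cts_snd; exact: swap_cts.
have sub : [set x | (swap o x).2 != 1] `<=` [set x | x <> o].
  by move=> x; rewrite /mkset => /eqP h e; apply: h; rewrite e swap_pole.
apply: (@filterS _ (nbhs p) _ _ _ sub).
case: (ltgtP (swap o p).2 1) => h; last by rewrite h eqxx in f1.
  have hh : nbhs p [set x | (swap o x).2 < 1] := cf _ (open_nbhs_nbhs (conj (@open_lt R 1) h)).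
  apply: (@filterS _ (nbhs p) _ _ _ _ hh) => x; rewrite /mkset => hx.
  by rewrite lt_eqF.
have hh : nbhs p [set x | 1 < (swap o x).2] := cf _ (open_nbhs_nbhs (conj (@open_gt R 1) h)).
apply: (@filterS _ (nbhs p) _ _ _ _ hh) => x; rewrite /mkset => hx.
by rewrite gt_eqF.
Qed.

(** The chart of [proper_crossing] followed by the projection, on a box small enough to avoid [o]
    and to stay within [d] of the crossing. The openness clause, with its control of the preimage,
    stands for continuity of the inverse. *)
Lemma plane_chart e f t t' d : e != f -> 0 < t -> t < 1 -> 0 < t' -> t' < 1 -> parc e t = parc f t' -> 0 < d ->
  exists (G : P2 -> P2) r, [/\ 0 < r, G (0, 0) = parc e t,
    forall y, box r (0, 0) y -> box d (parc e t) (G y) &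
    [/\ forall y e', box r (0, 0) y -> 0 < e' -> exists2 e'', 0 < e'' & forall y', box r (0, 0) y' -> box e'' y y' -> box e' (G y) (G y'),
     forall y e', box r (0, 0) y -> 0 < e' -> exists2 e'', 0 < e'' & forall w, box e'' (G y) w -> exists y', [/\ box r (0, 0) y', box e' y y' & G y' = w],
     forall y, box r (0, 0) y -> arci (parc e) (G y) <-> y.2 = 0 &
     forall y, box r (0, 0) y -> arci (parc f) (G y) <-> y.1 = 0]].
Proof.
move=> ef t0 t1 t0' t1' tt' d0.
have It : I01P t by split; exact: ltW.
have It' : I01P t' by split; exact: ltW.
have dtt := parc_eq isD so oe It It' tt'.
have [U [h [g [[oU Up hp] [hU gD ch cg ax]]]]] := D_cross isD ef t0 t1 t0' t1' dtt.
set p := darc D e t in Up hp.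
have sp : sphere p by exact: (D_arc_sphere isD).
have po : p <> o by exact/nesym/oe.
have D0 : open_disk ((0, 0) : P2) by rewrite /open_disk /= expr2 mulr0 addr0 ltr01.
have gp : g (0, 0) = p by have [_] := hU _ Up sp; rewrite hp.
have sg y : open_disk y -> sphere (g y) by move=> /gD [].
have gctn y : open_disk y -> forall W, nbhs (g y) W -> nbhs y [set y' | open_disk y' -> W (g y')].
  by move=> Dy W nW; exact: ((subspace_continuousP _ _).1 cg y Dy W nW).
have nc := avoid_center sp po; rewrite -[in nbhs _ _]gp in nc.
have [r1 r10 hr1] := nbhs_box (gctn _ D0 _ nc).
have Gcts y : open_disk y -> g y <> o -> forall e', 0 < e' -> exists2 e'', 0 < e'' &
    forall y', open_disk y' -> box e'' y y' -> box e' (stereo o (g y)) (stereo o (g y')).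
  move=> Dy gy e' e'0; have nW := stereo_cts so (sg _ Dy) gy (box_nbhs (stereo o (g y)) e'0).
  have [e'' e''0 he] := nbhs_box (gctn _ Dy _ nW).
  by exists e'' => // y' Dy' /he; apply.
have [r2 r20 hr2] : exists2 r, 0 < r & forall y, open_disk y -> box r (0, 0) y -> box d (parc e t) (stereo o (g y)).
  have [|r r0 hr] := Gcts _ D0 _ _ d0; first by rewrite gp.
  by exists r => // y Dy /(hr _ Dy); rewrite gp.
pose r := Num.min (1 / 2) (Num.min r1 r2).
have r0 : 0 < r by rewrite !lt_min r10 r20 andbT; lra.
have [l1 l2 l3] : [/\ r <= 1 / 2, r <= r1 & r <= r2] by split; rewrite !ge_min lexx ?orbT.
have rD y : box r (0, 0) y -> open_disk y by move=> /(box_le l1) /box_disk.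
have go y : box r (0, 0) y -> g y <> o by move=> hy; exact: (hr1 _ (box_le l2 hy) (rD _ hy)).
have onE e1 y : box r (0, 0) y -> arci (parc e1) (stereo o (g y)) <-> edge_img D e1 (g y).
  move=> hy; split=> [[u Iu]|[u /I01E Iu uE]]; last by exists u => //; rewrite !parcE uE.
  move=> uE; exists u; first exact/I01E.
  rewrite -(parc_inv isD so oe e1 Iu) uE stereoK //; [exact: sg (rD _ hy)|exact: go].
exists (fun y => stereo o (g y)), r; split=> //; first by rewrite gp.
  by move=> y hy; apply: hr2 (rD _ hy) (box_le l3 hy).
split.
- move=> y e' hy e'0; have [e'' e''0 he] := Gcts _ (rD _ hy) (go _ hy) _ e'0.
  by exists e'' => // y' /rD; exact: he.
- move=> y e' hy e'0.
  have [Uy _ hgy] := gD _ (rD _ hy).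
  have [e1 e10 he1] := box_opn hy.
  have m0 : 0 < Num.min e1 e' by rewrite lt_min e10.
  have nh : nbhs (g y) [set x | (U `&` @sphere R) x -> box (Num.min e1 e') y (h x)].
    have := (subspace_continuousP _ _).1 ch (g y) (conj Uy (sg _ (rD _ hy))).
    move=> cvh; have nn := box_nbhs y m0; rewrite -{1}hgy in nn; exact: (cvh _ nn).
  have nU : nbhs (g y) U by apply: open_nbhs_nbhs.
  have si : stereo_inv o (stereo o (g y)) = g y by apply: stereoK => //; [exact: sg (rD _ hy)|exact: go].
  have cinv := @stereo_inv_cts R o (stereo o (g y)).
  have nn : nbhs (g y) ([set x | (U `&` @sphere R) x -> box (Num.min e1 e') y (h x)] `&` U) by apply: filterI.
  rewrite -[in nbhs _ _]si in nn.
  have /nbhs_box [e'' e''0 he] := cinv _ nn.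
  exists e'' => // w /he [/= hw1 hw2].
  have sw := stereo_inv_sphere o w; have [Dw gw] := hU _ hw2 sw.
  have nw := hw1 (conj hw2 sw).
  exists (h (stereo_inv o w)); split.
  + by apply: he1; apply: box_le nw; rewrite ge_min lexx.
  + by apply: box_le nw; rewrite ge_min lexx orbT.
  + by rewrite gw stereo_invK.
- move=> y hy; have [Uy sy hgy] := gD _ (rD _ hy).
  by rewrite (onE e y hy) (ax _ Uy sy).1 hgy.
- move=> y hy; have [Uy sy hgy] := gD _ (rD _ hy).
  by rewrite (onE f y hy) (ax _ Uy sy).2 hgy.
Qed.

End Chart.

(** * The two segments of an edge at a crossing *)

Section Quadrants.
Variable R : realType.
Local Notation P2 := (R * R)%type.
Local Notation pt := (R * R * R)%type.
Variables (V E : finType) (ends : E -> V * V) (D : drawing R V E) (o : pt).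
Hypothesis isD : is_drawing ends D.
Hypotheses (so : sphere o) (ov : forall v, o <> pos D v) (oe : forall e t, I01P t -> o <> darc D e t).
Variable c : E -> seq R.
Hypotheses (c_sorted : forall e, sorted <%R (c e)) (c_size : forall e, (size (c e) <= 2)%N)
  (cP : forall e t, t \in c e <-> crosses D o e t).
Variable v0 : V.
Local Notation parc := (parc D o).
Local Notation ncr := (ncr c).
Local Notation bp := (bp c).
Local Notation bpt := (bpt D o c).
Local Notation sarc := (@sarc R V E D o c).
Local Notation seg := (seg c).
Local Notation K := (Kset sarc [set: seg]%SET).
Let G := planarization isD so ov oe c_sorted cP v0.

Lemma KsetP x : K x <-> exists e, arci (parc e) x.
Proof.
split=> [[s _ /(arci_sarcP c_sorted cP) [t [t0 t1 <-]]]|[e [t [t0 t1] <-]]].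
  exists (se s), t => //; have [[? ?] [? ?] _] := seg_bp c_sorted cP s; split; lra.
have [k [_ k1 k2 k3]] : exists k, [/\ (0 <= k)%N, (k < (ncr e).+1)%N, bp e k <= t & t <= bp e k.+1].
  by apply: bp_loc => //; rewrite bp_last.
have [s [s1 s2]] := seg_ex c_size k1; exists s; rewrite ?inE //.
by apply/(arci_sarcP c_sorted cP); exists t; rewrite s1 s2.
Qed.

Definition sg (b : bool) : R := if b then 1 else -1.

Lemma sgP b : sg b = 1 \/ sg b = -1. Proof. by case: b; [left|right]. Qed.

(** One edge [e] of the crossing, taken as the horizontal axis; the other edge is treated by
    exchanging the coordinates. *)
Section Half.
Variables (e : E) (i : nat) (H : P2 -> P2) (r : R).
Hypotheses (i0 : (0 < i)%N) (im : (i <= ncr e)%N) (r0 : 0 < r) (H0 : H (0, 0) = bpt e i)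
 (Hc : forall y e', box r (0, 0) y -> 0 < e' -> exists2 e'', 0 < e'' & forall y', box r (0, 0) y' -> box e'' y y' -> box e' (H y) (H y'))
 (Ho : forall y e', box r (0, 0) y -> 0 < e' -> exists2 e'', 0 < e'' & forall w, box e'' (H y) w -> exists y', [/\ box r (0, 0) y', box e' y y' & H y' = w])
 (He : forall y, box r (0, 0) y -> arci (parc e) (H y) <-> y.2 = 0)
 (HK : forall y, box r (0, 0) y -> K (H y) -> y.1 = 0 \/ y.2 = 0)
 (Hd : forall y t, box r (0, 0) y -> I01P t -> parc e t = H y -> bp e i.-1 < t /\ t < bp e i.+1)
 (Hf : forall y, box r (0, 0) y -> H y = bpt e i -> y.1 = 0).

Let t := bp e i.
Let It : I01P t.
Proof. by apply: (bp_I01 c_sorted cP); exact: leqW. Qed.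

Lemma half_pcts y y' : box r (0, 0) y -> box r (0, 0) y' -> pcts (fun u => H (lerp y y' u)).
Proof.
move=> ny ny' u Iu e1 e10; have [e2 e20 h2] := Hc (box_lerp Iu ny ny') e10.
have [d d0 hd] := lerp_cts y y' Iu e20; exists d => // s Is /(hd _ Is) h.
by apply: h2 h; exact: box_lerp.
Qed.

Lemma quadrant_linked y y' : box r (0, 0) y -> box r (0, 0) y' -> 0 < y.1 * y'.1 -> 0 < y.2 * y'.2 ->
  linked (~` K) (H y) (H y').
Proof.
move=> ny ny' h1 h2.
have nz (a b u : R) : I01P u -> 0 < a * b -> a + u * (b - a) <> 0.
  move=> Iu ab; case: (ltgtP a 0) => a0; last by move: ab; rewrite a0 mul0r ltxx.
    have b0 : b < 0 by move: ab; rewrite nmulr_rgt0.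
    have /andP[_ h] : a + b - 1 < a + u * (b - a) < 0 by apply: lerp_bd => //; lra.
    lra.
  have b0 : 0 < b by move: ab; rewrite pmulr_rgt0.
  have /andP[h _] : 0 < a + u * (b - a) < a + b + 1 by apply: lerp_bd => //; lra.
  lra.
have := path_linked (cls_Kset G (H := [set: seg]%SET)) (half_pcts ny ny') _ (@I01P0 R) (@I01P1 R).
rewrite lerp0 lerp1; apply=> u Iu /(HK (box_lerp Iu ny ny')) [] /=; exact: nz.
Qed.

Definition on_side (a : bool) u := exists tau, [/\ I01P tau, parc e tau = H (u, 0) & if a then t < tau else tau < t].

Lemma box_axis u : `|u| < r -> box r (0, 0) (u, 0).
Proof. by rewrite ltr_norml => /andP[? ?]; split => /=; lra. Qed.

Lemma axis_param u : `|u| < r -> exists2 tau, I01P tau & parc e tau = H (u, 0).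
Proof. by move=> ur; exact: ((He (box_axis ur)).2 erefl). Qed.

Lemma on_side_const a u u' : `|u| < r -> `|u'| < r -> 0 < u * u' -> on_side a u -> on_side a u'.
Proof.
move=> ur ur' uu' su.
have ny := box_axis ur; have ny' := box_axis ur'.
pose x s : R := u + s * (u' - u).
have xr s : I01P s -> `|x s| < r.
  by move=> Is; move: ur ur'; rewrite !ltr_norml => /andP[? ?] /andP[? ?]; exact: lerp_bd.
have x0 s : I01P s -> x s != 0.
  move=> Is; apply/eqP; rewrite /x; case: (ltgtP u 0) => u0; last by move: uu'; rewrite u0 mul0r ltxx.
    have b0 : u' < 0 by move: uu'; rewrite nmulr_rgt0.
    have /andP[_ h] : u + u' - 1 < u + s * (u' - u) < 0 by apply: lerp_bd => //; lra.
    lra.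
  have b0 : 0 < u' by move: uu'; rewrite pmulr_rgt0.
  have /andP[h _] : 0 < u + s * (u' - u) < u + u' + 1 by apply: lerp_bd => //; lra.
  lra.
suff : on_side a (x 1) by rewrite /x mul1r subrKC.
apply: (I01_ind (Q := fun s => on_side a (x s))) (@I01P0 R) (@I01P1 R) _; last by rewrite /x mul0r addr0.
move=> s Is.
have [tau Itau ht] := axis_param (xr _ Is).
have tt : tau != t.
  apply/eqP => e1; have xz : x s = 0 by apply: (Hf (box_axis (xr _ Is))); rewrite -ht e1.
  by move: (x0 _ Is); rewrite xz eqxx.
have d0 : 0 < `|tau - t| by rewrite normr_gt0 subr_eq0.
have [d1 d10 h1] := arc_inv_unif (parc_cts isD so oe e) (parc_inj isD so oe (e := e)) d0.
have [d2 d20 h2] := half_pcts ny ny' Is d10.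
have lE s' : lerp (u, 0) (u', 0) s' = (x s', 0) by rewrite /lerp /= subr0 mulr0 addr0.
exists d2 => // s' Is' ss'.
have := h2 _ Is' ss'; rewrite !lE.
have [tau' Itau' ht'] := axis_param (xr _ Is').
rewrite -ht -ht' => /(h1 _ _ Itau Itau') lt.
have uniq1 tau1 : I01P tau1 -> parc e tau1 = H (x s, 0) -> tau1 = tau.
  by move=> I1; rewrite -ht; exact: (parc_inj isD so oe).
have uniq2 tau1 : I01P tau1 -> parc e tau1 = H (x s', 0) -> tau1 = tau'.
  by move=> I1; rewrite -ht'; exact: (parc_inj isD so oe).
have sameside : (t < tau) = (t < tau') /\ (tau < t) = (tau' < t).
  move: lt tt; rewrite ltr_norml; case: (ltgtP tau t) => // tt.
    rewrite ltr0_norm ?subr_lt0 // => /andP[? ?] _.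
    have -> : tau' < t by lra.
    by split=> //; apply/esym/negbTE; rewrite -leNgt; lra.
  rewrite gtr0_norm ?subr_gt0 // => /andP[? ?] _.
  have -> : t < tau' by lra.
  by split=> //; apply/esym/negbTE; rewrite -leNgt; lra.
case: sameside => e1 e2.
split=> -[tau1 [I1 p1 s1]].
  by exists tau; split=> //; move: s1; rewrite (uniq2 _ I1 p1) e1 e2.
by exists tau'; split=> //; move: s1; rewrite (uniq1 _ I1 p1) e1 e2.
Qed.

Lemma on_side_ex a : exists u, [/\ `|u| < r, u != 0 & on_side a u].
Proof.
have n0 : box r (0, 0) ((0, 0) : P2) by exact: box_refl.
have [e1 e10 h1] := Ho n0 r0.
have [d d0 hd] := parc_cts isD so oe e It e10.
have [t0 t1] : 0 < t /\ t < 1.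
  rewrite /t -{1}(bp0 c e) -(bp_last c e).
  by split; apply: (bp_lt c_sorted cP) => //; exact: leqW.
pose k := Num.min d (Num.min t (1 - t)) / 2.
have k0 : 0 < k by rewrite divr_gt0 // !lt_min d0 t0 subr_gt0 t1.
have [k1 k2 k3] : [/\ k * 2 <= d, k * 2 <= t & k * 2 <= 1 - t].
  by split; rewrite /k divfK ?pnatr_eq0 // !ge_min lexx ?orbT.
pose tau := if a then t + k else t - k.
have Itau : I01P tau by rewrite /tau; case: (a); split; lra.
have nt : `|tau - t| < d.
  by rewrite ltr_norml /tau; case: (a); apply/andP; split; lra.
have tt : tau <> t by rewrite /tau; case: (a); lra.
have := hd _ Itau nt; rewrite -/t -[parc e t]/(bpt e i) -H0 => /h1 [[y1 y2] [ny _ hy]].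
have y20 : y2 = 0 by apply: (He ny).1; exists tau; rewrite ?hy.
rewrite y20 in ny hy; exists y1; split.
- by case: ny => /= *; rewrite ltr_norml; apply/andP; split; lra.
- apply/eqP => y10; apply: tt.
  have e2 : parc e tau = parc e t by rewrite -hy y10 H0.
  exact: (parc_inj isD so oe Itau It e2).
- by exists tau; split=> //; rewrite /tau; case: (a); lra.
Qed.

(** [s0] records the direction in which [e] runs along its axis. A face touching one of the two
    segments does so near the crossing, by [touches_everywhere], and there it meets one of the two
    quadrants beside that half axis. The index [i.-1 + a] is the segment before or after the
    crossing. *)
Lemma half_plane : exists s0 : bool, forall (a : bool) (s : seg), se s = e -> si s = (i.-1 + a)%N ->
  forall x, ~ K x -> touches sarc x s <-> exists b, linked (~` K) x (H (sg (s0 (+) a) * (r / 2), sg b * (r / 2))).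
Proof.
have h2 : 0 < r / 2 by rewrite divr_gt0.
have r0b := r0.
have [u1 [u1r u10 u1s]] := on_side_ex true.
have [u2 [u2r u20 u2s]] := on_side_ex false.
have contra_side u : on_side true u -> on_side false u -> False.
  move=> [tau [I1 p1 /= s1]] [tau' [I2 p2 /= s2]].
  by have := parc_inj isD so oe I1 I2 (etrans p1 (esym p2)); lra.
pose s0 := ~~ (0 < u1).
have sr b : `|sg b * (r / 2)| < r by case: (sgP b) => ->; rewrite ltr_norml; apply/andP; split; lra.
have sg1 : on_side true (sg (s0 (+) true) * (r / 2)).
  apply: on_side_const u1r (sr _) _ u1s; rewrite /s0 addbT negbK.
  case: (ltgtP 0 u1) u10 => // h _; rewrite /sg.
    by apply: mulr_gt0; lra.
  by rewrite nmulr_rgt0 //; lra.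
(* The two parts of [e] lie on different half axes, since [on_side] is constant on each. *)
have u12 : u1 * u2 < 0.
  rewrite ltNge le_eqVlt; apply/negP => /orP[|h].
    by rewrite eq_sym mulf_eq0 (negbTE u10) (negbTE u20).
  apply: (contra_side u2) => //; exact: on_side_const u1s.
have sg2 : on_side false (sg (s0 (+) false) * (r / 2)).
  apply: on_side_const u2r (sr _) _ u2s; rewrite /s0 addbF.
  case: (ltgtP 0 u1) u10 => // h _; rewrite /sg /=.
    have : u2 < 0 by move: u12; rewrite pmulr_rlt0.
    by move=> h3; rewrite nmulr_rgt0 //; lra.
  have : 0 < u2 by move: u12; rewrite nmulr_rlt0.
  by move=> h3; apply: mulr_gt0; lra.
exists s0 => a s se1 si1 x Kx.
set u := sg (s0 (+) a) * (r / 2).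
have ur : `|u| < r by exact: sr.
have su : on_side a u by rewrite /u; case: (a).
have ou : open_arc sarc s (H (u, 0)).
  case: su => tau [Itau ptau stau]; have [b1 b2] := Hd (box_axis ur) Itau ptau.
  apply/(open_sarcP c_sorted cP); exists tau; rewrite se1 si1.
  case: (a) stau => /= st; first by rewrite addn1 prednK.
  by rewrite addn0 prednK.
have un : u * u = (r / 2) * (r / 2) by rewrite /u; case: (sgP (s0 (+) a)) => ->; ring.
have nq b v : 0 < v -> v < r -> box r (0, 0) (u, sg b * v).
  by move=> v0' vr; move: ur; rewrite ltr_norml => /andP[? ?]; case: (sgP b) => ->; split => /=; lra.
split=> [tx|[b xb]].
  have [e1 e10 h1] := Ho (box_axis ur) h2.
  have [w hw xw] := touches_everywhere G Kx tx ou e10.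
  have [[y1 y2] [ny [/= n1 n2 _ _] yw]] := h1 _ hw.
  have Kw := linked_in Kx xw.
  have y20 : y2 != 0.
    apply/eqP => y20; apply: Kw; apply/KsetP; exists e; rewrite -yw; exact: ((He ny).2).
  exists (0 < y2); apply: linked_trans xw _; rewrite -yw; apply: quadrant_linked => //.
  - by apply: nq => //; lra.
  - rewrite /=; move: n1 n2; rewrite /u; case: (sgP (s0 (+) a)) => -> n1 n2.
      by apply: mulr_gt0; lra.
    by rewrite nmulr_rgt0; lra.
  - rewrite /= /sg; case: (ltgtP 0 y2) y20 => // h _.
      by apply: mulr_gt0; lra.
    by rewrite nmulr_rgt0 //; lra.
exists (H (u, 0)) => // e1 e10; have [e2 e20 h3] := Hc (box_axis ur) e10.
pose v := Num.min (r / 2) (e2 / 2).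
have v0' : 0 < v by rewrite lt_min; apply/andP; split; lra.
have [v1 v2] : v <= r / 2 /\ v <= e2 / 2 by split; rewrite ge_min lexx ?orbT.
have nv : box r (0, 0) (u, sg b * v) by apply: nq => //; lra.
exists (H (u, sg b * v)); first by apply: h3 => //; case: (sgP b) => ->; split => /=; lra.
apply: linked_trans xb _; apply: quadrant_linked => //=.
- by apply: nq => //; lra.
- by rewrite un; exact: mulr_gt0.
- have -> : sg b * (r / 2) * (sg b * v) = r / 2 * v by case: (sgP b) => ->; ring.
  exact: mulr_gt0.
Qed.

Lemma quadrant_off a b : ~ K (H (sg a * (r / 2), sg b * (r / 2))).
Proof.
have r0b := r0.
move=> /HK; rewrite /=; case: (sgP a) (sgP b) => -> [] -> h.
all: have [||] := h; [split => /=; lra|lra|lra].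
Qed.
End Half.

End Quadrants.

(** * The four quadrants of a crossing *)

Section Crossing.
Variable R : realType.
Local Notation P2 := (R * R)%type.
Local Notation pt := (R * R * R)%type.
Variables (V E : finType) (ends : E -> V * V) (D : drawing R V E) (o : pt).
Hypothesis isD : is_drawing ends D.
Hypotheses (so : sphere o) (ov : forall v, o <> pos D v) (oe : forall e t, I01P t -> o <> darc D e t).
Variable c : E -> seq R.
Hypotheses (c_sorted : forall e, sorted <%R (c e)) (c_size : forall e, (size (c e) <= 2)%N)
  (cP : forall e t, t \in c e <-> crosses D o e t).
Variable v0 : V.
Local Notation parc := (parc D o).
Local Notation ncr := (ncr c).
Local Notation bp := (bp c).
Local Notation bpt := (bpt D o c).
Local Notation sarc := (@sarc R V E D o c).
Local Notation seg := (seg c).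
Local Notation K := (Kset sarc [set: seg]%SET).
Let G := planarization isD so ov oe c_sorted cP v0.
Local Notation KsetP := (KsetP c_sorted c_size cP).

Lemma bpt_triple e f g i j k : e != f -> f != g -> e != g -> (0 < i)%N -> (i <= ncr e)%N ->
  (j <= (ncr f).+1)%N -> (k <= (ncr g).+1)%N -> bpt e i = bpt f j -> bpt f j = bpt g k -> False.
Proof.
move=> ef fg eg i0 im jm km h1 h2.
have [t0 t1] := c_bd cP (bp_mid i0 im).
have inner h l : (l <= (ncr h).+1)%N -> bpt e i = bpt h l -> 0 < bp h l /\ bp h l < 1.
  move=> lm hl; case: l lm hl => [|l] lm hl.
    by case: (parc_vpos isD so ov oe (e := e) (v := (ends h).1) t0 t1); rewrite -(parc0 o isD).
  move: lm; rewrite ltnS leq_eqVlt => /predU1P [lE|lm].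
    case: (parc_vpos isD so ov oe (e := e) (v := (ends h).2) t0 t1).
    by rewrite -(parc1 o isD) -(bp_last c h) -lE.
  exact: (c_bd cP (bp_mid (ltn0Sn _) lm)).
have [u0 u1] := inner _ _ jm h1; have [w0 w1] := inner _ _ km (etrans h1 h2).
have I1 : I01P (bp e i) by split; exact: ltW.
have I2 : I01P (bp f j) by split; exact: ltW.
have I3 : I01P (bp g k) by split; exact: ltW.
exact: (D_triple isD ef fg eg t0 t1 u0 u1 w0 w1 (parc_eq isD so oe I1 I2 h1) (parc_eq isD so oe I2 I3 h2)).
Qed.

(** [half_plane] applied to both edges in one chart, the second time with the coordinates exchanged.
    The chart is small enough to miss all other edges and all but the two adjacent segments of each
    of these two. *)
Lemma quadrants e f i k : e != f -> (0 < i)%N -> (i <= ncr e)%N -> (0 < k)%N -> (k <= ncr f)%N ->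
  bpt e i = bpt f k -> exists q : bool -> bool -> P2,
  [/\ forall a b, ~ K (q a b),
      forall (a : bool) (s : seg), se s = e -> si s = (i.-1 + a)%N -> forall x, ~ K x ->
        touches sarc x s <-> exists b, linked (~` K) x (q a b) &
      forall (b : bool) (s : seg), se s = f -> si s = (k.-1 + b)%N -> forall x, ~ K x ->
        touches sarc x s <-> exists a, linked (~` K) x (q a b)].
Proof.
move=> ef i0 im k0 km h.
have [t0 t1] := c_bd cP (bp_mid i0 im); have [u0 u1] := c_bd cP (bp_mid k0 km).
have gap g j : (0 < j)%N -> (j <= ncr g)%N -> exists2 d, 0 < d & forall u, I01P u ->
    box d (bpt g j) (parc g u) -> bp g j.-1 < u /\ u < bp g j.+1.
  move=> j0 jm.
  have b1 : bp g j.-1 < bp g j by apply: (bp_lt c_sorted cP); [rewrite prednK|exact: leqW].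
  have b2 : bp g j < bp g j.+1 by apply: (bp_lt c_sorted cP).
  pose eta := Num.min (bp g j - bp g j.-1) (bp g j.+1 - bp g j).
  have eta0 : 0 < eta by rewrite lt_min !subr_gt0 b1.
  have [l1 l2] : eta <= bp g j - bp g j.-1 /\ eta <= bp g j.+1 - bp g j by split; rewrite ge_min lexx ?orbT.
  have [d d0 hd] := arc_inv_unif (parc_cts isD so oe g) (parc_inj isD so oe (e := g)) eta0.
  exists d => // u Iu /(hd _ _ _ Iu); rewrite ltr_norml => /(_ (bp_I01 c_sorted cP (leqW jm))) /andP[? ?].
  by split; lra.
have [d1 d10 hd1] := gap _ _ i0 im; have [d2 d20 hd2] := gap _ _ k0 km.
have [d3 d30 hd3] : exists2 d, 0 < d & forall g u, g != e -> g != f -> I01P u -> ~ box d (bpt e i) (parc g u).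
  have fin (L : seq E) : exists2 d, 0 < d & forall g u, g \in L -> g != e -> g != f -> I01P u -> ~ box d (bpt e i) (parc g u).
    elim: L => [|g L [d d0 hd]]; first by exists 1.
    case: (pselect (g != e /\ g != f)) => [[ge gf]|ng]; last first.
      exists d => // g' u; rewrite inE => /predU1P [->|gL] ge gf; last exact: hd.
      by case: ng.
    have ng' : ~ arci (parc g) (bpt e i).
      case=> u Iu hu; have It := bp_I01 c_sorted cP (leqW im).
      have [a [b [a1 b1 ea eb]]] := meet_bp isD so ov oe cP ge Iu It hu.
      apply: (@bpt_triple e f g i k a) => //; [by rewrite eq_sym|by rewrite eq_sym|exact: leqW|].
      by rewrite -h !bptE -ea.
    have cg : cls (arci (parc g)) by apply: ucpt_cls; apply: ucpt_arc; exact: (parc_cts isD so oe g).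
    have [d' d'0 hd'] := cg _ ng'.
    exists (Num.min d d'); first by rewrite lt_min d0.
    move=> g' u; rewrite inE => /predU1P [->|gL] ge' gf' Iu hn.
      by apply: (hd' (parc g u)); [apply: box_le hn; rewrite ge_min lexx orbT|exists u].
    by apply: (hd g' u) => //; apply: box_le hn; rewrite ge_min lexx.
  by have [d d0 hd] := fin (enum E); exists d => // g u; apply: hd; rewrite mem_enum.
pose d := Num.min d1 (Num.min d2 d3).
have d0 : 0 < d by rewrite !lt_min d10 d20.
have [l1 l2 l3] : [/\ d <= d1, d <= d2 & d <= d3] by split; rewrite !ge_min lexx ?orbT.
have [H [r [r0 H0 Hn [Hc Ho He Hf]]]] := plane_chart isD so oe ef t0 t1 u0 u1 h d0.
have HK y : box r (0, 0) y -> K (H y) -> y.1 = 0 \/ y.2 = 0.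
  move=> ny /KsetP [g hg]; case: (eqVneq g e) hg => [-> hg|ge]; first by right; exact: ((He _ ny).1 hg).
  case: (eqVneq g f) => [-> hg|gf [u Iu hu]]; first by left; exact: ((Hf _ ny).1 hg).
  by case: (hd3 g u ge gf Iu); rewrite hu; apply: box_le l3 (Hn _ ny).
have sw r' (x y : P2) : box r' x y -> box r' (x.2, x.1) (y.2, y.1) by case.
pose H' (y : P2) := H (y.2, y.1).
have [s0 hs0] : exists s0 : bool, forall (a : bool) (s : seg), se s = e -> si s = (i.-1 + a)%N ->
  forall x, ~ K x -> touches sarc x s <-> exists b, linked (~` K) x (H (sg R (s0 (+) a) * (r / 2), sg R b * (r / 2))).
  apply: (half_plane isD so ov oe c_sorted c_size cP v0 i0 im r0 H0 Hc Ho He HK).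
  - by move=> y u ny Iu hu; apply: hd1 => //; rewrite hu; apply: box_le l1 (Hn _ ny).
  - move=> y ny hy; apply: ((Hf _ ny).1); rewrite hy h; exists (bp f k) => //; split; exact: ltW.
have [s1 hs1] : exists s0 : bool, forall (a : bool) (s : seg), se s = f -> si s = (k.-1 + a)%N ->
  forall x, ~ K x -> touches sarc x s <-> exists b, linked (~` K) x (H' (sg R (s0 (+) a) * (r / 2), sg R b * (r / 2))).
  apply: (half_plane isD so ov oe c_sorted c_size cP v0 k0 km r0).
  - by rewrite /H' /= H0 -h.
  - move=> y e' /sw ny e'0; have [e2 e20 h2] := Hc _ _ ny e'0; exists e2 => // y' /sw ny' /sw yy'.
    exact: h2.
  - move=> y e' /sw ny e'0; have [e2 e20 h2] := Ho _ _ ny e'0; exists e2 => // w /h2 [y' [n1 n2 n3]].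
    by exists (y'.2, y'.1); split; [exact: sw n1|have := sw _ _ _ n2; rewrite /= -surjective_pairing|rewrite /H' /= -surjective_pairing].
  - by move=> y /sw ny; exact: (Hf _ ny).
  - by move=> y /sw ny /(HK _ ny) /= []; [right|left].
  - by move=> y u /sw ny Iu hu; apply: hd2 => //; rewrite hu -h; apply: box_le l2 (Hn _ ny).
  - move=> y /sw ny hy; apply: ((He _ ny).1); rewrite -[H _]/(H' y) hy -h; exists (bp e i) => //; split; exact: ltW.
exists (fun a b => H (sg R (s0 (+) a) * (r / 2), sg R (s1 (+) b) * (r / 2))); split.
- by move=> a b; exact: (quadrant_off r0 HK).
- move=> a s se1 si1 x Kx; rewrite (hs0 a s se1 si1 x Kx); split=> -[b hb].
    by exists (s1 (+) b); rewrite addbA addbb.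
  by exists (s1 (+) b).
- move=> b s se1 si1 x Kx; rewrite (hs1 b s se1 si1 x Kx); split=> -[a ha].
    by exists (s0 (+) a); rewrite addbA addbb.
  by exists (s0 (+) a).
Qed.

(** Near the crossing the two sides of the segment are [q false] and [q true]; the definition of
    [mult] by competing faces agrees with counting them. *)
Lemma mult_pair (s : seg) (q : bool -> P2) : (forall b, ~ K (q b)) ->
  (forall x, ~ K x -> touches sarc x s <-> exists b, linked (~` K) x (q b)) ->
  forall x, ~ K x -> mult sarc x s = (`[< linked (~` K) x (q false) >] + `[< linked (~` K) x (q true) >])%N.
Proof.
move=> Kq hq x Kx; rewrite /mult; case: asboolP => tx; last first.
  have n b : ~ linked (~` K) x (q b) by move=> xb; apply: tx; apply/(hq _ Kx); exists b.
  by do 2![case: asboolP => [/n //|_]].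
have tq b : touches sarc (q b) s by apply/(hq _ (Kq b)); exists b; exact: linked_refl.
case: asboolP => [[y [Ky ty nxy]]|hn].
  have [a xa] := (hq _ Kx).1 tx; have [b yb] := (hq _ Ky).1 ty.
  have nb : ~ linked (~` K) x (q b) by move=> xb; apply: nxy; exact: linked_trans xb (linked_sym yb).
  case: a b xa nb yb => [] [] // xa nb yb; do 2![case: asboolP => //].
have xq b : linked (~` K) x (q b).
  by apply: contrapT => nb; apply: hn; exists (q b); split.
by do 2![case: asboolP => [_|/(_ (xq _))//]].
Qed.

(** [Q x a b] says that the face of [x] contains the quadrant between segment [a] of [e] and segment
    [b] of [f]. This table is all that the counting keeps of the topology at a crossing. *)
Lemma mult_quadrants e f i k : e != f -> (0 < i)%N -> (i <= ncr e)%N -> (0 < k)%N -> (k <= ncr f)%N ->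
  bpt e i = bpt f k -> exists Q : P2 -> bool -> bool -> bool,
  [/\ forall (a : bool) (s : seg), se s = e -> si s = (i.-1 + a)%N -> forall x, ~ K x -> mult sarc x s = (Q x a false + Q x a true)%N,
      forall (b : bool) (s : seg), se s = f -> si s = (k.-1 + b)%N -> forall x, ~ K x -> mult sarc x s = (Q x false b + Q x true b)%N &
      forall x y (a b : bool), Q x a b -> Q y a b -> linked (~` K) x y].
Proof.
move=> ef i0 im k0 km h; have [q [Kq he hf]] := quadrants ef i0 im k0 km h.
exists (fun x a b => `[< linked (~` K) x (q a b) >]); split.
- by move=> a s se1 si1 x Kx; apply: (mult_pair (q := q a) (Kq a) (he a s se1 si1) Kx).
- move=> b s se1 si1 x Kx.
  exact: (mult_pair (q := fun a => q a b) (fun a => Kq a b) (hf b s se1 si1) Kx).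
- by move=> x y a b /asboolP h1 /asboolP h2; exact: linked_trans h1 (linked_sym h2).
Qed.

End Crossing.

Lemma connected_const (T : topologicalType) (C : set T) (Z : T -> Prop) (x q : T) :
  connected C -> C x -> C q -> (forall w, C w -> \forall w' \near w, C w' -> (Z w' <-> Z w)) ->
  Z x -> Z q.
Proof.
move=> cC Cx Cq loc Zx.
have inner (A : set T) : A° `<=` A by exact: interior_subset.
(* [OT] and [OF] are open in the whole space, with the traces of [Z] and of its negation on [C]. *)
pose OT := [set w | C w -> Z w]°; pose OF := [set w | C w -> ~ Z w]°.
have TE w : C w -> OT w <-> Z w.
  move=> Cw; split=> [/inner|Zw]; first exact.
  by apply: filterS (loc w Cw) => w' h Cw'; apply/(h Cw').
have FE w : C w -> OF w <-> ~ Z w.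
  move=> Cw; split=> [/inner|Zw]; first exact.
  by apply: filterS (loc w Cw) => w' h Cw' Zw'; apply: Zw; apply/(h Cw').
have BC : [set w | C w /\ Z w] = C.
  apply: cC; first by exists x.
    exists OT; first exact: open_interior.
    by apply/seteqP; split=> w [Cw h]; split=> //; apply/(TE w Cw).
  exists (~` OF); first by apply: open_closedC; exact: open_interior.
  apply/seteqP; split=> w [Cw h]; split=> //; first by move/(FE w Cw).
  by apply: contrapT => nZ; apply: h; apply/(FE w Cw).
have : [set w | C w /\ Z w] q by rewrite BC.
by case.
Qed.

(** * Connectedness of the planarization; empty lenses *)

Section Lens.
Variable R : realType.
Local Notation P2 := (R * R)%type.
Local Notation pt := (R * R * R)%type.
Variables (V E : finType) (ends : E -> V * V) (D : drawing R V E) (o : pt).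
Hypothesis isD : is_drawing ends D.
Hypotheses (so : sphere o) (ov : forall v, o <> pos D v) (oe : forall e t, I01P t -> o <> darc D e t).
Variable c : E -> seq R.
Hypotheses (c_sorted : forall e, sorted <%R (c e)) (c_size : forall e, (size (c e) <= 2)%N)
  (cP : forall e t, t \in c e <-> crosses D o e t).
Variable v0 : V.
Hypotheses (hconn : mg_connected ends) (hV : (1 < #|V|)%N).
Local Notation parc := (parc D o).
Local Notation vpos := (vpos D o).
Local Notation ncr := (ncr c).
Local Notation bp := (bp c).
Local Notation bpt := (bpt D o c).
Local Notation sarc := (@sarc R V E D o c).
Local Notation seg := (seg c).
Local Notation node := (node D o c).
Local Notation K := (Kset sarc [set: seg]%SET).
Local Notation ssrc := (@ssrc R V E D o c v0).
Local Notation stgt := (@stgt R V E D o c v0).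
Local Notation npos := (@npos R V E D o c).
Let G : plane_graph ssrc stgt npos sarc := planarization isD so ov oe c_sorted cP v0.

Lemma vertex_edge v : exists e, (ends e).1 = v \/ (ends e).2 = v.
Proof.
have [u uv] : exists u, u != v.
  move: hV; rewrite (cardD1 v) inE ltnS => /card_gt0P [u].
  by rewrite !inE andbT => uv; exists u.
have /connectP [[|w l] /=] := hconn v u; first by move=> _ uE; rewrite uE eqxx in uv.
case/andP=> /existsP [e /orP[/eqP he|/eqP he]] _ _; exists e; rewrite he; by [left|right].
Qed.

Lemma node_cases (x : node) : (exists v, npos x = vpos v) \/
  exists e i, [/\ (0 < i)%N, (i <= ncr e)%N & npos x = bpt e i].
Proof.
have /nodesP [[v hv]|[e [t [tc he]]]] := valP x; first by left; exists v.
right; exists e, (index t (c e)).+1; split=> //; first by rewrite ncrE index_mem.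
by rewrite !bptE bp_index.
Qed.

Lemma node_on_edge (x : node) : exists e i, (i <= (ncr e).+1)%N /\ npos x = bpt e i.
Proof.
case: (node_cases x) => [[v ->]|[e [i [i0 im ->]]]]; last by exists e, i; split=> //; exact: leqW.
have [e [he|he]] := vertex_edge v.
  by exists e, 0%N; rewrite !bptE bp0 (parc0 o isD) he.
by exists e, (ncr e).+1; rewrite !bptE bp_last (parc1 o isD) he.
Qed.

Lemma npos_inj : injective npos. Proof. exact: val_inj. Qed.

Lemma node_incident (x : node) : exists s : seg, ssrc s = x \/ stgt s = x.
Proof.
have [e [i [im hx]]] := node_on_edge x; move: im; rewrite leq_eqVlt => /predU1P [iE|im].
  have [s [s1 s2]] := seg_ex c_size (leqnn (ncr e)); exists s; right; apply: npos_inj.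
  by rewrite (npos_tgt o isD) // s1 s2 hx iE.
have [s [s1 s2]] := seg_ex c_size im; exists s; left; apply: npos_inj.
by rewrite (npos_src o isD) // s1 s2 hx.
Qed.

Lemma planar_connected (x y : node) : connect (node_adj (S := seg) ssrc stgt) x y.
Proof.
have symA : symmetric (node_adj (S := seg) ssrc stgt).
  by move=> u v; apply/existsP/existsP => -[s hs]; exists s; rewrite orbC.
have along e i (u v : node) : (i <= (ncr e).+1)%N -> npos u = bpt e 0 -> npos v = bpt e i ->
    connect (node_adj (S := seg) ssrc stgt) u v.
  elim: i v => [|i IH] v im hu hv.
    by have -> : u = v; [apply: npos_inj; rewrite hu hv|exact: connect0].
  have [s [s1 s2]] := seg_ex c_size im.
  apply: connect_trans (IH (ssrc s) (ltnW im) hu _) _; first by rewrite (npos_src o isD) // s1 s2.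
  apply: connect1; apply/existsP; exists s; rewrite eqxx /=; apply/orP; left.
  by apply/eqP; apply: npos_inj; rewrite (npos_tgt o isD) // s1 s2 hv.
have vn v : exists u : node, npos u = vpos v.
  by exists (SeqSub ((nodesP D o c _).2 (or_introl (ex_intro _ v erefl)))).
have to_vertex (u : node) : exists v (w : node), npos w = vpos v /\ connect (node_adj (S := seg) ssrc stgt) w u.
  have [e [i [im hu]]] := node_on_edge u; have [w hw] := vn (ends e).1.
  exists (ends e).1, w; split=> //; apply: (along e i) => //.
  by rewrite hw !bptE bp0 (parc0 o isD).
have edge v w (a b : node) : adj ends v w -> npos a = vpos v -> npos b = vpos w ->
    connect (node_adj (S := seg) ssrc stgt) a b.
  move=> /existsP [e /orP[/eqP he|/eqP he]] ha hb.
    apply: (along e (ncr e).+1) => //; rewrite !bptE ?bp0 ?bp_last ?(parc0 o isD) ?(parc1 o isD) he //.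
  rewrite (sym_connect_sym symA).
  apply: (along e (ncr e).+1) => //; rewrite !bptE ?bp0 ?bp_last ?(parc0 o isD) ?(parc1 o isD) he //.
have vertices v w (a b : node) : npos a = vpos v -> npos b = vpos w -> connect (node_adj (S := seg) ssrc stgt) a b.
  have /connectP [l pl ->] := hconn v w.
  elim: l v a pl => [|u l IH] v a /=.
    by move=> _ ha hb; have -> : a = b; [apply: npos_inj; rewrite ha hb|exact: connect0].
  case/andP=> vu pl ha hb; have [d hd] := vn u.
  by apply: connect_trans (edge _ _ _ _ vu ha hd) (IH _ _ pl hd hb).
have [v [a [ha ax]]] := to_vertex x; have [w [b [hb yb]]] := to_vertex y.
rewrite (sym_connect_sym symA) in ax.
by apply: connect_trans ax _; apply: connect_trans (vertices _ _ _ _ ha hb) yb.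
Qed.

Definition run e i j : {set seg} := [set s : seg | (se s == e) && (i <= si s < j)%N]%SET.

Lemma Kset_run e i j x : (i < j)%N -> (j <= (ncr e).+1)%N ->
  Kset sarc (run e i j) x <-> exists t, [/\ bp e i <= t, t <= bp e j & parc e t = x].
Proof.
move=> ij jm; split=> [[s]|[t [t0 t1 <-]]].
  rewrite inE => /and3P [/eqP es is_ sj] /(arci_sarcP c_sorted cP) [t [t0 t1 <-]].
  rewrite es in t0 t1 *; exists t; split=> //.
    apply: le_trans t0; apply: (bp_le c_sorted cP) => //; apply: leq_trans (ltnW sj) jm.
  by apply: le_trans t1 _; apply: (bp_le c_sorted cP).
have [k [k1 k2 k3 k4]] := bp_loc ij jm t0 t1.
have [s [s1 s2]] := seg_ex c_size (leq_trans k2 jm : (k <= ncr e)%N).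
exists s; first by rewrite inE s1 s2 eqxx k1 k2.
by apply/(arci_sarcP c_sorted cP); exists t; rewrite s1 s2.
Qed.

Lemma node_K (x : P2) : x \in nodes D o c -> K x.
Proof.
move=> xn; have [s hs] := node_incident (SeqSub xn).
have -> : x = npos (SeqSub xn) by [].
by exists s; rewrite ?inE //; case: hs => <-; [exact: (pos_src_arc G)|exact: (pos_tgt_arc G)].
Qed.

Lemma crossing_node q : is_crossing D q -> q <> o /\ stereo o q \in nodes D o c.
Proof.
case=> e [f [s [t [ef /I01oE [s0 s1] /I01oE [t0 t1] hs ht]]]].
have Is : I01P s by split; exact: ltW.
split; first by rewrite -hs; exact/nesym/oe.
have st : parc e s = parc f t by rewrite !parcE hs ht.
have [sc tc] := crosses_sym cP ef s0 s1 t0 t1 st.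
by apply/nodesP; right; exists e, s; rewrite !parcE hs.
Qed.

Lemma sphere_component C p q : ~ Kset sarc C p ->
  let L := [set x | exists2 e, exists2 t, I01P t & darc D e t = x & Kset sarc C (stereo o x)] in
  connected_component (@sphere R `\` L) (stereo_inv o p) q -> q <> o ->
  linked (~` Kset sarc C) p (stereo o q).
Proof.
move=> Cp L [X [Xx XL cX] Xq] qo.
set Y := linked (~` Kset sarc C) p.
have cC := cls_Kset G (H := C).
pose unb := forall M, 0 < M -> exists2 y, Y y & ~ box M (0, 0) y.
pose Z w := (w <> o /\ Y (stereo o w)) \/ (w = o /\ unb).
have Zx : Z (stereo_inv o p).
  by left; split; [exact: stereo_inv_neq|rewrite stereo_invK; exact: linked_refl].
suff : Z q by case=> [[]|[]].
have XS w : X w -> sphere w by move=> /XL [].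
have XC w : X w -> w <> o -> ~ Kset sarc C (stereo o w).
  move=> Xw wo Cw; have [sw nL] := XL _ Xw; apply: nL.
  have /(KsetP c_sorted c_size cP) [e [t It ht]] : K (stereo o w).
    by apply: Kset_sub Cw; exact: finset.subsetT.
  exists e => //; exists t => //; rewrite -(parc_inv isD so oe e It) ht.
  by apply: stereoK.
have [M M0 CM] := ucpt_bounded (ucpt_Kset G (H := C)).
apply: (connected_const cX Xx Xq _ Zx) => w Xw.
case: (pselect (w = o)) => wo; last first.
  have nw := avoid_center so (XS _ Xw) wo.
  have [e e0 he] := opn_step cC (XC _ Xw wo).
  have ns : nbhs w [set w' | box e (stereo o w) (stereo o w')].
    exact: (stereo_cts so (XS _ Xw) wo (box_nbhs _ e0)).
  apply: (@filterS _ (nbhs w) _ _ _ _ (@filterI _ (nbhs w) _ _ _ nw ns)).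
  move=> w' [/= w'o /he /linked_step hw] _; split.
    case=> [[_ h]|[]//]; left; split=> //; exact: linked_trans h (linked_sym hw).
  case=> [[_ h]|[]//]; left; split=> //; exact: linked_trans h hw.
rewrite wo.
case: (pselect unb) => hu.
  have [W nW hW] := stereo_infinity M so.
  apply: (@filterS _ (nbhs o) _ _ _ _ nW) => w' Ww' Xw'; split; first by right.
  move=> _; case: (pselect (w' = o)) => w'o; first by right.
  left; split=> //; have [y Yy yM] := hu M M0.
  have far := linked_far M0 cC CM.
  apply: linked_trans Yy _; apply: linked_trans (linked_sym (far _ yM)) _.
  by apply: far; apply: hW => //; exact: XS.
have [M' M'0 hM'] : exists2 M', 0 < M' & forall y, Y y -> box M' (0, 0) y.
  apply: contrapT => hn; apply: hu => M1 M10; apply: contrapT => hn'.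
  by apply: hn; exists M1 => // y Yy; apply: contrapT => ny; apply: hn'; exists y.
have [W nW hW] := stereo_infinity M' so.
apply: (@filterS _ (nbhs o) _ _ _ _ nW) => w' Ww' Xw'; split.
  case=> [[w'o /hM' h]|[_ //]]; by case: (hW w' Ww' (XS _ Xw') w'o h).
by case=> [[]|[_ //]].
Qed.

(** [Ps] and [T] list the faces and the segments inside the lens. By [merge] they fill the component
    of [p0] off the two runs, so it contains no node, whereas [non_homotopic] places a vertex or a
    crossing there. *)
Lemma no_lens e f i j k l (T : {set seg}) (Ps : P2 -> Prop) p0 :
  non_homotopic D -> e != f -> (i < j)%N -> (j <= (ncr e).+1)%N -> (k < l)%N -> (l <= (ncr f).+1)%N ->
  (bpt e i = bpt f k /\ bpt e j = bpt f l) \/ (bpt e i = bpt f l /\ bpt e j = bpt f k) ->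
  (forall a b, (i <= a <= j)%N -> (k <= b <= l)%N -> bpt e a = bpt f b -> a = i \/ a = j) ->
  (forall p, Ps p -> ~ K p) ->
  (forall p s, Ps p -> touches sarc p s -> s \in run e i j :|: run f k l \/ s \in T) ->
  (forall t, t \in T -> Kset sarc (run e i j :|: run f k l) (npos (ssrc t)) /\
                        Kset sarc (run e i j :|: run f k l) (npos (stgt t))) ->
  (forall t q, t \in T -> ~ K q -> touches sarc q t -> exists2 p, Ps p & linked (~` K) p q) ->
  Ps p0 -> False.
Proof.
move=> nh ef ij jm kl lm hends hmeet PK PT TC TP Pp0.
set C := (run e i j :|: run f k l)%SET.
have KU x : Kset sarc C x <-> Kset sarc (run e i j) x \/ Kset sarc (run f k l) x.
  split=> [[s]|]; first by rewrite inE => /orP[h1|h1] h2; [left|right]; exists s.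
  by case=> -[s h1 h2]; exists s; rewrite // inE h1 ?orbT.
have Ie := bp_I01 c_sorted cP; have ije := bp_lt c_sorted cP ij jm; have klf := bp_lt c_sorted cP kl lm.
have [ie0 ie1] := Ie e i (leq_trans (ltnW ij) jm); have [je0 je1] := Ie e j jm.
have [kf0 kf1] := Ie f k (leq_trans (ltnW kl) lm); have [lf0 lf1] := Ie f l lm.
have dpt g h a b : (a <= (ncr g).+1)%N -> (b <= (ncr h).+1)%N -> bpt g a = bpt h b -> darc D g (bp g a) = darc D h (bp h b).
  by move=> am bm; apply: (parc_eq isD so oe); apply: Ie.
have im := leq_trans (ltnW ij) jm; have km := leq_trans (ltnW kl) lm.
have hd : (darc D e (bp e i) = darc D f (bp f k) /\ darc D e (bp e j) = darc D f (bp f l)) \/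
          (darc D e (bp e i) = darc D f (bp f l) /\ darc D e (bp e j) = darc D f (bp f k)).
  by case: hends => -[h1 h2]; [left|right]; split; exact: dpt.
have Kp0 := PK _ Pp0.
have Cp0 : ~ Kset sarc C p0 by move=> h; apply: Kp0; apply: Kset_sub h; exact: finset.subsetT.
pose A := darc D e @` [set t | bp e i <= t <= bp e j].
pose B := darc D f @` [set t | bp f k <= t <= bp f l].
have AB : A `&` B = [set darc D e (bp e i)] `|` [set darc D e (bp e j)].
  apply/seteqP; split=> x.
    move=> [[t /andP[t0 t1] tx] [u /andP[u0 u1] ux]].
    have It : I01P t by split; lra.
    have Iu : I01P u by split; lra.
    have tu : parc e t = parc f u by rewrite !parcE tx ux.
    have [a [b [am bm ta ub]]] := meet_bp isD so ov oe cP ef It Iu tu.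
    have mono g a1 a2 : (a1 <= (ncr g).+1)%N -> (a2 <= (ncr g).+1)%N -> bp g a1 <= bp g a2 -> (a1 <= a2)%N.
      by move=> h1 h2; apply: contraTT; rewrite -ltnNge -ltNge => h3; apply: (bp_lt c_sorted cP).
    have hab : bpt e a = bpt f b by rewrite !bptE -ta -ub.
    have [aE|aE] : a = i \/ a = j.
      apply: (hmeet a b) => //; apply/andP; split; [apply: (mono e)|apply: (mono e)|apply: (mono f)|apply: (mono f)];
      rewrite -?ta -?ub //.
      by left; rewrite -tx ta aE.
    by right; rewrite -tx ta aE.
  have inA t : bp e i <= t -> t <= bp e j -> A (darc D e t) by move=> h1 h2; exists t => //=; rewrite h1 h2.
  have inB t : bp f k <= t -> t <= bp f l -> B (darc D f t) by move=> h1 h2; exists t => //=; rewrite h1 h2.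
  have ije' := ltW ije; have klf' := ltW klf.
  case=> /= ->; split; try (by apply: inA); case: hd => -[h1 h2]; rewrite ?h1 ?h2; exact: inB.
have Bends : [set darc D f (bp f k)] `|` [set darc D f (bp f l)] = [set darc D e (bp e i)] `|` [set darc D e (bp e j)].
  by case: hd => -[-> ->] //; rewrite setUC.
have onAB x : sphere x -> x <> o -> (A `|` B) x <-> Kset sarc C (stereo o x).
  move=> sx xo; rewrite KU (Kset_run _ ij jm) (Kset_run _ kl lm); split.
    by case=> -[t /andP[t0 t1] tx]; [left|right]; exists t; rewrite !parcE tx.
  case=> -[t [t0 t1 tx]]; [left|right]; exists t; rewrite /= ?t0 ?t1 //.
    have It : I01P t by split; lra.
    by rewrite -(parc_inv isD so oe e It) tx stereoK.
  have It : I01P t by split; lra.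
  by rewrite -(parc_inv isD so oe f It) tx stereoK.
pose x := stereo_inv o p0.
have sx : sphere x by exact: stereo_inv_sphere.
have xo : x <> o by exact: stereo_inv_neq.
have nx : ~ (A `|` B) x by move/(onAB _ sx xo); rewrite stereo_invK.
have [q [hq hv]] := nh e f (bp e i) (bp e j) (bp f k) (bp f l) ie0 ije je1 kf0 klf lf1 AB Bends x sx nx.
have [qo qn] : q <> o /\ stereo o q \in nodes D o c.
  case: hv => [[v ->]|/crossing_node //]; split; first exact/nesym/ov.
  by apply/nodesP; left; exists v.
have lq : linked (~` Kset sarc C) p0 (stereo o q).
  apply: sphere_component => //.
  case: hq => X [Xx XL cX] Xq; exists X => //; split=> // w /XL [sw nw]; split=> //.
  case=> g [t It tw] Cw; apply: nw; apply/onAB => //.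
  by rewrite -tw; exact/nesym/oe.
have := merge G node_incident PK PT TC TP Pp0 lq.
case=> [[p Pp /(linked_in (PK _ Pp))]|[t _ ot]]; first by apply; exact: node_K.
by have := open_not_node isD so ov oe c_sorted cP ot; rewrite qn.
Qed.

End Lens.

(** * Faces of small weight *)

(** Equal terms are paired by [pi]; [enum_rank] selects one of each pair. *)
Lemma even_involution (T : finType) (pi : T -> T) (a : T -> nat) :
  (forall z, pi (pi z) = z) -> (forall z, pi z != z) -> (forall z, a (pi z) = a z) ->
  ~~ odd (\sum_z a z).
Proof.
move=> piK pin ha.
rewrite (bigID (fun z => (enum_rank z < enum_rank (pi z))%N)) /=.
suff -> : (\sum_(z | ~~ (enum_rank z < enum_rank (pi z))%N) a z =
           \sum_(z | (enum_rank z < enum_rank (pi z))%N) a z)%N by rewrite addnn odd_double.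
rewrite (reindex_inj (can_inj piK)); apply: eq_big => [z|z _]; last exact: ha.
rewrite piK -leqNgt leq_eqVlt; case: eqP => // /val_inj /enum_rank_inj e.
by have := pin z; rewrite -e eqxx.
Qed.

(** * Multiplicities, weights and their parity *)

Section Faces.
Variable R : realType.
Local Notation P2 := (R * R)%type.
Local Notation pt := (R * R * R)%type.
Variables (V E : finType) (ends : E -> V * V) (D : drawing R V E) (o : pt).
Hypothesis isD : is_drawing ends D.
Hypotheses (so : sphere o) (ov : forall v, o <> pos D v) (oe : forall e t, I01P t -> o <> darc D e t).
Variable c : E -> seq R.
Hypotheses (c_sorted : forall e, sorted <%R (c e)) (c_size : forall e, (size (c e) <= 2)%N)
  (cP : forall e t, t \in c e <-> crosses D o e t).
Variable v0 : V.
Hypotheses (hconn : mg_connected ends) (hV : (1 < #|V|)%N) (nh : non_homotopic D) (bigE : (3 < #|E|)%N).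
Local Notation ncr := (ncr c).
Local Notation bpt := (bpt D o c).
Local Notation sarc := (@sarc R V E D o c).
Local Notation seg := (seg c).
Local Notation K := (Kset sarc [set: seg]%SET).
Local Notation ssrc := (@ssrc R V E D o c v0).
Local Notation stgt := (@stgt R V E D o c v0).
Local Notation npos := (@npos R V E D o c).
Let G : plane_graph ssrc stgt npos sarc := planarization isD so ov oe c_sorted cP v0.
Implicit Types (x y : P2) (e f g h : E) (s t u : seg).

Lemma ncr_le2 e : (ncr e <= 2)%N. Proof. exact: c_size. Qed.

Lemma seg_ex0 : exists s : seg, True.
Proof.
have /card_gt0P [e _] : (0 < #|E|)%N by apply: leq_trans bigE.
by have [s _] := seg_ex c_size (leq0n (ncr e)); exists s.
Qed.

(** Made total by an arbitrary default segment, so that [mu] takes plain natural indices; meaningful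
    for [i <= ncr e]. *)
Definition sgf e i : seg := xget (projT1 (cid seg_ex0)) [set s | se s = e /\ si s = i].

Lemma sgfP e i : (i <= ncr e)%N -> se (sgf e i) = e /\ si (sgf e i) = i.
Proof.
move=> im; have [s hs] := seg_ex c_size im; rewrite /sgf.
by case: xgetP => [s' _ //|/(_ s)].
Qed.

Lemma sgf_eq s : sgf (se s) (si s) = s.
Proof. by have [h1 h2] := sgfP (si_le s); exact: seg_eq. Qed.

Definition mu x e i := mult sarc x (sgf e i).
Lemma muE x e i : mu x e i = mult sarc x (sgf e i). Proof. by []. Qed.

Lemma touches_mu x s : touches sarc x s <-> (0 < mu x (se s) (si s))%N.
Proof. by rewrite /mu sgf_eq mult_gt0. Qed.

Lemma bptI e i j : (i <= (ncr e).+1)%N -> (j <= (ncr e).+1)%N -> bpt e i = bpt e j -> i = j.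
Proof. exact: (bpt_inj isD so oe c_sorted cP). Qed.

Lemma bpt3 e f g i j k : e != f -> f != g -> e != g -> (0 < i)%N -> (i <= ncr e)%N ->
  (j <= (ncr f).+1)%N -> (k <= (ncr g).+1)%N -> bpt e i = bpt f j -> bpt f j = bpt g k -> False.
Proof. exact: (bpt_triple isD so ov oe). Qed.

Lemma partner e i : (0 < i)%N -> (i <= ncr e)%N -> exists f k, [/\ f != e, (0 < k)%N, (k <= ncr f)%N & bpt e i = bpt f k].
Proof.
move=> i0 im; have tc := bp_mid i0 im.
have [t0 t1 [f [s [fe s0 s1 hs]]]] := (cP e _).1 tc.
have [_ sc] : bp c e i \in c e /\ s \in c f.
  by apply: (crosses_sym cP) => //; rewrite eq_sym.
exists f, (index s (c f)).+1; split=> //; first by rewrite ncrE index_mem.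
by rewrite !bptE -hs bp_index.
Qed.

Lemma mu_quad e f i k : e != f -> (0 < i)%N -> (i <= ncr e)%N -> (0 < k)%N -> (k <= ncr f)%N ->
  bpt e i = bpt f k -> exists Q : P2 -> bool -> bool -> bool,
  [/\ forall (a : bool) x, ~ K x -> mu x e (i.-1 + a) = (Q x a false + Q x a true)%N,
      forall (b : bool) x, ~ K x -> mu x f (k.-1 + b) = (Q x false b + Q x true b)%N &
      forall x y (a b : bool), Q x a b -> Q y a b -> linked (~` K) x y].
Proof.
move=> ef i0 im k0 km h.
have [Q [h1 h2 h3]] := mult_quadrants isD so ov oe c_sorted c_size cP v0 ef i0 im k0 km h.
exists Q; split=> // [a x Kx|b x Kx].
  have hm : (i.-1 + a <= ncr e)%N by case: a; lia.
  by have [s1 s2] := sgfP hm; exact: h1.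
have hm : (k.-1 + b <= ncr f)%N by case: b; lia.
by have [s1 s2] := sgfP hm; exact: h2.
Qed.

(** The face fills a quadrant along the segment of [e], and a segment of [f] bounds this quadrant
    too. *)
Lemma nbr1 x e f i k (a : bool) : e != f -> (0 < i)%N -> (i <= ncr e)%N -> (0 < k)%N -> (k <= ncr f)%N ->
  bpt e i = bpt f k -> ~ K x -> (0 < mu x e (i.-1 + a))%N -> exists b : bool, (0 < mu x f (k.-1 + b))%N.
Proof.
move=> ef i0 im k0 km h Kx; have [Q [h1 h2 _]] := mu_quad ef i0 im k0 km h.
rewrite h1 // addn_gt0 !lt0b => /orP[q|q]; [exists false|exists true]; rewrite h2 // addn_gt0 !lt0b;
by case: a q => ->; rewrite ?orbT.
Qed.

(** Two different faces sharing the segment occupy its two quadrants, which lie on either side of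
    [e] and so along opposite segments of [f]. *)
Lemma nbr2 x y e f i k (a : bool) : e != f -> (0 < i)%N -> (i <= ncr e)%N -> (0 < k)%N -> (k <= ncr f)%N ->
  bpt e i = bpt f k -> ~ K x -> ~ K y -> ~ linked (~` K) x y ->
  (0 < mu x e (i.-1 + a))%N -> (0 < mu y e (i.-1 + a))%N ->
  exists b : bool, (0 < mu x f (k.-1 + b))%N /\ (0 < mu y f (k.-1 + ~~ b))%N.
Proof.
move=> ef i0 im k0 km h Kx Ky nxy; have [Q [h1 h2 h3]] := mu_quad ef i0 im k0 km h.
rewrite !h1 // !addn_gt0 !lt0b => /orP hx /orP hy.
have [b hb] : exists b, Q x a b by case: hx => ?; [exists false|exists true].
have [b' hb'] : exists b, Q y a b by case: hy => ?; [exists false|exists true].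
have bb : b' = ~~ b.
  by case: b b' hb hb' => [] [] // q q'; case: nxy; exact: h3 q q'.
exists b; rewrite -bb !h2 // !addn_gt0 !lt0b.
by split; case: (a) hb hb' => hb1 hb2; rewrite ?hb1 ?hb2 ?orbT.
Qed.

Lemma sum_seg (F : seg -> nat) : (\sum_s F s = \sum_e \sum_(i < (ncr e).+1) F (sgf e i))%N.
Proof.
rewrite (partition_big (@se R E c) predT) //=; apply: eq_bigr => e _.
rewrite (partition_big (fun s => inord (si s) : 'I_(ncr e).+1) predT) //=.
apply: eq_bigr => i _; have im : (i <= ncr e)%N by rewrite -ltnS.
have [h1 h2] := sgfP im; rewrite (big_pred1 (sgf e i)) // => s.
apply/andP/eqP => [[/eqP se1 /eqP si1]|->].
  have si2 : si s = i by rewrite -si1 inordK // ltnS -se1 si_le.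
  by rewrite -(sgf_eq s) se1 si2.
split; first by rewrite h1.
by apply/eqP/val_inj; rewrite /= h2 inordK.
Qed.

Definition real_ends s : nat := ((si s == 0%N) + (si s == ncr (se s)))%N.

Definition weight x : nat := \sum_s mult sarc x s * (2 + real_ends s).
Definition mult_deg x k : nat := \sum_(s | real_ends s == k) mult sarc x s.

Lemma real_ends_le2 s : (real_ends s <= 2)%N. Proof. by rewrite /real_ends; case: (_ == _); case: (_ == _). Qed.

Lemma weightE x : weight x = (2 * mult_deg x 0 + 3 * mult_deg x 1 + 4 * mult_deg x 2)%N.
Proof.
rewrite /weight /mult_deg !big_distrr /= (bigID (fun s => real_ends s == 0%N)) /= -addnA; congr (_ + _)%N.
  by apply: eq_bigr => s /eqP ->; rewrite mulnC.
rewrite (bigID (fun s => real_ends s == 1%N)) /=; congr (_ + _)%N.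
  apply: eq_big => [s|s /andP[_ /eqP ->]]; last by rewrite mulnC.
  by case: (real_ends s) => [|[|]].
apply: eq_big => [s|s /andP[r0 r1]].
  by have := real_ends_le2 s; case: (real_ends s) => [|[|[|]]].
by have := real_ends_le2 s; move: r0 r1; case: (real_ends s) => [|[|[|]]] //; rewrite mulnC.
Qed.

Definition supp x : {set seg} := [set s | (0 < mult sarc x s)%N]%SET.

Lemma card_supp x : (#|supp x| <= mult_deg x 0 + mult_deg x 1 + mult_deg x 2)%N.
Proof.
have -> : (mult_deg x 0 + mult_deg x 1 + mult_deg x 2)%N = (\sum_s mult sarc x s)%N.
  rewrite /mult_deg [RHS](bigID (fun s => real_ends s == 0%N)) /= -addnA; congr (_ + _)%N.
  rewrite [RHS](bigID (fun s => real_ends s == 1%N)) /=; congr (_ + _)%N.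
    by apply: eq_bigl => s; case: (real_ends s) => [|[|]].
  by apply: eq_bigl => s; have := real_ends_le2 s; case: (real_ends s) => [|[|[|]]].
rewrite -sum1_card [leqRHS](bigID (fun s => s \in supp x)) /=; apply: leq_trans (leq_addr _ _).
by apply: leq_sum => s; rewrite inE.
Qed.

(* Handshake: the multiplicities at the two edges of a crossing have equal sums. *)
Lemma even_mult1 x : ~ K x -> ~~ odd (mult_deg x 1).
Proof.
move=> Kx.
(* Occurrences of crossings: the pair [(e, i)] stands for the crossing of index [i.+1] on [e]. *)
pose X := {z : E * 'I_2 | (z.2 < ncr z.1)%N}.
pose xe (z : X) := (val z).1; pose xi (z : X) : nat := (val z).2.+1.
have xi0 z : (0 < xi z)%N by [].
have xim z : (xi z <= ncr (xe z))%N by exact: (valP z).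
have Xex e i : (0 < i)%N -> (i <= ncr e)%N -> exists z : X, xe z = e /\ xi z = i.
  move=> i0 im; have i2 : (i.-1 < 2)%N by have := ncr_le2 e; lia.
  have him : (i.-1 < ncr e)%N by lia.
  exists (exist (fun z : E * 'I_2 => is_true (z.2 < ncr z.1)%N) (e, Ordinal i2) him).
  by rewrite /xe /xi /= prednK.
have Xeq (z z' : X) : xe z = xe z' -> xi z = xi z' -> z = z'.
  case: z z' => [[e i] h1] [[f j] h2]; rewrite /xe /xi /= => ef [ij].
  by apply: val_inj => /=; congr (_, _) => //; exact: val_inj.
(* [pi] passes to the occurrence of the same crossing on the other edge; it is an involution because
   no three edges cross at a point. *)
have /choice [pi hpi] : forall z : X, exists z', xe z' != xe z /\ bpt (xe z) (xi z) = bpt (xe z') (xi z').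
  move=> z; have [f [k [fe k0 km h]]] := partner (xi0 z) (xim z).
  by have [z' [h1 h2]] := Xex f k k0 km; exists z'; rewrite h1 h2.
have piK z : pi (pi z) = z.
  have [h1 h2] := hpi z; have [h3 h4] := hpi (pi z).
  have ee : xe (pi (pi z)) = xe z.
    apply/eqP/negPn/negP => ne.
    by apply: (bpt3 (e := xe z) (f := xe (pi z)) (g := xe (pi (pi z))) _ _ _ (xi0 z) (xim z) _ _ h2 h4);
       rewrite 1?eq_sym // leqW.
  have e1 : (xi (pi (pi z)) <= (ncr (xe z)).+1)%N by rewrite -ee leqW.
  apply: Xeq => //; apply: (bptI e1 (leqW (xim z))).
  by rewrite -[in LHS]ee -h4 -h2.
pose a z := (mu x (xe z) (xi z).-1 + mu x (xe z) (xi z))%N.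
(* Either edge counts the same four quadrants. *)
have ha z : a (pi z) = a z.
  have [h1 h2] := hpi z; rewrite eq_sym in h1.
  have [Q [q1 q2 _]] := mu_quad h1 (xi0 z) (xim z) (xi0 (pi z)) (xim (pi z)) h2.
  have := q1 false x Kx; have := q1 true x Kx; have := q2 false x Kx; have := q2 true x Kx.
  rewrite !addn0 !addn1 !prednK // /a => -> -> -> ->; lia.
have pin z : pi z != z by have [h1 _] := hpi z; apply: contraNneq h1 => ->.
have ev := even_involution piK pin ha.
have sumX : (\sum_z a z = \sum_e \sum_(i < ncr e) (mu x e i + mu x e i.+1))%N.
  rewrite (partition_big xe predT) //=; apply: eq_bigr => e _.
  have [m0|m0] := posnP (ncr e).
    by rewrite m0 big_ord0 big1 // => z /eqP ze; have := xim z; rewrite ze m0.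
  rewrite [RHS](eq_bigr (fun i : 'I_(ncr e) => (mu x e i + mu x e i.+1)%N)) //.
  have -> : (\sum_(i < ncr e) (mu x e i + mu x e i.+1) = \sum_(i < (ncr e).-1.+1) (mu x e i + mu x e i.+1))%N.
    by rewrite prednK.
  rewrite (partition_big (fun z => inord (xi z).-1 : 'I_(ncr e).-1.+1) predT) //=.
  apply: eq_bigr => i _; have im : (i.+1 <= ncr e)%N by have := ltn_ord i; lia.
  have [z0 [z1 z2]] := Xex e i.+1 (ltn0Sn _) im.
  rewrite (big_pred1 z0) /a ?z1 ?z2 // => z; apply/andP/eqP => [[/eqP ze /eqP zi]|->].
    have him : ((val z).2 < ncr e)%N by rewrite -ze; exact: (valP z).
    apply: Xeq; rewrite ?z1 ?z2 // -zi /xi.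
    by rewrite inordK ?prednK.
  split; first by rewrite z1.
  apply/eqP/val_inj => /=.
  have -> : nat_of_ord (sval z0).2 = i by case: z2.
  by rewrite inordK.
(* A segment is counted once for each of its ends that is a crossing, hence [2 - real_ends] times;
   modulo 2 only the segments with one such end remain. *)
have sumE : (\sum_s mult sarc x s * (2 - real_ends s) = \sum_e \sum_(i < ncr e) (mu x e i + mu x e i.+1))%N.
  rewrite sum_seg; apply: eq_bigr => e _.
  have key i : (i <= ncr e)%N -> (mult sarc x (sgf e i) * (2 - real_ends (sgf e i)) = mu x e i * (2 - ((i == 0) + (i == ncr e))))%N.
    by move=> im; have [h1 h2] := sgfP im; rewrite /mu /real_ends h1 h2.
  rewrite (eq_bigr (fun i : 'I_(ncr e).+1 => mu x e i * (2 - ((i == 0 :> nat) + (i == ncr e :> nat))))%N); last first.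
    by move=> i _; apply: key; rewrite -ltnS.
  have := ncr_le2 e; case: (ncr e) => [|[|[|//]]] _; rewrite !big_ord_recr !big_ord0 /=; lia.
have : ~~ odd (\sum_s mult sarc x s * (2 - real_ends s))%N by rewrite sumE -sumX.
have -> : (\sum_s mult sarc x s * (2 - real_ends s) = 2 * mult_deg x 0 + mult_deg x 1)%N.
  rewrite /mult_deg !big_distrr /= (bigID (fun s => real_ends s == 0%N)) /=; congr (_ + _)%N.
    by apply: eq_bigr => s /eqP ->; rewrite mulnC.
  rewrite (bigID (fun s => real_ends s == 1%N)) /= [X in (_ + X)%N]big1 ?addn0.
    apply: eq_big => [s|s /andP[_ /eqP ->]]; last by rewrite muln1.
    by case: (real_ends s) => [|[|]].
  by move=> s /andP[r0 r1]; have := real_ends_le2 s; move: r0 r1; case: (real_ends s) => [|[|[|]]] //; rewrite muln0.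
by rewrite oddD oddM.
Qed.

End Faces.

Lemma le12 k : k = 1%N \/ k = 2%N -> (0 < k)%N /\ (k <= 2)%N. Proof. by case=> ->. Qed.
Lemma flip12 k : k = 1%N \/ k = 2%N -> (3 - k)%N = 1%N \/ (3 - k)%N = 2%N.
Proof. by case=> ->; [right|left]. Qed.
Lemma dich12 k r : k = 1%N \/ k = 2%N -> r = 1%N \/ r = 2%N -> r = k \/ r = (3 - k)%N.
Proof. by case=> -> [] ->; [left|right|right|left]. Qed.
Lemma flip_neq k : (3 - k)%N = k -> False. Proof. lia. Qed.
Lemma cover12 k r : k = 1%N \/ k = 2%N -> r = 1%N \/ r = 2%N -> k <> r ->
  (1%N = k \/ 1%N = r) /\ (2%N = k \/ 2%N = r).
Proof. by case=> -> [] -> // _; split; [left|right|right|left]. Qed.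
Lemma three_cases (d a : nat) : (d <= a)%N -> (a <= d.+2)%N -> a = d \/ a = d.+1 \/ a = d.+2.
Proof. lia. Qed.
Lemma four_cases i a : i = 1%N \/ i = 2%N -> (a <= 3)%N -> a = 0%N \/ a = 3%N \/ a = i \/ a = (3 - i)%N.
Proof. by move=> iE; have := iE; case=> ->; lia. Qed.

(** * Small faces and their neighbours across middle segments *)

Section Cells.
Variable R : realType.
Local Notation P2 := (R * R)%type.
Local Notation pt := (R * R * R)%type.
Variables (V E : finType) (ends : E -> V * V) (D : drawing R V E) (o : pt).
Hypothesis isD : is_drawing ends D.
Hypotheses (so : sphere o) (ov : forall v, o <> pos D v) (oe : forall e t, I01P t -> o <> darc D e t).
Variable c : E -> seq R.
Hypotheses (c_sorted : forall e, sorted <%R (c e)) (c_size : forall e, (size (c e) <= 2)%N)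
  (cP : forall e t, t \in c e <-> crosses D o e t).
Variable v0 : V.
Hypotheses (hconn : mg_connected ends) (hV : (1 < #|V|)%N) (nh : non_homotopic D) (bigE : (3 < #|E|)%N).
Local Notation ncr := (ncr c).
Local Notation bpt := (bpt D o c).
Local Notation sarc := (@sarc R V E D o c).
Local Notation seg := (seg c).
Local Notation K := (Kset sarc [set: seg]%SET).
Local Notation ssrc := (@ssrc R V E D o c v0).
Local Notation stgt := (@stgt R V E D o c v0).
Local Notation npos := (@npos R V E D o c).
Let G : plane_graph ssrc stgt npos sarc := planarization isD so ov oe c_sorted cP v0.
Implicit Types (x y : P2) (e f g h : E) (s t u : seg).

Local Notation sgf := (@sgf R E c c_size bigE).
Local Notation sgfP := (sgfP c_size bigE).
Local Notation sgf_eq := (sgf_eq c_size bigE).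
Local Notation mu := (@mu R V E D o c c_size bigE).
Local Notation touches := (touches sarc).
Local Notation bptI := (bptI isD so oe c_sorted cP).
Local Notation bpt3 := (bpt3 isD so ov oe cP).
Local Notation npos_src := (npos_src o isD v0).
Local Notation npos_tgt := (npos_tgt o isD v0).
Local Notation run := (@run R E c).
Local Notation touches_mu := (touches_mu D o c_size bigE).
Local Notation supp := (supp D o c).
Local Notation partner := (partner cP).
Local Notation nbr1 := (nbr1 isD so ov oe c_sorted cP v0 hV).
Local Notation nbr2 := (nbr2 isD so ov oe c_sorted cP v0 hV).
Local Notation lens e f i j k l T Ps p := (@no_lens R V E ends D o isD so ov oe c c_sorted c_size cP v0 hconn hV e f i j k l T Ps p nh).


Lemma mu_touches x e i : (i <= ncr e)%N -> (0 < mu x e i)%N <-> touches x (sgf e i).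
Proof. by move=> im; rewrite touches_mu; have [-> ->] := sgfP im. Qed.

Lemma card_seg_gt3 : (3 < #|{: seg}|)%N.
Proof.
apply: leq_trans bigE _; rewrite -(card_imset (f := fun e => sgf e 0) predT) ?max_card //.
move=> e f h; have [h1 _] := sgfP (leq0n (ncr e)); have [h2 _] := sgfP (leq0n (ncr f)).
by rewrite -h1 -h2 h.
Qed.

(** By [touches_nonsep] the set [C] would be the whole graph, which has more than three segments. *)
Lemma supp_nonsep x (C : {set seg}) : ~ K x -> (forall s, touches x s -> s \in C) ->
  nonsep sarc C -> (#|C| <= 3)%N -> False.
Proof.
move=> Kx xC nC c3.
have all := touches_nonsep G (node_incident isD c_size v0 hconn hV) Kx xC nC.
have := card_seg_gt3; rewrite ltnNge => /negP; apply; apply: leq_trans c3.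
by rewrite -cardsT; apply: subset_leq_card; apply/fintype.subsetP => s _; exact: all.
Qed.

Lemma nonsep1 s : nonsep sarc [set s]%SET.
Proof.
rewrite -(finset.setU0 [set s]%SET).
apply: (nonsep_attach G (v := ssrc s) (nonsep0 G)); rewrite ?inE //; first by left.
by move=> s'; rewrite inE.
Qed.

Lemma ssrc_neq_tgt s : ssrc s <> stgt s.
Proof. by move=> h; apply: (src_neq_tgt G (s := s)); rewrite h. Qed.

Lemma ssrc_eq s t : ssrc s = ssrc t <-> bpt (se s) (si s) = bpt (se t) (si t).
Proof. by rewrite -!npos_src; split=> [->//|/(npos_inj (D := D))]. Qed.
Lemma stgt_eq s t : stgt s = stgt t <-> bpt (se s) (si s).+1 = bpt (se t) (si t).+1.
Proof. by rewrite -!npos_tgt; split=> [->//|/(npos_inj (D := D))]. Qed.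
Lemma ssrc_tgt_eq s t : ssrc s = stgt t <-> bpt (se s) (si s) = bpt (se t) (si t).+1.
Proof. by rewrite -npos_src -npos_tgt; split=> [->//|/(npos_inj (D := D))]. Qed.

(** If [s'] has an end off [s], the two segments separate nothing. Otherwise they share both ends,
    belong to different edges and bound a lens. *)
Lemma supp2 x s s' : ~ K x -> (forall t, touches x t -> t = s \/ t = s') -> False.
Proof.
move=> Kx xs.
have xC t : touches x t -> t \in (s' |: [set s])%SET.
  by move=> /xs [->|->]; rewrite !inE eqxx ?orbT.
have c2 : (#|(s' |: [set s])%SET| <= 3)%N by rewrite cardsU1 cards1; case: (_ \notin _).
have ns v : (ssrc s' = v \/ stgt s' = v) -> ssrc s <> v -> stgt s <> v -> False.
  move=> v' v1 v2; apply: (supp_nonsep Kx xC) => //.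
  case: (eqVneq s' s) => [->|ss]; first by rewrite finset.setUid; exact: nonsep1.
  apply: (nonsep_attach G (v := v)) => //; first exact: nonsep1.
    by rewrite inE.
  by move=> t; rewrite inE => /eqP ->.
case: (eqVneq s' s) => [ss|ss].
  by apply: (supp_nonsep Kx xC) => //; rewrite ss finset.setUid; exact: nonsep1.
have m1 : ssrc s' = ssrc s \/ ssrc s' = stgt s.
  apply: contrapT => hn; apply: (ns (ssrc s')); [by left| |] => e; apply: hn; [left|right]; by rewrite e.
have m2 : stgt s' = ssrc s \/ stgt s' = stgt s.
  apply: contrapT => hn; apply: (ns (stgt s')); [by right| |] => e; apply: hn; [left|right]; by rewrite e.
have n' := @ssrc_neq_tgt s'.
have hends : (ssrc s = ssrc s' /\ stgt s = stgt s') \/ (ssrc s = stgt s' /\ ssrc s' = stgt s).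
  by case: m1 m2 => h1 [h2|h2]; [case: n'; rewrite h1 h2|left|right|case: n'; rewrite h1 h2].
have l := si_le s; have l' := si_le s'.
have ee : se s != se s'.
  apply/eqP => ee; case: hends => -[].
    move=> /ssrc_eq h1 _; rewrite ee in h1 l; move/eqP: ss; apply.
    by apply: seg_eq => //; apply/esym/(bptI _ _ h1); lia.
  move=> /ssrc_tgt_eq h1 /ssrc_tgt_eq h2; rewrite ee in h1 h2 l.
  have e1 := bptI _ _ h1; have e2 := bptI _ _ h2; lia.
apply: (lens (se s) (se s') (si s) (si s).+1 (si s') (si s').+1 finset.set0 (fun p => p = x) x ee) => //.
- case: hends => -[h1 h2]; [left|right].
    by split; [exact/ssrc_eq|exact/stgt_eq].
  by split; [exact/ssrc_tgt_eq|exact/esym/ssrc_tgt_eq].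
- by move=> a b /andP[a1 a2] _ _; lia.
- by move=> p ->.
- move=> p t -> /xs [->|->]; left; rewrite !inE !eqxx !leqnn ?ltnSn ?orbT //.
- by move=> t; rewrite inE.
- by move=> t q; rewrite inE.
Qed.

Lemma supp_gt2 x : ~ K x -> (2 < #|supp x|)%N.
Proof.
move=> Kx; rewrite ltnNge; apply/negP => c2.
have sin t : touches x t -> t \in supp x.
  by rewrite inE => /mult_gt0.
have [s0 _] := seg_ex0 c_size bigE.
apply: (supp2 (s := nth s0 (enum (supp x)) 0) (s' := nth s0 (enum (supp x)) 1) Kx) => t /sin ts.
have : (index t (enum (supp x)) < 2)%N.
  by apply: leq_trans c2; rewrite cardE index_mem mem_enum.
have {}ts : t \in enum (supp x) by rewrite mem_enum.
move: (nth_index s0 ts); case: (index _ _) => [|[|//]] <- _; by [left|right].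
Qed.

(* [d] selects an end of e: false the source, true the target. *)
Definition end_seg e (d : bool) := if d then ncr e else 0%N.
Definition end_crossing e (d : bool) := if d then ncr e else 1%N.
Definition end_real e (d : bool) := if d then (ncr e).+1 else 0%N.

(* A cell bounded by the middle segment of f and by end segments of e and g that
   cross f and have a common vertex. *)
Record cellV y f p q e g i j (d dd : bool) : Prop := {
  v_f : ncr f = 2%N;
  v_pq : (p = 1%N /\ q = 2%N) \/ (p = 2%N /\ q = 1%N);
  v_ef : e != f; v_gf : g != f; v_eg : e != g;
  v_e : (0 < ncr e)%N; v_g : (0 < ncr g)%N;
  v_i : i = end_crossing e d; v_j : j = end_crossing g dd;
  v_fp : bpt f p = bpt e i; v_fq : bpt f q = bpt g j;
  v_r : bpt e (end_real e d) = bpt g (end_real g dd);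
  v_t : (0 < mu y f 1)%N;
  v_s : forall s, touches y s -> [\/ se s = f /\ si s = 1%N, se s = e /\ si s = end_seg e d | se s = g /\ si s = end_seg g dd]
}.

Definition typeV y f := exists p q e g i j d dd, cellV y f p q e g i j d dd.

Lemma cellV_sym y f p q e g i j d dd : cellV y f p q e g i j d dd -> cellV y f q p g e j i dd d.
Proof.
case=> h1 h2 h3 h4 h5 h6 h7 h8 h9 h10 h11 h12 h13 h14; split=> //; first by tauto.
  by rewrite eq_sym.
by move=> s /h14 [h|h|h]; [apply: Or31|apply: Or33|apply: Or32].
Qed.

Lemma ec_bd e d : (0 < ncr e)%N -> (0 < end_crossing e d)%N /\ (end_crossing e d <= ncr e)%N.
Proof. by rewrite /end_crossing; case: d. Qed.

(** The cell is symmetric in [e] and [g], so either crossing of [f] can be put first. *)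
Lemma cellV_at y f p q e g i j d dd l : cellV y f p q e g i j d dd -> l = 1%N \/ l = 2%N ->
  exists q' e' g' i' j' d' dd', cellV y f l q' e' g' i' j' d' dd'.
Proof.
move=> h lE; case: (eqVneq l p) => [->|lp]; first by exists q, e, g, i, j, d, dd.
have -> : l = q by case: (v_pq h) lE lp => -[-> ->] [->|->].
by exists p, g, e, j, i, dd, d; exact: cellV_sym.
Qed.

Lemma real_ends_cases s : [\/ real_ends s = 0%N /\ (si s = 1%N /\ ncr (se s) = 2%N),
   real_ends s = 1%N /\ (0 < ncr (se s))%N /\ (exists d, si s = end_seg (se s) d) | real_ends s = 2%N /\ ncr (se s) = 0%N].
Proof.
have := si_le s; have := ncr_le2 c_size (se s); rewrite /real_ends /end_seg.
case: (ncr (se s)) => [|[|[|//]]] _; case: (si s) => [|[|[|//]]] // _ /=.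
- by apply: Or33.
- by apply: Or32; split=> //; split=> //; exists false.
- by apply: Or32; split=> //; split=> //; exists true.
- by apply: Or32; split=> //; split=> //; exists false.
- by apply: Or31.
- by apply: Or32; split=> //; split=> //; exists true.
Qed.

Lemma es_inj e d d' : (0 < ncr e)%N -> end_seg e d = end_seg e d' -> d = d'.
Proof. by case: d d' => [] [] //=; rewrite /end_seg; lia. Qed.

Lemma real_end_neq e d f i : (0 < i)%N -> (i <= ncr f)%N -> bpt e (end_real e d) <> bpt f i.
Proof.
move=> i0 im h; have [t0 t1] := c_bd cP (bp_mid i0 im).
have := parc_vpos isD so ov oe (e := f) t0 t1; rewrite /end_real in h; case: d h => h.
  by move/(_ (ends e).2); apply; rewrite -(parc1 o isD) -(bp_last c e).
by move/(_ (ends e).1); apply; rewrite -(parc0 o isD) -(bp0 c e).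
Qed.

Lemma real_node e d : exists v : node D o c, npos v = bpt e (end_real e d) /\
  (ssrc (sgf e (end_seg e d)) = v \/ stgt (sgf e (end_seg e d)) = v).
Proof.
have [h1 h2] : se (sgf e (end_seg e d)) = e /\ si (sgf e (end_seg e d)) = end_seg e d by apply: sgfP; rewrite /end_seg; case: d.
case: d h1 h2 => h1 h2; [exists (stgt (sgf e (end_seg e true)))|exists (ssrc (sgf e (end_seg e false)))].
  by split; [rewrite npos_tgt h1 h2|right].
by split; [rewrite npos_src h1 h2|left].
Qed.

Lemma incident_pos s v : ssrc s = v \/ stgt s = v ->
  npos v = bpt (se s) (si s) \/ npos v = bpt (se s) (si s).+1.
Proof. by case=> <-; rewrite ?npos_src ?npos_tgt; [left|right]. Qed.

(** At least three sides, an even second number, and [2 a + 3 b + 4 k <= 9] leave four solutions, of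
    weights 8, 6, 8 and 8. *)
Lemma small_cases x : ~ K x -> (weight D o c x <= 9)%N ->
  [\/ mult_deg D o c x 0 = 1%N /\ mult_deg D o c x 1 = 2%N /\ mult_deg D o c x 2 = 0%N,
      mult_deg D o c x 0 = 3%N /\ mult_deg D o c x 1 = 0%N /\ mult_deg D o c x 2 = 0%N,
      mult_deg D o c x 0 = 4%N /\ mult_deg D o c x 1 = 0%N /\ mult_deg D o c x 2 = 0%N |
      mult_deg D o c x 0 = 2%N /\ mult_deg D o c x 1 = 0%N /\ mult_deg D o c x 2 = 1%N].
Proof.
move=> Kx; have := even_mult1 isD so ov oe c_sorted c_size cP v0 hV bigE Kx.
have := leq_trans (supp_gt2 Kx) (card_supp D o c x); rewrite weightE.
move: (mult_deg _ _ _ _ 0) (mult_deg _ _ _ _ 1) (mult_deg _ _ _ _ 2) => a b k.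
case: b => [|[|[|b]]] //= h1 h2 h3; last by lia.
  case: k h1 h3 => [|[|k]] h1 h3; last by lia.
    have [->|->] : a = 3%N \/ a = 4%N by lia.
      by apply: Or42.
    by apply: Or43.
  by apply: Or44; split=> //; lia.
by apply: Or41; split=> //; lia.
Qed.

Lemma real_ends_mid s : real_ends s = 0%N -> si s = 1%N /\ ncr (se s) = 2%N.
Proof. by case: (real_ends_cases s) => -[-> h]. Qed.

Lemma mult_le_deg x s k : real_ends s = k -> (mult sarc x s <= mult_deg D o c x k)%N.
Proof. by move=> /eqP h; rewrite /mult_deg (bigD1 s) //= leq_addr. Qed.

Lemma mult2_le_deg x s t k : real_ends s = k -> real_ends t = k -> s != t -> (mult sarc x s + mult sarc x t <= mult_deg D o c x k)%N.
Proof.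
move=> /eqP h /eqP h' st; rewrite /mult_deg (bigD1 s) //= leq_add2l (bigD1 t) //= ?leq_addr //.
by rewrite h' eq_sym.
Qed.

(** At each crossing of the middle side the boundary goes on along another edge; as there is only
    one middle side and no uncrossed one, it does so along an end segment. The three sides exhaust
    the support, and if their outer ends differed they would form a path, which separates
    nothing. *)
Lemma cellV_small x : ~ K x -> mult_deg D o c x 0 = 1%N -> mult_deg D o c x 1 = 2%N -> mult_deg D o c x 2 = 0%N ->
  exists f, typeV x f.
Proof.
move=> Kx n0 n1 n2.
have [t rt xt] : exists2 t, real_ends t = 0%N & (0 < mult sarc x t)%N.
  apply: contrapT => hn; have : mult_deg D o c x 0 = 0%N; last by rewrite n0.
  rewrite /mult_deg big1 // => t /eqP rt; apply/eqP; rewrite -leqn0 leqNgt; apply/negP => xt.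
  by apply: hn; exists t.
have [t1 f2] := real_ends_mid rt; set f := se t in f2.
have tE : t = sgf f 1 by rewrite -t1 sgf_eq.
have xf : (0 < mu x f 1)%N by rewrite muE -tE.
have end_at p q : p = 1%N \/ p = 2%N -> (p.-1 + q)%N = 1%N -> (q <= 1)%N ->
    exists e i d, [/\ e != f, (0 < ncr e)%N, i = end_crossing e d, bpt f p = bpt e i &
      touches x (sgf e (end_seg e d))].
  move=> hp pq q1.
  have p0 : (0 < p)%N by lia.
  have pm : (p <= ncr f)%N by rewrite f2; lia.
  have [e [i [ef i0 im hpi]]] := partner p0 pm.
  have fe : f != e by rewrite eq_sym.
  have [b hb] : exists b : bool, (0 < mu x e (i.-1 + b))%N.
    apply: (nbr1 (a := q == 1%N) fe p0 pm i0 im hpi Kx).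
    by have -> : (p.-1 + (q == 1%N))%N = 1%N by case: q pq q1 => [|[|]] //=; lia.
  have jm : (i.-1 + b <= ncr e)%N by case: (b); lia.
  set s := sgf e (i.-1 + b) in hb; have [s1 s2] := sgfP jm.
  have ts : touches x s by apply/(mu_touches x jm).
  have ms : (0 < mult sarc x s)%N by apply/mult_gt0.
  have st : s != t by apply: contraNneq ef => st; rewrite -s1 -/s st.
  case: (real_ends_cases s) => -[rs].
  - by have := mult2_le_deg x rs rt st; rewrite n0; lia.
  - rewrite s1 s2 => -[e0 [d hd]]; exists e, i, d; split=> //; last by rewrite -hd.
    by rewrite /end_crossing; move: hd; rewrite /end_seg; case: (d); case: (b); lia.
  - by have := mult_le_deg x rs; rewrite n2; lia.
have [e [i [d [ef e0 iE hi te]]]] := end_at 1%N 1%N (or_introl erefl) erefl isT.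
have [g [j [dd [gf g0 jE hj tg]]]] := end_at 2%N 0%N (or_intror erefl) erefl isT.
have esm h b : (end_seg h b <= ncr h)%N by rewrite /end_seg; case: b.
have [se1 si1] := sgfP (esm e d); have [se2 si2] := sgfP (esm g dd).
set s := sgf e (end_seg e d) in te se1 si1; set u := sgf g (end_seg g dd) in tg se2 si2.
have st : s != t by apply: contraNneq ef => st; rewrite -se1 st.
have ut : u != t by apply: contraNneq gf => hut; rewrite -se2 hut.
have su : s != u.
  apply/eqP => su; have eg : e = g by rewrite -se1 su.
  have dE : end_seg e d = end_seg g dd by rewrite -si1 -si2 su.
  rewrite -eg in dE jE hj; have {}dE := es_inj e0 dE.
  have ff : bpt f 1 = bpt f 2 by rewrite hi hj iE jE dE.
  have := bptI (e := f) _ _ ff; lia.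
have xsu (y : seg) : touches x y -> [\/ y = t, y = s | y = u].
  move=> ty; have suppE : [set t; s; u]%SET = supp x.
    apply/eqP; rewrite eqEcard; apply/andP; split.
      apply/fintype.subsetP => z; rewrite !inE => /orP[/orP[]|] /eqP -> //; exact/mult_gt0.
    have := card_supp D o c x; rewrite n0 n1 n2 => h; apply: leq_trans h _.
    by rewrite finset.setUC cardsU1 cards2 !inE negb_or ut eq_sym su eq_sym st.
  have : y \in supp x by rewrite inE; apply/mult_gt0.
  rewrite -suppE !inE => /orP[/orP[]|] /eqP ->; by [apply: Or31|apply: Or32|apply: Or33].
have [vs [vs1 vs2]] := real_node e d; have [vu [vu1 vu2]] := real_node g dd.
rewrite -/s in vs2; rewrite -/u in vu2.
have t_off h b v : npos v = bpt h (end_real h b) -> ssrc t <> v /\ stgt t <> v.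
  move=> hv; have ne k : (0 < k <= 2)%N -> npos v <> bpt f k.
    by case/andP=> k0 k2; rewrite hv; apply: real_end_neq; rewrite ?f2.
  split=> tv; first by apply: (ne 1%N isT); rewrite -tv npos_src t1.
  by apply: (ne 2%N isT); rewrite -tv npos_tgt t1.
have r_eq : bpt e (end_real e d) = bpt g (end_real g dd).
  apply: contrapT => ne; apply: (supp_nonsep (C := (u |: (s |: [set t]))%SET) Kx).
  - by move=> y /xsu [] ->; rewrite !inE eqxx ?orbT.
  - apply: (nonsep_attach G (v := vu)) => //.
    + apply: (nonsep_attach G (v := vs)) => //; first exact: nonsep1.
        by rewrite inE.
      by move=> y; rewrite inE => /eqP ->; exact: t_off vs1.
    + by rewrite !inE negb_or eq_sym su ut.
    + move=> y; rewrite !inE => /orP[] /eqP ->; last exact: t_off vu1.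
      suff hs w : (ssrc s = w \/ stgt s = w) -> w <> vu.
        by split; [apply: hs; left|apply: hs; right].
      move=> /incident_pos hw wu; rewrite wu vu1 se1 si1 in hw.
      have ne' k : (0 < k <= ncr e)%N -> bpt g (end_real g dd) <> bpt e k.
        by case/andP=> k0 km; apply: real_end_neq.
      case: (d) hw ne => /=; rewrite /end_seg /end_real => -[hw|hw] ne.
      * by apply: (ne' (ncr e)) => //; rewrite e0 leqnn.
      * by apply: ne.
      * by apply: ne.
      * by apply: (ne' 1%N).
  - by rewrite !cardsU1 cards1; case: (_ \notin _); case: (_ \notin _).
have eg : e != g.
  apply/eqP => eg; move: su r_eq; rewrite /s /u -eg.
  case: (d) (dd) => -[] //=; rewrite /end_real ?eqxx // => _ h; have := bptI (e := e) _ _ h; lia.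
exists f, 1%N, 2%N, e, g, i, j, d, dd; split=> //; first by left.
move=> y /xsu [] ->; [apply: Or31|apply: Or32|apply: Or33]; rewrite ?t1 //.
Qed.

Lemma mid_of x e i : mult_deg D o c x 1 = 0%N -> (i <= ncr e)%N -> (0 < ncr e)%N -> (0 < mu x e i)%N ->
  ncr e = 2%N /\ i = 1%N.
Proof.
move=> n1 im e0 xe; have [h1 h2] := sgfP im.
case: (real_ends_cases (sgf e i)); rewrite h1 => -[r].
- by rewrite h2; case=> -> ->.
- by have := mult_le_deg x r; rewrite n1 leqNgt xe.
- by move=> h; rewrite h in e0.
Qed.

Definition middles x : {set E} := [set f | (ncr f == 2%N) && (0 < mu x f 1)%N]%SET.

Lemma card_middles x : (#|supp x| <= #|middles x| + mult_deg D o c x 1 + mult_deg D o c x 2)%N /\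
  (#|middles x| <= mult_deg D o c x 0)%N.
Proof.
pose S0 := [set s in supp x | real_ends s == 0%N]%SET.
have -> : #|middles x| = #|S0|.
  have <- : [set se s | s in S0]%SET = middles x.
    apply/finset.setP => f; rewrite inE; apply/imsetP/andP => [[s]|[/eqP f2 xf]].
      rewrite !inE => /andP[xs /eqP /real_ends_mid [s1 s2]] ->.
      by have hs := sgf_eq s; rewrite s1 in hs; rewrite s2 muE hs.
    have [h1 h2] : se (sgf f 1) = f /\ si (sgf f 1) = 1%N by apply: sgfP; rewrite f2.
    exists (sgf f 1) => //; rewrite !inE /real_ends h1 h2 f2 /= eqxx andbT; exact: xf.
  apply: card_in_imset => s t; rewrite !inE => /andP[_ /eqP /real_ends_mid [s1 _]] /andP[_ /eqP /real_ends_mid [t1 _]] st.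
  by apply: seg_eq => //; rewrite s1 t1.
have bnd (P : pred seg) : (#|[set s in supp x | P s]%SET| <= \sum_(s | P s) mult sarc x s)%N.
  rewrite -sum1_card [leqRHS](bigID (fun s => s \in supp x)) /=; apply: leq_trans (leq_addr _ _).
  rewrite [leqLHS](eq_bigl (fun s => P s && (s \in supp x))) => [|s]; last by rewrite !inE andbC.
  by apply: leq_sum => s /andP[_]; rewrite inE.
split; last exact: bnd.
rewrite -(cardsID [set s | real_ends s == 0%N]%SET) -addnA.
have -> : (supp x :&: [set s | real_ends s == 0%N])%SET = S0 by apply/finset.setP => s; rewrite !inE.
rewrite leq_add2l.
have -> : (supp x :\: [set s | real_ends s == 0%N])%SET = [set s in supp x | real_ends s != 0%N]%SET.
  by apply/finset.setP => s; rewrite !inE andbC.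
apply: leq_trans (bnd _) _; rewrite /mult_deg (bigID (fun s => real_ends s == 1%N)) /=.
apply: leq_add; apply: eq_leq; apply: eq_bigl => s.
  by case: (real_ends s) => [|[|]].
by have := real_ends_le2 s; case: (real_ends s) => [|[|[|]]].
Qed.

Lemma cellV_cross y f p q e g i j d dd : cellV y f p q e g i j d dd ->
  [/\ (0 < p)%N, (p <= ncr f)%N, (0 < i)%N & (i <= ncr e)%N].
Proof.
by case=> h1 h2 _ _ _ h3 _ -> *; have [? ?] := ec_bd d h3; split=> //; case: h2 => -[-> ?]; rewrite ?h1.
Qed.

(** [b] tells on which side of the crossing the end segment of the cell lies; by [nbr2] the face
    across [f] touches the segment of [e] on the other side. *)
Lemma cellV_other y x f p q e g i j d dd : ~ K y -> ~ K x -> ~ linked (~` K) y x ->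
  cellV y f p q e g i j d dd -> (0 < mu x f 1)%N -> exists b : bool,
  [/\ end_seg e d = (i.-1 + b)%N & (0 < mu x e (i.-1 + ~~ b))%N].
Proof.
move=> Ky Kx nl h xf; have [p0 pm i0 im] := cellV_cross h.
have fe : f != e by rewrite eq_sym; exact: v_ef h.
have pa : (p.-1 + (p == 1%N))%N = 1%N by case: (v_pq h) => -[-> _].
have [b [yb xb]] : exists b : bool, (0 < mu y e (i.-1 + b))%N /\ (0 < mu x e (i.-1 + ~~ b))%N.
  by apply: (nbr2 (a := p == 1%N) fe p0 pm i0 im (v_fp h) Ky Kx nl); rewrite pa // (v_t h).
exists b; split=> //.
have jm : (i.-1 + b <= ncr e)%N by case: (b); lia.
have [s1 s2] := sgfP jm.
move/(mu_touches y jm): yb => /(v_s h); rewrite s1 s2 => -[[]|[]|[]] //.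
  by move=> ef; case/eqP: (v_ef h).
by move=> eg; case/eqP: (v_eg h).
Qed.

Lemma Kset_bpt e i j k : (i <= k <= j)%N -> (i < j)%N -> (j <= (ncr e).+1)%N ->
  Kset sarc (run e i j) (bpt e k).
Proof.
case/andP=> ik kj ij jm; apply/(Kset_run c_sorted c_size cP _ ij jm).
by exists (bp c e k); split=> //; apply: (bp_le c_sorted cP) => //; lia.
Qed.

Lemma Kset_runU e f i j k l x : Kset sarc (run e i j) x \/ Kset sarc (run f k l) x ->
  Kset sarc (run e i j :|: run f k l)%SET x.
Proof. by case; apply: Kset_sub; [exact: finset.subsetUl|exact: finset.subsetUr]. Qed.

Lemma touches_between p q x s : ~ K p -> ~ K q -> ~ linked (~` K) p q -> touches p s -> touches q s ->
  ~ K x -> touches x s -> linked (~` K) p x \/ linked (~` K) q x.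
Proof.
move=> Kp Kq nl ps qs Kx xs.
by case: (touches_two G Kp Kq Kx ps qs xs) => // h; [left|right].
Qed.

Lemma partner_unique e f g i j k : e != f -> e != g -> (0 < i)%N -> (i <= ncr e)%N ->
  (j <= ncr f)%N -> (k <= ncr g)%N -> bpt e i = bpt f j -> bpt e i = bpt g k -> f = g /\ j = k.
Proof.
move=> ef eg i0 im jm km h1 h2; have fg : f = g.
  apply/eqP/negPn/negP => fg.
  by apply: (bpt3 ef fg eg i0 im _ _ h1 (etrans (esym h1) h2)); exact: leqW.
by rewrite -fg in km h2 *; split=> //; apply: (bptI _ _ (etrans (esym h1) h2)); exact: leqW.
Qed.

Lemma mid_ends f : ncr f = 2%N -> npos (ssrc (sgf f 1)) = bpt f 1 /\ npos (stgt (sgf f 1)) = bpt f 2.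
Proof.
move=> f2; have [h1 h2] : se (sgf f 1) = f /\ si (sgf f 1) = 1%N by apply: sgfP; rewrite f2.
by rewrite npos_src npos_tgt h1 h2.
Qed.

Lemma touches_mid x f : ncr f = 2%N -> (0 < mu x f 1)%N -> touches x (sgf f 1).
Proof. by move=> f2 h; apply/mu_touches; rewrite ?f2. Qed.

Lemma mid_eq s f : ncr f = 2%N -> se s = f -> si s = 1%N -> s = sgf f 1.
Proof. by move=> f2 h1 h2; have := sgf_eq s; rewrite h1 h2. Qed.

(** Two such cells on either side of the middle segment of [f] use the same edges [e] and [g], with
    opposite end segments. So [e] and [g] have no other crossing and share both ends: they are
    parallel edges, and the two cells with the middle segment of [f] fill their lens. *)
Lemma cellV_linked y y' f : ~ K y -> ~ K y' -> typeV y f -> typeV y' f -> linked (~` K) y y'.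
Proof.
move=> Ky Ky' [p0 [q0 [e0 [g0 [i0 [j0 [d0 [dd0 h0]]]]]]]] [p1 [q1 [e1 [g1 [i1 [j1 [d1 [dd1 h1]]]]]]]].
apply: contrapT => nl.
have [q [e [g [i [j [d [dd h]]]]]]] := cellV_at h0 (or_introl (erefl 1%N)).
have [q' [e' [g' [i' [j' [d' [dd' h']]]]]]] := cellV_at h1 (or_introl (erefl 1%N)).
move=> {h0 h1 p0 q0 e0 g0 i0 j0 d0 dd0 p1 q1 e1 g1 i1 j1 d1 dd1}.
have q2 : q = 2%N by case: (v_pq h) => -[].
have q2' : q' = 2%N by case: (v_pq h') => -[].
subst q q'.
have [p0 pm i0 im] := cellV_cross h; have [_ _ i0' im'] := cellV_cross h'.
have hs := cellV_sym h; have hs' := cellV_sym h'.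
have [q0 qm j0 jm] := cellV_cross hs; have [_ _ j0' jm'] := cellV_cross hs'.
have fe : f != e by rewrite eq_sym (v_ef h).
have fg : f != g by rewrite eq_sym (v_ef hs).
have fe' : f != e' by rewrite eq_sym (v_ef h').
have fg' : f != g' by rewrite eq_sym (v_ef hs').
have [ee ii] := partner_unique fe fe' p0 pm im im' (v_fp h) (v_fp h').
have [gg jj] := partner_unique fg fg' q0 qm jm jm' (v_fp hs) (v_fp hs').
subst e' i' g' j'.
have other p q a b k l d1 d2 d3 d4 : cellV y f p q a b k l d1 d2 -> cellV y' f p q a b k l d3 d4 ->
    ncr a = 1%N /\ d3 = ~~ d1.
  move=> h1 h2; have [b1 [hb1 xb]] := cellV_other Ky Ky' nl h1 (v_t h2).
  have [_ _ k0 km] := cellV_cross h1.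
  have lm : (k.-1 + ~~ b1 <= ncr a)%N by case: (b1); lia.
  have [s1 s2] := sgfP lm.
  have hb2 : end_seg a d3 = (k.-1 + ~~ b1)%N.
    move/(mu_touches y' lm): xb => /(v_s h2); rewrite s1 s2 => -[[]|[]|[]] //.
      by move=> ef; case/eqP: (v_ef h2).
    by move=> eg; case/eqP: (v_eg h2).
  have dn : d3 = ~~ d1.
    case: d1 d3 hb1 hb2 {h1 h2} => [] [] // ->; case: (b1) => /=; lia.
  split=> //; have := v_i h1; rewrite {1}(v_i h2) dn /end_crossing; have := v_e h1.
  by case: (d1) => /=; lia.
have [e1 d'E] := other _ _ _ _ _ _ _ _ _ _ h h'.
have [g1 dd'E] := other _ _ _ _ _ _ _ _ _ _ hs hs'.
subst d' dd'.
have i1 : i = 1%N by lia.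
have j1 : j = 1%N by lia.
subst i j.
have f2 := v_f h; have [t1 t2] := mid_ends f2.
have [h1 h2] : se (sgf f 1) = f /\ si (sgf f 1) = 1%N by apply: sgfP; rewrite f2.
have eK k : (k <= 2)%N -> Kset sarc (run e 0 2) (bpt e k) by move=> k2; apply: Kset_bpt; rewrite ?e1.
have gK k : (k <= 2)%N -> Kset sarc (run g 0 2) (bpt g k) by move=> k2; apply: Kset_bpt; rewrite ?g1.
apply: (lens e g 0%N 2%N 0%N 2%N [set sgf f 1%N]%SET (fun z => z = y \/ z = y') y (v_eg h)) => //.
- have := v_r h; have := v_r h'; rewrite /end_real e1 g1.
  by case: (d) (dd) => [] [] /= r1 r2; [left|right|right|left].
- move=> a b /andP[_ a2] /andP[_ b2] hab.
  case: a a2 hab => [|[|[|//]]] _ hab; [by left| |by right].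
  have r : bpt f 1 = bpt g b by rewrite (v_fp h).
  by case: (bpt3 (v_ef h) fg (v_eg h) i0 im (leqW pm) _ (esym (v_fp h)) r); rewrite g1.
- by move=> z [->|->].
- have key d1 dd1 (s : seg) : [\/ se s = f /\ si s = 1%N, se s = e /\ si s = end_seg e d1 | se s = g /\ si s = end_seg g dd1] ->
      s \in (run e 0 2 :|: run g 0 2)%SET \/ s \in [set sgf f 1]%SET.
    case=> -[s1 s2]; first by right; rewrite inE (mid_eq f2 s1 s2).
      by left; rewrite !inE s1 eqxx s2 /end_seg e1; case: (d1).
    by left; rewrite !inE s1 eqxx s2 /end_seg g1; case: (dd1); rewrite orbT.
  by move=> z s [->|->] => [/(v_s h)|/(v_s h')] /key.
- move=> t; rewrite inE => /eqP ->; rewrite t1 t2 (v_fp h) (v_fq h).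
  by split; apply: Kset_runU; [left; exact: eK|right; exact: gK].
- move=> t z; rewrite inE => /eqP -> Kz zt.
  have [|] := touches_between Ky Ky' nl (touches_mid f2 (v_t h)) (touches_mid f2 (v_t h')) Kz zt.
    by exists y => //; left.
  by exists y' => //; right.
- by left.
Qed.

(** At a crossing of [f] the faces on its two sides touch consecutive segments of the other edge,
    and these cannot both be middle segments. *)
Lemma middles_linked x x' f : ~ K x -> ~ K x' -> mult_deg D o c x 1 = 0%N -> mult_deg D o c x' 1 = 0%N ->
  f \in middles x -> f \in middles x' -> linked (~` K) x x'.
Proof.
move=> Kx Kx' n1 n1'; rewrite !inE => /andP[/eqP f2 xf] /andP[_ xf'].
apply: contrapT => nl; have f0 : (1 <= ncr f)%N by rewrite f2.
have [e [i [ef i0 im hi]]] := partner (isT : (0 < 1)%N) f0; rewrite eq_sym in ef.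
have [b [hb hb']] : exists b : bool, (0 < mu x e (i.-1 + b))%N /\ (0 < mu x' e (i.-1 + ~~ b))%N.
  exact: (nbr2 (i := 1%N) (a := true) ef isT f0 i0 im hi Kx Kx' nl xf xf').
have e0 : (0 < ncr e)%N by lia.
have bm (b' : bool) : (i.-1 + b' <= ncr e)%N by case: b'; lia.
have [_ h1] := mid_of n1 (bm b) e0 hb; have [_ h2] := mid_of n1' (bm (~~ b)) e0 hb'.
by move: h1 h2; case: (b) => /=; lia.
Qed.

Lemma cellV_middle x y f p q e g i j d dd : ~ K x -> ~ K y -> ~ linked (~` K) y x ->
  mult_deg D o c x 1 = 0%N -> f \in middles x -> cellV y f p q e g i j d dd -> e \in middles x.
Proof.
move=> Kx Ky nl n1; rewrite !inE => /andP[/eqP f2 xf] h.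
have [b [_ hb]] := cellV_other Ky Kx nl h xf; have [_ _ i0 im] := cellV_cross h.
have bm : (i.-1 + ~~ b <= ncr e)%N by case: (b); lia.
by have [-> h1] := mid_of n1 bm (v_e h) hb; rewrite h1 in hb; rewrite hb.
Qed.

Lemma middles_partner x f i : ~ K x -> mult_deg D o c x 1 = 0%N -> f \in middles x -> i = 1%N \/ i = 2%N ->
  exists h k, [/\ h != f, h \in middles x, k = 1%N \/ k = 2%N & bpt f i = bpt h k].
Proof.
move=> Kx n1; rewrite !inE => /andP[/eqP f2 xf] iE.
have i0 : (0 < i)%N by lia.
have im : (i <= ncr f)%N by rewrite f2; lia.
have [h [k [hf k0 km hk]]] := partner i0 im; have fh : f != h by rewrite eq_sym.
have [b hb] : exists b : bool, (0 < mu x h (k.-1 + b))%N.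
  apply: (nbr1 (a := i == 1%N) fh i0 im k0 km hk Kx).
  by case: iE => ->.
have bm : (k.-1 + b <= ncr h)%N by case: (b); lia.
have h0 : (0 < ncr h)%N by lia.
have [h2 h1] := mid_of n1 bm h0 hb; rewrite h1 in hb.
by exists h, k; rewrite inE h2 hb; split=> //; lia.
Qed.

(** The edges [e] and [g] of the cell [y] pass on to [x] as middle segments. If they cross each
    other there, their parts from the common vertex to that crossing bound a lens filled by [x], [y]
    and the middle segment of [f]. Otherwise a fourth edge [k] crosses both and closes [x]; a cell
    with a vertex beyond [k] would use [e] and [g] again, which would then share both ends and bound
    a lens filled by three faces. *)
Lemma opposite_middle x y f : ~ K x -> ~ K y -> ~ linked (~` K) x y ->
  mult_deg D o c x 1 = 0%N -> (weight D o c x <= 9)%N -> f \in middles x -> typeV y f ->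
  #|middles x| = 4%N /\ exists2 h, h \in middles x &
    forall y', ~ K y' -> ~ linked (~` K) x y' -> typeV y' h -> False.
Proof.
move=> Kx Ky nxy n1 small fM [p0 [q0 [e0 [g0 [i0 [j0 [d0 [dd0 h0]]]]]]]].
have nyx : ~ linked (~` K) y x by move/linked_sym.
have [q [e [g [i [j [d [dd h]]]]]]] := cellV_at h0 (or_introl (erefl 1%N)).
move=> {h0 p0 q0 e0 g0 i0 j0 d0 dd0}.
have q2 : q = 2%N by case: (v_pq h) => -[].
subst q; have hs := cellV_sym h.
have eM := cellV_middle Kx Ky nyx n1 fM h; have gM := cellV_middle Kx Ky nyx n1 fM hs.
have two m : m \in middles x -> ncr m = 2%N by rewrite inE => /andP[/eqP].
have xm m : m \in middles x -> touches x (sgf m 1).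
  by rewrite inE => /andP[/eqP m2 xm]; exact: touches_mid.
have [f2 e2 g2] : [/\ ncr f = 2%N, ncr e = 2%N & ncr g = 2%N] by split; exact: two.
have ef := v_ef h; have gf := v_ef hs; have eg := v_eg h.
have fe : f != e by rewrite eq_sym.
have fg : f != g by rewrite eq_sym.
have ge : g != e by rewrite eq_sym.
have fp := v_fp h; have fq := v_fq h.
have [_ M0] := card_middles x.
have c3 : #|[set f; e; g]%SET| = 3%N.
  by rewrite finset.setUC cardsU1 cards2 !inE negb_or gf ge fe.
have s3 : ([set f; e; g] \subset middles x)%SET.
  by apply/fintype.subsetP => z; rewrite !finset.in_setU !finset.in_set1 => /orP[/orP[]|] /eqP ->.
have M3 : (3 <= #|middles x|)%N by rewrite -c3; exact: subset_leq_card.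
have [n0 n2] : (mult_deg D o c x 0 <= 4)%N /\ mult_deg D o c x 2 = 0%N.
  have := leq_trans M3 M0; case: (small_cases Kx small) => -[-> [? ->]] //.
have M4 := leq_trans M0 n0.
have xs s : touches x s -> se s \in middles x /\ s = sgf (se s) 1.
  move=> xs; have ms : (0 < mult sarc x s)%N by apply/mult_gt0.
  case: (real_ends_cases s) => -[r].
  - case=> s1 s2; have sE : s = sgf (se s) 1 by exact: mid_eq.
    by split=> //; rewrite inE s2 /= muE -sE.
  - by have := mult_le_deg x r; rewrite n1 leqNgt ms.
  - by have := mult_le_deg x r; rewrite n2 leqNgt ms.
have uq m n n' k l l' : m \in middles x -> m != n -> m != n' -> k = 1%N \/ k = 2%N ->
    n \in middles x -> n' \in middles x -> l = 1%N \/ l = 2%N -> l' = 1%N \/ l' = 2%N ->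
    bpt m k = bpt n l -> bpt m k = bpt n' l' -> n = n' /\ l = l'.
  move=> /two m2 mn mn' kE /two n_2 /two n_2' lE lE' h1 h2.
  have [k0 kk2] := le12 kE; have [_ l2] := le12 lE; have [_ l2'] := le12 lE'.
  by apply: (partner_unique mn mn' k0 _ _ _ h1 h2); rewrite ?m2 ?n_2 ?n_2'.
have iE : i = 1%N \/ i = 2%N by rewrite (v_i h) /end_crossing e2; case: (d); [right|left].
have jE : j = 1%N \/ j = 2%N by rewrite (v_j h) /end_crossing g2; case: (dd); [right|left].
pose io := (3 - i)%N; pose jo := (3 - j)%N.
have ioE : io = 1%N \/ io = 2%N by exact: flip12.
have joE : jo = 1%N \/ jo = 2%N by exact: flip12.
have l1 : 1%N = 1%N \/ 1%N = 2%N by left.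
have l2 : 2%N = 1%N \/ 2%N = 2%N by right.
have bne m k k' : m \in middles x -> k = 1%N \/ k = 2%N -> k' = 1%N \/ k' = 2%N -> bpt m k = bpt m k' -> k = k'.
  by move=> /two m2 kE kE' hh; apply: (bptI _ _ hh); rewrite m2 leqW //; [case: (le12 kE)|case: (le12 kE')].
have [k [l [ke kM lE hk]]] := middles_partner Kx n1 eM ioE.
have [k' [l' [kg kM' lE' hk']]] := middles_partner Kx n1 gM joE.
have ek : e != k by rewrite eq_sym.
have gk : g != k' by rewrite eq_sym.
have kf : k != f.
  apply/eqP => kf; subst k; case: lE => lE; subst l.
    by case: (flip_neq (bne _ _ _ eM ioE iE (etrans hk fp))).
  by have [ge' _] := uq _ _ _ _ _ _ fM fe fg l2 eM gM ioE jE (esym hk) fq; rewrite ge' eqxx in eg.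
have kf' : k' != f.
  apply/eqP => kf'; subst k'; case: lE' => lE'; subst l'.
    by have [ge' _] := uq _ _ _ _ _ _ fM fg fe l1 gM eM joE iE (esym hk') fp; rewrite ge' eqxx in ge.
  by case: (flip_neq (bne _ _ _ gM joE jE (etrans hk' fq))).
have esE a : end_seg e a = (2 * a)%N by rewrite /end_seg e2; case: a.
have gsE a : end_seg g a = (2 * a)%N by rewrite /end_seg g2; case: a.
have iD : i = d.+1 by rewrite (v_i h) /end_crossing e2; case: (d).
have jD : j = dd.+1 by rewrite (v_j h) /end_crossing g2; case: (dd).
have meet_f b : (b <= 3)%N -> bpt e i = bpt g b -> False.
  move=> b3 hb; have [i0 im] := le12 iE; rewrite -e2 in im.
  apply: (bpt3 (j := 1%N) ef fg eg i0 im _ _ (esym fp) (etrans fp hb)); by rewrite ?f2 ?g2.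
have [tf1 tf2] := mid_ends f2.
have fx := xm f fM; have fy := touches_mid f2 (v_t h).
case: (eqVneq k g) => [kg0|kg0].
  subst k; exfalso.
  have lj : l <> j.
    move=> lj; subst l.
    by have [fe' _] := uq _ _ _ _ _ _ gM gf ge jE fM eM l2 ioE (esym fq) (esym hk); rewrite fe' eqxx in fe.
  have ljo : l = jo by case: (dich12 jE lE).
  subst l.
  (* Both crossings of each of [f], [e], [g] are taken by the other two, so a fourth middle side
     would have no partner. *)
  have mE m : m \in middles x -> [\/ m = f, m = e | m = g].
    move=> mM; apply: contrapT => hn.
    have [mf me mg] : [/\ m != f, m != e & m != g].
      by split; apply/eqP => mm; apply: hn; [apply: Or31|apply: Or32|apply: Or33].
    have ME : (m |: [set f; e; g])%SET = middles x.
      apply/eqP; rewrite eqEcard; apply/andP; split.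
        by apply/fintype.subsetP => z; rewrite finset.in_setU1 => /predU1P[->//|]; exact: (fintype.subsetP s3).
      by rewrite cardsU1 c3 !finset.in_setU !finset.in_set1 (negPf mf) (negPf me) (negPf mg).
    have [m' [r [m'm m'M rE hr]]] := middles_partner Kx n1 mM l1.
    have m'E : [\/ m' = f, m' = e | m' = g].
      move: m'M; rewrite -ME finset.in_setU1 !finset.in_setU !finset.in_set1 (negPf m'm) /=.
      by case/orP=> [/orP[]|] /eqP ->; [apply: Or31|apply: Or32|apply: Or33].
    have fm : f != m by rewrite eq_sym.
    have em : e != m by rewrite eq_sym.
    have gm : g != m by rewrite eq_sym.
    case: m'E => m'E; subst m'.
    - case: rE => rE; subst r.
        by have [h1 _] := uq _ _ _ _ _ _ fM fe fm l1 eM mM iE l1 fp (esym hr); rewrite h1 eqxx in em.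
      by have [h1 _] := uq _ _ _ _ _ _ fM fg fm l2 gM mM jE l1 fq (esym hr); rewrite h1 eqxx in gm.
    - have [ri|ri] : r = i \/ r = io by exact: dich12.
        rewrite ri in hr.
        by have [h1 _] := uq _ _ _ _ _ _ eM ef em iE fM mM l1 l1 (esym fp) (esym hr); rewrite h1 eqxx in fm.
      rewrite ri in hr.
      by have [h1 _] := uq _ _ _ _ _ _ eM eg em ioE gM mM joE l1 hk (esym hr); rewrite h1 eqxx in gm.
    - have [ri|ri] : r = j \/ r = jo by exact: dich12.
        rewrite ri in hr.
        by have [h1 _] := uq _ _ _ _ _ _ gM gf gm jE fM mM l2 l1 (esym fq) (esym hr); rewrite h1 eqxx in fm.
      rewrite ri in hr.
      by have [h1 _] := uq _ _ _ _ _ _ gM ge gm joE eM mM ioE l1 (esym hk) (esym hr); rewrite h1 eqxx in em.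
  have eK a : (d <= a <= d.+2)%N -> Kset sarc (run e d d.+2) (bpt e a).
    by move=> da; apply: (Kset_bpt da); rewrite ?e2; case: (d).
  have gK a : (dd <= a <= dd.+2)%N -> Kset sarc (run g dd dd.+2) (bpt g a).
    by move=> da; apply: (Kset_bpt da); rewrite ?g2; case: (dd).
  apply: (lens e g d d.+2 dd dd.+2 [set sgf f 1%N]%SET (fun z => z = x \/ z = y) x eg) => //.
  - by rewrite e2; case: (d).
  - by rewrite g2; case: (dd).
  - have := v_r h; move: hk; rewrite /end_real e2 g2 /io /jo iD jD.
    by case: (d) (dd) => [] [] /= r1 r2; [left|right|right|left].
  - move=> a b /andP[a1 a2] /andP[_ b2] hab.
    have [->|[ai|->]] : a = d \/ a = i \/ a = d.+2 by rewrite iD; exact: three_cases.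
    + by left.
    + by case: (meet_f b); rewrite -?ai //; apply: leq_trans b2 _; case: (dd).
    + by right.
  - by move=> z [->|->].
  - move=> z s [->|->].
      case/xs => /mE[] sE ->; rewrite sE; first by right; rewrite inE.
        have [s1 s2] : se (sgf e 1) = e /\ si (sgf e 1) = 1%N by apply: sgfP; rewrite e2.
        by left; rewrite !inE s1 s2 eqxx; case: (d).
      have [s1 s2] : se (sgf g 1) = g /\ si (sgf g 1) = 1%N by apply: sgfP; rewrite g2.
      by left; rewrite !inE s1 s2 eqxx orbC; case: (dd).
    move/(v_s h) => -[[s1 s2]|[s1 s2]|[s1 s2]]; first by right; rewrite inE (mid_eq f2 s1 s2).
      by left; rewrite !inE s1 s2 esE eqxx; case: (d).
    by left; rewrite !inE s1 s2 gsE eqxx orbC; case: (dd).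
  - move=> t; rewrite inE => /eqP ->; rewrite tf1 tf2 fp fq.
    by split; apply: Kset_runU; [left; apply: eK|right; apply: gK]; rewrite ?iD ?jD !leqnSn.
  - move=> t z; rewrite inE => /eqP -> Kz zt.
    have [|] := touches_between Kx Ky nxy fx fy Kz zt; by [exists x => //; left|exists y => //; right].
  - by left.
have kfeg : k \notin [set f; e; g]%SET.
  by rewrite !finset.in_setU !finset.in_set1 (negPf kf) (negPf ke) (negPf kg0).
have c4 : #|(k |: [set f; e; g])%SET| = 4%N by rewrite cardsU1 kfeg c3.
have ME : (k |: [set f; e; g])%SET = middles x.
  apply/eqP; rewrite eqEcard c4 M4 andbT.
  by apply/fintype.subsetP => z; rewrite finset.in_setU1 => /predU1P[->//|]; exact: (fintype.subsetP s3).
split; first by rewrite -ME c4.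
have gk0 : g != k by rewrite eq_sym.
(* There are only four middle sides, and both crossings of [e] are taken, by [f] and by [k]; so the
   remaining partner of [g] is [k] too. *)
have kk : k' = k.
  move: kM'; rewrite -ME finset.in_setU1 !finset.in_setU !finset.in_set1 (negPf kf') (negPf kg) orbF /=.
  case/predU1P=> // /eqP k'e; subst k'.
  have [li|li] : l' = i \/ l' = io by exact: dich12.
    rewrite li in hk'.
    by have [h1 _] := uq _ _ _ _ _ _ eM ef eg iE fM gM l1 joE (esym fp) (esym hk'); rewrite h1 eqxx in fg.
  rewrite li in hk'.
  by have [h1 _] := uq _ _ _ _ _ _ eM ek eg ioE kM gM lE joE hk (esym hk'); rewrite h1 eqxx in kg0.
subst k'.
have ll : l <> l'.
  move=> ll; subst l'.
  by have [h1 _] := uq _ _ _ _ _ _ kM ke kg0 lE eM gM ioE joE (esym hk) (esym hk'); rewrite h1 eqxx in eg.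
exists k => // y' Ky' nxy' [p0 [q0 [e0 [g0 [i0 [j0 [d0 [dd0 h0]]]]]]]].
have [q' [e' [g' [i' [j' [d' [dd' h']]]]]]] := cellV_at h0 lE.
move=> {h0 p0 q0 e0 g0 i0 j0 d0 dd0}; have hs' := cellV_sym h'.
have q'l : q' = l' by case: (v_pq h') lE' ll => -[-> ->] [->|->].
subst q'.
have [p0 pm i0' im'] := cellV_cross h'; have [q0 qm j0' jm'] := cellV_cross hs'.
have ke' : k != e' by rewrite eq_sym (v_ef h').
have kg' : k != g' by rewrite eq_sym (v_ef hs').
have iom : (io <= ncr e)%N by rewrite e2; case: (le12 ioE).
have jom : (jo <= ncr g)%N by rewrite g2; case: (le12 joE).
have [ee ii] := partner_unique ke ke' p0 pm iom im' (esym hk) (v_fp h').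
have [gg jj] := partner_unique kg0 kg' q0 qm jom jm' (esym hk') (v_fp hs').
subst e' g'.
(* [y'] meets [e] at its other crossing, hence uses its other end. *)
have d'E : d' = ~~ d.
  by move: (v_i h'); rewrite -ii /io iD /end_crossing e2; case: (d') (d) => [] [].
have dd'E : dd' = ~~ dd.
  by move: (v_j h'); rewrite -jj /jo jD /end_crossing g2; case: (dd') (dd) => [] [].
subst d' dd'.
have k2 := two _ kM; have [tk1 tk2] := mid_ends k2.
have kx := xm k kM; have ky := touches_mid k2 (v_t h').
have meet_k b : (b <= 3)%N -> bpt e io = bpt g b -> False.
  move=> b3 hb; have [io0 _] := le12 ioE.
  have lm : (l <= (ncr k).+1)%N by rewrite k2 leqW //; case: (le12 lE).
  by apply: (bpt3 ek kg0 eg io0 iom lm _ hk (etrans (esym hk) hb)); rewrite g2.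
have eK a : (a <= 3)%N -> Kset sarc (run e 0 3) (bpt e a) by move=> a3; apply: Kset_bpt; rewrite ?e2.
have gK a : (a <= 3)%N -> Kset sarc (run g 0 3) (bpt g a) by move=> a3; apply: Kset_bpt; rewrite ?g2.
have end_real' s : se s = e -> s \in (run e 0 3 :|: run g 0 3)%SET.
  by move=> sE; rewrite !inE sE eqxx /= ltnS; have := si_le s; rewrite sE e2 => ->.
have gr' s : se s = g -> s \in (run e 0 3 :|: run g 0 3)%SET.
  by move=> sE; rewrite !inE sE eqxx orbC /= ltnS; have := si_le s; rewrite sE g2 => ->.
apply: (lens e g 0%N 3%N 0%N 3%N [set sgf f 1%N; sgf k 1%N]%SET (fun z => [\/ z = x, z = y | z = y']) x eg) => //.
- by rewrite e2.
- by rewrite g2.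
- have := v_r h; have := v_r h'; rewrite /end_real e2 g2.
  by case: (d) (dd) => [] [] /= r1 r2; [left|right|right|left].
- move=> a b /andP[_ a3] /andP[_ b3] hab.
  have [->|[->|[ai|ai]]] : a = 0%N \/ a = 3%N \/ a = i \/ a = io by exact: four_cases.
  + by left.
  + by right.
  + by case: (meet_f b b3); rewrite -ai.
  + by case: (meet_k b b3); rewrite -ai.
- by move=> z [] ->.
- move=> z s [] ->.
  + case/xs => + sE; rewrite -ME => /finset.setU1P[kE|/finset.setUP[/finset.set2P[sE'|sE']|/finset.set1P sE']].
    * by right; rewrite !inE sE kE eqxx orbT.
    * by right; rewrite !inE sE sE' eqxx.
    * by left; apply: end_real'.
    * by left; apply: gr'.
  + move/(v_s h) => -[[s1 s2]|[s1 s2]|[s1 s2]].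
    * by right; rewrite !inE (mid_eq f2 s1 s2) eqxx.
    * by left; apply: end_real'.
    * by left; apply: gr'.
  + move/(v_s h') => -[[s1 s2]|[s1 s2]|[s1 s2]].
    * by right; rewrite !inE (mid_eq k2 s1 s2) eqxx orbT.
    * by left; apply: end_real'.
    * by left; apply: gr'.
- move=> t; rewrite !inE => /orP[] /eqP ->.
    rewrite tf1 tf2 fp fq.
    by split; apply: Kset_runU; [left; apply: eK|right; apply: gK]; apply: leqW; [case: (le12 iE)|case: (le12 jE)].
  rewrite tk1 tk2.
  have lK a : a = l \/ a = l' -> Kset sarc (run e 0 3 :|: run g 0 3)%SET (bpt k a).
    by case=> ->; apply: Kset_runU; [left; rewrite -hk; apply: eK|right; rewrite -hk'; apply: gK]; apply: leqW; [case: (le12 ioE)|case: (le12 joE)].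
  by have [? ?] := cover12 lE lE' ll; split; apply: lK.
- move=> t z; rewrite !inE => /orP[] /eqP -> Kz zt.
    have [|] := touches_between Kx Ky nxy fx fy Kz zt.
      by exists x => //; apply: Or31.
    by exists y => //; apply: Or32.
  have [|] := touches_between Kx Ky' nxy' kx ky Kz zt.
    by exists x => //; apply: Or31.
  by exists y' => //; apply: Or33.
- by apply: Or31.
Qed.

Lemma typeV_mult1 x f : ~ K x -> typeV x f -> mult_deg D o c x 1 != 0%N.
Proof.
move=> Kx [p0 [q0 [e0 [g0 [i0 [j0 [d0 [dd0 h0]]]]]]]]; apply/eqP => n1.
have [q [e [g [i [j [d [dd h]]]]]]] := cellV_at h0 (or_introl (erefl 1%N)).
have [p0' pm i0' im] := cellV_cross h; have fe : f != e by rewrite eq_sym (v_ef h).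
have [b hb] : exists b : bool, (0 < mu x e (i.-1 + b))%N.
  exact: (nbr1 (i := 1%N) (a := true) fe p0' pm i0' im (v_fp h) Kx (v_t h)).
have bm : (i.-1 + b <= ncr e)%N by case: (b); lia.
have [e2 m1] := mid_of n1 bm (v_e h) hb; have [s1 s2] := sgfP bm.
move/(mu_touches x bm): hb => /(v_s h); rewrite s1 s2 m1 => -[[ef _]|[_]|[eg _]].
- by case/eqP: (v_ef h).
- by rewrite /end_seg e2; case: (d).
- by case/eqP: (v_eg h).
Qed.

(** * Claims on middle segments *)

Section Claims.
Variables (F : nat) (p : nat -> P2).
Hypothesis rep : face_reps sarc [set: seg]%SET F p.

(** Cells with a vertex take priority: a small face without end segments of crossed edges claims
    only the middle sides that no represented cell of that type claims. *)
Definition claim i f : Prop := typeV (p i) f \/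
  [/\ mult_deg D o c (p i) 1 = 0%N, (weight D o c (p i) <= 9)%N, f \in middles (p i) &
      forall j, (j < F)%N -> ~ typeV (p j) f].
Definition claims i : {set E} := [set f | `[< claim i f >]]%SET.

Lemma claimsP i f : f \in claims i <-> claim i f.
Proof. by rewrite /claims finset.in_set; split=> [/asboolP|h]; [|apply/asboolP]. Qed.

Lemma claims_inj i j f : (i < F)%N -> (j < F)%N -> f \in claims i -> f \in claims j -> i = j.
Proof.
move=> iF jF /claimsP ci /claimsP cj; apply/eqP/negPn/negP => ij.
have nl := rep.2 i j iF jF ij; have Ki := rep.1 i iF; have Kj := rep.1 j jF.
case: ci => [vi|[ni wi mi hi]]; case: cj => [vj|[nj wj mj hj]].
- exact: nl (cellV_linked Ki Kj vi vj).
- exact: hj iF vi.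
- exact: hi jF vj.
- exact: nl (middles_linked Ki Kj ni nj mi mj).
Qed.

Lemma claims_ncr i f : f \in claims i -> ncr f = 2%N.
Proof.
move/claimsP=> [[q [r [e [g [a [b [d [dd h]]]]]]]]|[_ _ + _]]; first exact: v_f h.
by rewrite inE => /andP[/eqP].
Qed.

(** The weights 8, 6, 8, 8 of [small_cases] ask for 1, 2, 1, 1 claims. With two or three middle
    sides no neighbouring cell preempts any of them, since [opposite_middle] would force four; with
    four, either none is preempted or the side opposite to a preempted one is free. *)
Lemma claims_bound i : (i < F)%N -> (10 <= weight D o c (p i) + 2 * #|claims i|)%N.
Proof.
move=> iF; have Ki := rep.1 i iF; set x := p i in Ki *.
case: (leqP (weight D o c x) 9) => [small|big]; last exact: leq_trans (leq_addr _ _).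
have [cM1 cM2] := card_middles x.
have cs := supp_gt2 Ki.
have noV f : mult_deg D o c x 1 = 0%N -> ~ typeV x f by move=> n1 /(typeV_mult1 Ki); rewrite n1.
have adj f j : mult_deg D o c x 1 = 0%N -> f \in middles x -> (j < F)%N -> typeV (p j) f ->
    #|middles x| = 4%N /\ exists h, h \in claims i.
  move=> n1 fM jF vj; have Kj := rep.1 j jF.
  have other k h : (k < F)%N -> typeV (p k) h -> i != k.
    by move=> kF vk; apply/eqP => ik; apply: (noV h n1); rewrite /x ik.
  have [M4 [h hM hh]] := opposite_middle Ki Kj (rep.2 i j iF jF (other j f jF vj)) n1 small fM vj.
  split=> //; exists h; apply/claimsP; right; split=> // k kF vk.
  exact: hh (rep.1 k kF) (rep.2 i k iF kF (other k h kF vk)) vk.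
have full : mult_deg D o c x 1 = 0%N -> (#|middles x| <= 3)%N -> (#|middles x| <= #|claims i|)%N.
  move=> n1 M3; apply/subset_leq_card/fintype.subsetP => f fM; apply/claimsP; right; split=> // j jF vj.
  by have [M4 _] := adj f j n1 fM jF vj; rewrite M4 in M3.
have w := weightE D o c x.
case: (small_cases Ki small) => -[n0 [n1 n2]]; rewrite n0 n1 n2 in w cM1 cM2 adj full *; rewrite {}w.
- have [f vf] := cellV_small Ki n0 n1 n2.
  have : (0 < #|claims i|)%N by apply/card_gt0P; exists f; apply/claimsP; left.
  by clear; lia.
- have := full erefl cM2; move: cs cM1; clear; lia.
- have hc : (0 < #|claims i|)%N.
    case: (pselect (exists f j, [/\ f \in middles x, (j < F)%N & typeV (p j) f])) => [[f [j [fM jF vj]]]|hn].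
      by have [_ [h hh]] := adj f j erefl fM jF vj; apply/card_gt0P; exists h.
    have /card_gt0P [f fM] : (0 < #|middles x|)%N by move: cs cM1; clear; lia.
    apply/card_gt0P; exists f; apply/claimsP; right; split=> // j jF vj.
    by apply: hn; exists f, j.
  by move: hc; clear; lia.
- have := full erefl (leqW cM2); move: cs cM1; clear; lia.
Qed.

End Claims.

Lemma sum_real_ends : (\sum_(s : seg) (2 + real_ends s) = \sum_e (2 * (ncr e).+1 + 2))%N.
Proof.
rewrite (sum_seg c_size bigE); apply: eq_bigr => e _.
have key (i : 'I_(ncr e).+1) : real_ends (sgf e i) = ((i == 0 :> nat) + (i == ncr e :> nat))%N.
  by have [h1 h2] := sgfP (ltn_ord i : (i <= ncr e)%N); rewrite /real_ends h1 h2.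
rewrite (eq_bigr (fun i : 'I_(ncr e).+1 => 2 + ((i == 0 :> nat) + (i == ncr e :> nat)))%N) => [|i _]; last by rewrite key.
have := ncr_le2 c_size e; case: (ncr e) => [|[|[|//]]] _; by rewrite !big_ord_recr !big_ord0.
Qed.

Lemma card_seg : (#|{: seg}| = \sum_e (ncr e).+1)%N.
Proof.
rewrite -sum1_card (sum_seg c_size bigE); apply: eq_bigr => e _.
by rewrite sum_nat_const card_ord muln1.
Qed.

Lemma claims_total F p : face_reps sarc [set: seg]%SET F p ->
  (\sum_(i < F) #|claims F p i| <= \sum_e (ncr e == 2))%N.
Proof.
move=> rep.
rewrite (eq_bigr (fun i : 'I_F => \sum_e (e \in claims F p i))%N) => [|i _]; last first.
  by rewrite -sum1_card big_mkcond; apply: eq_bigr => e _; case: (_ \in _).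
rewrite exchange_big; apply: leq_sum => e _ /=.
case: (pselect (exists i : 'I_F, e \in claims F p i)) => [[i ei]|hn]; last first.
  by rewrite big1 // => i _; apply/eqP; rewrite eqb0; apply/negP => ei; apply: hn; exists i.
rewrite (claims_ncr ei) (bigD1 i) //= ei big1 // => j ji.
apply/eqP; rewrite eqb0; apply: contraNN ji => ej.
by apply/eqP/val_inj; exact: (claims_inj rep (ltn_ord j) (ltn_ord i) ej ei).
Qed.

Theorem edge_bound : (2 * #|E| + 20 <= 10 * #|V|)%N.
Proof.
have n1 : (1 < #|{: node D o c}|)%N.
  have [s _] := seg_ex0 c_size bigE.
  rewrite (cardD1 (ssrc s)) inE /= ltnS; apply/card_gt0P; exists (stgt s).
  by rewrite !inE andbT; apply/eqP => h; case: (@ssrc_neq_tgt s).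
have [F [p [rep hF]]] := many_faces G (planar_connected isD c_size v0 hconn hV) n1.
pose nn := #|{: node D o c}|.
have hN : (2 * nn <= 2 * #|V| + \sum_e ncr e)%N by exact: card_node cP.
have {}hF : (#|{: seg}| + 2 <= F + nn)%N by exact: hF.
have wF : (10 * F <= \sum_(i < F) weight D o c (p i) + 2 * \sum_(i < F) #|claims F p i|)%N.
  rewrite big_distrr -big_split /= mulnC -[F in leqLHS]card_ord -sum_nat_const.
  by apply: leq_sum => i _; exact: claims_bound rep _ (ltn_ord i).
have wS : (\sum_(i < F) weight D o c (p i) <= 2 * \sum_(s : seg) (2 + real_ends s))%N.
  rewrite /weight exchange_big big_distrr /=; apply: leq_sum => s _.
  by rewrite -big_distrl /= leq_mul2r (sum_mult_le2 G s rep) orbT.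
have wC := claims_total rep.
have sE k : (\sum_(e : E) k = k * #|E|)%N by rewrite sum_nat_const mulnC.
have e1 : (\sum_e (2 * (ncr e).+1 + 2) = 2 * \sum_e ncr e + 4 * #|E|)%N.
  by rewrite -sE big_distrr -big_split /=; apply: eq_bigr => e _; lia.
have e2 : (\sum_e (ncr e).+1 = \sum_e ncr e + #|E|)%N.
  by rewrite -[#|E|]mul1n -sE -big_split /=; apply: eq_bigr => e _; rewrite addn1.
have e3 : (2 * \sum_e (ncr e == 2) <= \sum_e ncr e)%N.
  by rewrite big_distrr /=; apply: leq_sum => e _; case: eqP => [->|].
rewrite sum_real_ends e1 in wS; rewrite card_seg e2 in hF.
move: hF hN wF wS wC e3; move: nn => nn; clear.
move: (\sum_e ncr e)%N (\sum_e (ncr e == 2%N))%N (\sum_(i < F) weight D o c (p i))%N (\sum_(i < F) #|claims F p i|)%N => a b x y.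
move: #|E| #|V| => m n; lia.
Qed.

End Cells.

Theorem theorem33 (R : realType) (n : nat) (V E : finType) (ends : E -> V * V) :
  (3 <= n)%N -> #|V| = n -> loopless ends -> mg_connected ends ->
  non_homotopic_k_planar R ends 2 ->
  (#|E| <= 5 * n - 10)%N.
Proof.
move=> n3 Vn _ hconn [D [isD [nh kp]]].
(* With at most three edges the bound holds because [5 n - 10 >= 5]. More edges guarantee more than
   three segments, on which [supp_nonsep] relies. *)
have [bigE|smallE] := ltnP 3 #|E|; last by lia.
have hV : (1 < #|V|)%N by rewrite Vn; exact: ltnW.
have [v0 _] : exists v0 : V, v0 \in V by apply/card_gt0P; exact: ltnW.
have [z [so ov oe]] := off_drawing isD v0.
have [c hc] := crossing_params (o := z) isD so oe kp.
have := @edge_bound R V E ends D z isD so ov oe c (fun e => let: And3 h _ _ := hc e in h)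
  (fun e => let: And3 _ h _ := hc e in h) (fun e => let: And3 _ _ h := hc e in h) v0 hconn hV nh bigE.
lia.
Qed.
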